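(* Let $k$ be a commutative ring, $A,B$ be $k$-algebras, $\mathfrak{C}$ an $A$-coring and $\mathfrak{D}$ a $B$-coring such that ${}_A\mathfrak{C}$ and ${}_B\mathfrak{D}$ are flat. Let $X\in{}^{\mathfrak{C}}\mathcal{M}^{\mathfrak{D}}$ and $\Lambda\in{}^{\mathfrak{D}}\mathcal{M}^{\mathfrak{C}}$ be bicomodules. The following statements are equivalent: (i) $(-\square_{\mathfrak{C}}X,\,-\square_{\mathfrak{D}}\Lambda)$ is a Frobenius pair (of functors between $\mathcal{M}^{\mathfrak{C}}$ and $\mathcal{M}^{\mathfrak{D}}$); (ii) $-\square_{\mathfrak{C}}X:\mathcal{M}^{\mathfrak{C}}\to\mathcal{M}^{\mathfrak{D}}$ is a Frobenius functor, and $\mathrm{h}_{\mathfrak{D}}(X,\mathfrak{D})\simeq\Lambda$ as $(\mathfrak{D},\mathfrak{C})$-bicomodules; (iii) there is a Frobenius pair $(F,G)$ of $k$-linear functors $F:\mathcal{M}^{\mathfrak{C}}\to\mathcal{M}^{\mathfrak{D}}$, $G:\mathcal{M}^{\mathfrak{D}}\to\mathcal{M}^{\mathfrak{C}}$ such that $F(\mathfrak{C})\simeq X$ and $G(\mathfrak{D})\simeq\Lambda$ as bicomodules; (iv) $\Lambda$ is quasi-finite and injector as a right $\mathfrak{C}$-comodule, $X$ is quasi-finite and injector as a right $\mathfrak{D}$-comodule, and $X\simeq\mathrm{h}_{\mathfrak{C}}(\Lambda,\mathfrak{C})$ and $\Lambda\simeq\mathrm{h}_{\mathfrak{D}}(X,\mathfrak{D})$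 as bicomodules; (v) $\Lambda$ is quasi-finite as a right $\mathfrak{C}$-comodule, $X$ is quasi-finite as a right $\mathfrak{D}$-comodule, and there are natural isomorphisms $-\square_{\mathfrak{C}}X\simeq\mathrm{h}_{\mathfrak{C}}(\Lambda,-)$ and $-\square_{\mathfrak{D}}\Lambda\simeq\mathrm{h}_{\mathfrak{D}}(X,-)$.
   Context: Algebras are associative and unital. An $A$-coring is an $A$-bimodule $\mathfrak{C}$ with $A$-bimodule maps $\Delta_{\mathfrak C}:\mathfrak{C}\to\mathfrak{C}\otimes_A\mathfrak{C}$ (coassociative) and $\epsilon_{\mathfrak C}:\mathfrak{C}\to A$ (counit). A right $\mathfrak{C}$-comodule is a right $A$-module $M$ with a coassociative, counital right $A$-linear coaction $\rho_M:M\to M\otimes_A\mathfrak{C}$; category $\mathcal{M}^{\mathfrak{C}}$. Left comodules (${}^{\mathfrak C}\mathcal M$, coaction $\lambda$) are symmetric. A $(\mathfrak{C},\mathfrak{D})$-bicomodule (category ${}^{\mathfrak{C}}\mathcal{M}^{\mathfrak{D}}$) is an $(A,B)$-bimodule that is a left $\mathfrak{C}$-comodule with $B$-linear coaction $\lambda$ and a right $\mathfrak{D}$-comodule with $A$-linear coaction $\rho$, with $(\lambda\otimes_B\mathfrak{D})\rho=(\mathfrak{C}\otimes_A\rho)\lambda$. Cotensor product: $M\square_{\mathfrak{C}}N=\ker(\rho_M\otimes_AN-M\otimes_A\lambda_N: M\otimes_AN\to M\otimes_A\mathfrak{C}\otimes_AN)$. If ${}_B\mathfrak{D}$ is flat and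 $N\in{}^{\mathfrak C}\mathcal M^{\mathfrak D}$, then $-\square_{\mathfrak C}N:\mathcal M^{\mathfrak C}\to\mathcal M^{\mathfrak D}$ is a functor. A pair of functors $(F,G)$ is a Frobenius pair if $G$ is both a left and a right adjoint of $F$; then $F$ and $G$ are called Frobenius functors. $N\in{}^{\mathfrak C}\mathcal M^{\mathfrak D}$ is quasi-finite as a right $\mathfrak D$-comodule if $-\otimes_AN:\mathcal M_A\to\mathcal M^{\mathfrak D}$ has a left adjoint $\mathrm h_{\mathfrak D}(N,-)$ (cohom functor), with unit $\theta_Y:Y\to \mathrm h_{\mathfrak D}(N,Y)\otimes_AN$. Then $\mathrm h_{\mathfrak D}(N,Y)$ is a right $\mathfrak C$-comodule via the unique right $A$-linear map $\rho$ with $(\rho\otimes_AN)\theta_Y=(\mathrm h_{\mathfrak D}(N,Y)\otimes_A\lambda_N)\theta_Y$, so $\mathrm h_{\mathfrak D}(N,-)$ is also regarded as a functor $\mathcal M^{\mathfrak D}\to\mathcal M^{\mathfrak C}$. $N$ is injector as a right $\mathfrak D$-comodule if $-\otimes_AN:\mathcal M_A\to\mathcal M^{\mathfrak D}$ preserves injective objects. If $F:\mathcal M^{\mathfrak D}\to\mathcal M^{\mathfrak C}$ is $k$-linear and preserves inductive limits (e.g. a left adjoint), then $F(\mathfrak D)$ is a $(\mathfrak D,\mathfrak C)$-bicomodule: the left $B$-action is induced by functoriality, and the left coaction is $F(\Delta_{\mathfrak D}):F(\mathfrak D)\to F(\mathfrak D\otimes_B\mathfrak D)\simeq\mathfrak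 D\otimes_BF(\mathfrak D)$ (canonical isomorphism). In particular $\mathrm h_{\mathfrak D}(N,\mathfrak D)$ is a $(\mathfrak D,\mathfrak C)$-bicomodule. *)

(* Defs.v *)
From HB Require Import structures.
From mathcomp Require Import all_boot all_algebra.
From mathcomp Require Import boolp.

Set Implicit Arguments.
Unset Strict Implicit.
Unset Printing Implicit Defensive.

Import GRing.Theory.
Local Open Scope ring_scope.
Local Open Scope quotient_scope.

Reserved Notation "a *> x" (at level 40, left associativity).
Reserved Notation "x <* b" (at level 40, left associativity).
Reserved Notation "x ⊗ y" (at level 39, left associativity).
Reserved Notation "M ⨂ N" (at level 39, left associativity).

(* The base ring k acts symmetrically (last field). Consequently a right
   B-module is the same thing as a bimodule over (k, B), where k is regarded as
   the algebra k^o: the left k-action carries no further data. *)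
Record bimod (k : comNzRingType) (A B : algType k) := Bimod {
  bcar :> zmodType;
  lact : A -> bcar -> bcar;
  ract : bcar -> B -> bcar;
  lactDr : forall a, {morph lact a : x y / x + y};
  lactDl : forall x, {morph lact^~ x : a b / a + b};
  lact1 : forall x, lact 1 x = x;
  lactM : forall a b x, lact (a * b) x = lact a (lact b x);
  ractDl : forall b, {morph ract^~ b : x y / x + y};
  ractDr : forall x, {morph ract x : a b / a + b};
  ract1 : forall x, ract x 1 = x;
  ractM : forall x a b, ract x (a * b) = ract (ract x a) b;
  lractA : forall a x b, ract (lact a x) b = lact a (ract x b);
  ksym : forall (c : k) x, lact c%:A x = ract x c%:A }.

Notation "a *> x" := (lact a x) : ring_scope.
Notation "x <* b" := (ract x b) : ring_scope.

Lemma morphD0 (V W : zmodType) (f : V -> W) : {morph f : x y / x + y} -> f 0 = 0.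
Proof. by move=> fD; apply: (addrI (f 0)); rewrite -fD !addr0. Qed.

Lemma morphDN (V W : zmodType) (f : V -> W) :
  {morph f : x y / x + y} -> {morph f : x / - x}.
Proof.
by move=> fD x; apply: (addrI (f x)); rewrite -fD !subrr (morphD0 fD).
Qed.

Section BimodTheory.
Variables (k : comNzRingType) (A B : algType k) (M : bimod A B).
Lemma lact0 a : a *> (0 : M) = 0. Proof. exact: morphD0 (@lactDr _ _ _ M a). Qed.
Lemma ract0 b : (0 : M) <* b = 0.
Proof. exact: morphD0 (@ractDl _ _ _ M b). Qed.
Lemma lactN a : {morph @lact _ _ _ M a : x / - x}.
Proof. exact: morphDN (@lactDr _ _ _ M a). Qed.
Lemma ractN b : {morph (@ract _ _ _ M)^~ b : x / - x}.
Proof. exact: morphDN (@ractDl _ _ _ M b). Qed.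
End BimodTheory.

(* Right linear maps; the left algebras of source and target may differ. *)
Record rhom (k : comNzRingType) (E E' B : algType k)
    (M : bimod E B) (N : bimod E' B) := RHom {
  rfun :> M -> N;
  rfunD : {morph rfun : x y / x + y};
  rfunr : forall b, {morph rfun : x / x <* b} }.

Record bhom (k : comNzRingType) (A B : algType k) (M N : bimod A B) := BHom {
  brh :> rhom M N;
  rfunl : forall a, {morph brh : x / a *> x} }.

Section RHom.
Variables (k : comNzRingType) (E E' E'' B : algType k).
Variables (M : bimod E B) (N : bimod E' B) (P : bimod E'' B).

Lemma rhom_ext (f g : rhom M N) : f =1 g -> f = g.
Proof.
case: f g => [f fD fr] [g gD gr] /= /funext efg.
by case: _ / efg in gD gr *; congr RHom; exact: Prop_irrelevance.
Qed.

Lemma rfun0 (f : rhom M N) : f 0 = 0.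
Proof. exact: morphD0 (@rfunD _ _ _ _ _ _ f). Qed.
Lemma rfunN (f : rhom M N) : {morph f : x / - x}.
Proof. exact: morphDN (@rfunD _ _ _ _ _ _ f). Qed.

Definition rid : rhom M M :=
  @RHom _ _ _ _ M M (fun x => x) (fun _ _ => erefl) (fun _ _ => erefl).

Lemma rcomp_subproofD (g : rhom N P) (f : rhom M N) : {morph g \o f : x y / x + y}.
Proof. by move=> x y /=; rewrite !rfunD. Qed.
Lemma rcomp_subproofr (g : rhom N P) (f : rhom M N) b : {morph g \o f : x / x <* b}.
Proof. by move=> x /=; rewrite !rfunr. Qed.
Definition rcomp (g : rhom N P) (f : rhom M N) : rhom M P :=
  RHom (rcomp_subproofD g f) (rcomp_subproofr g f).
End RHom.
Arguments rid {k E B} M.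

Definition bid (k : comNzRingType) (A B : algType k) (M : bimod A B) : bhom M M :=
  @BHom _ _ _ M M (rid M) (fun _ _ => erefl).

Lemma bhom_ext (k : comNzRingType) (A B : algType k) (M N : bimod A B)
  (f g : bhom M N) : f =1 g -> f = g.
Proof.
case: f g => [f fl] [g gl] /= /rhom_ext efg.
by case: _ / efg in gl *; congr BHom; exact: Prop_irrelevance.
Qed.

(* M ⨂ N consists of the finite formal sums of pairs (m, n), two of them being
   identified when every B-balanced biadditive map takes the same value on them. *)
Section Tensor.
Variables (k : comNzRingType) (A B C : algType k).
Variables (M : bimod A B) (N : bimod B C).

Definition balanced (V : zmodType) (phi : M -> N -> V) : Prop :=
  [/\ forall n, {morph phi^~ n : x y / x + y},
      forall m, {morph phi m : x y / x + y}
    & forall m b n, phi (m <* b) n = phi m (b *> n)].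

Definition teval (V : zmodType) (phi : M -> N -> V) (s : seq (M * N)) : V :=
  \sum_(p <- s) phi p.1 p.2.

Definition tequiv (s t : seq (M * N)) : bool :=
  `[< forall (V : zmodType) (phi : M -> N -> V),
        balanced phi -> teval phi s = teval phi t >].

Lemma tequiv_refl : reflexive tequiv. Proof. by move=> s; apply/asboolP. Qed.
Lemma tequiv_sym : symmetric tequiv.
Proof. by move=> s t; apply/asboolP/asboolP => H V p b; rewrite H. Qed.
Lemma tequiv_trans : transitive tequiv.
Proof.
by move=> t s u /asboolP H /asboolP K; apply/asboolP => V p b; rewrite H// K.
Qed.
Canonical tequiv_equiv := EquivRel tequiv tequiv_refl tequiv_sym tequiv_trans.

Definition tens := {eq_quot tequiv}.
HB.instance Definition _ := Choice.on tens.
HB.instance Definition _ := EqQuotient.on tens.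

Definition tlift (V : zmodType) (phi : M -> N -> V) (x : tens) : V :=
  teval phi (repr x).

Lemma tens_eqP (x y : tens) :
  (forall V phi, @balanced V phi -> tlift phi x = tlift phi y) -> x = y.
Proof.
move=> H; rewrite -[x]reprK -[y]reprK; apply/eqmodP/asboolP => V p b.
exact: H.
Qed.

Lemma tlift_pi V phi s : @balanced V phi -> tlift phi (\pi_tens s) = teval phi s.
Proof.
move=> b; rewrite /tlift.
have /eqmodP/asboolP : repr (\pi_tens s) = s %[mod tens] by rewrite reprK.
exact.
Qed.

Definition tzero : tens := \pi_tens [::].
Definition tadd (x y : tens) : tens := \pi_tens (repr x ++ repr y).
Definition topp (x : tens) : tens := \pi_tens [seq (- p.1, p.2) | p <- repr x].
Definition ten (m : M) (n : N) : tens := \pi_tens [:: (m, n)].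

Lemma tlift_tadd V phi : @balanced V phi -> {morph tlift phi : x y / tadd x y >-> x + y}.
Proof. by move=> b x y; rewrite tlift_pi// /teval big_cat. Qed.
Lemma tlift_topp V phi : @balanced V phi -> {morph tlift phi : x / topp x >-> - x}.
Proof.
move=> b x; rewrite tlift_pi// /teval big_map -sumrN; apply: eq_bigr => -[m n] _ /=.
by case: b => bl _ _; exact: morphDN (bl n) m.
Qed.
Lemma tlift_tzero V phi : @balanced V phi -> tlift phi tzero = 0.
Proof. by move=> b; rewrite tlift_pi// /teval big_nil. Qed.
Lemma tlift_ten V phi m n : @balanced V phi -> tlift phi (ten m n) = phi m n.
Proof. by move=> b; rewrite tlift_pi// /teval big_seq1. Qed.

Lemma taddA : associative tadd.
Proof. by move=> x y z; apply: tens_eqP => V p b; rewrite !tlift_tadd// addrA. Qed.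
Lemma taddC : commutative tadd.
Proof. by move=> x y; apply: tens_eqP => V p b; rewrite !tlift_tadd// addrC. Qed.
Lemma tadd0 : left_id tzero tadd.
Proof.
by move=> x; apply: tens_eqP => V p b; rewrite tlift_tadd// tlift_tzero// add0r.
Qed.
Lemma taddN : left_inverse tzero topp tadd.
Proof.
move=> x; apply: tens_eqP => V p b.
by rewrite tlift_tadd// tlift_topp// tlift_tzero// addNr.
Qed.
HB.instance Definition _ := GRing.isZmodule.Build tens taddA taddC tadd0 taddN.

Lemma tliftD V phi : @balanced V phi -> {morph tlift phi : x y / x + y}.
Proof. exact: tlift_tadd. Qed.
Lemma tlift0 V phi : @balanced V phi -> tlift phi 0 = 0.
Proof. exact: tlift_tzero. Qed.

Lemma tenDl n : {morph ten^~ n : x y / x + y}.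
Proof.
move=> x y; apply: tens_eqP => V p b.
by rewrite tliftD// !tlift_ten//; case: b => ->.
Qed.
Lemma tenDr m : {morph ten m : x y / x + y}.
Proof.
move=> x y; apply: tens_eqP => V p b.
by rewrite tliftD// !tlift_ten//; case: b => _ ->.
Qed.
Lemma tenM m b n : ten (m <* b) n = ten m (b *> n).
Proof. by apply: tens_eqP => V p bal; rewrite !tlift_ten//; case: bal. Qed.

Lemma ten0l n : ten 0 n = 0. Proof. exact: morphD0 (tenDl n). Qed.
Lemma ten0r m : ten m 0 = 0. Proof. exact: morphD0 (tenDr m). Qed.

Lemma tens_ind (P : tens -> Prop) :
  (forall m n, P (ten m n)) -> (forall x y, P x -> P y -> P (x + y)) -> P 0 ->
  forall x, P x.
Proof.
move=> Pten PD P0 x; rewrite -[x]reprK.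
elim: (repr x) => [//|[m n] s IHs].
suff -> : \pi_tens ((m, n) :: s) = ten m n + \pi_tens s by apply: PD.
apply: tens_eqP => V p b.
by rewrite tliftD// tlift_ten// !tlift_pi// /teval big_cons.
Qed.

Definition tlact (a : A) : tens -> tens := tlift (fun m n => ten (a *> m) n).
Definition tract (t : tens) (c : C) : tens := tlift (fun m n => ten m (n <* c)) t.

Lemma tlact_bal a : balanced (fun m n => ten (a *> m) n).
Proof.
split=> [n m m'|m n n'|m b n]; rewrite ?lactDr ?tenDl ?tenDr//.
by rewrite -lractA tenM.
Qed.
Lemma tract_bal c : balanced (fun m n => ten m (n <* c)).
Proof.
split=> [n m m'|m n n'|m b n]; rewrite ?ractDl ?tenDl ?tenDr//.
by rewrite tenM lractA.
Qed.
Lemma tlactE a m n : tlact a (ten m n) = ten (a *> m) n.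
Proof. by rewrite /tlact tlift_ten//; exact: tlact_bal. Qed.
Lemma tractE m n c : tract (ten m n) c = ten m (n <* c).
Proof. by rewrite /tract tlift_ten//; exact: tract_bal. Qed.
Lemma tlactDr a : {morph tlact a : x y / x + y}.
Proof. exact: tliftD (tlact_bal a). Qed.
Lemma tractDl c : {morph tract^~ c : x y / x + y}.
Proof. exact: tliftD (tract_bal c). Qed.
Lemma tlact0 a : tlact a 0 = 0. Proof. exact: tlift0 (tlact_bal a). Qed.
Lemma tract0 c : tract 0 c = 0. Proof. exact: tlift0 (tract_bal c). Qed.

Ltac tind0 x := elim/tens_ind: x;
  [ by move=> m n; rewrite ?(tlactE, tractE) ?(lactDl, ractDr, lact1, ract1, lactM, ractM)
      ?(tenDl, tenDr)
  | let h := fresh in let h' := fresh in move=> ? ? h h';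
    rewrite ?(tlactDr, tractDl) ?h ?h' //
  | by rewrite ?(tlact0, tract0) ?addr0 ].

Lemma tlactDl x : {morph tlact^~ x : a b / a + b}.
Proof. by move=> a b; tind0 x; rewrite addrACA. Qed.
Lemma tlact1 x : tlact 1 x = x.
Proof. by tind0 x. Qed.
Lemma tlactM a b x : tlact (a * b) x = tlact a (tlact b x).
Proof. by tind0 x. Qed.
Lemma tractDr x : {morph tract x : a b / a + b}.
Proof. by move=> a b; tind0 x; rewrite addrACA. Qed.
Lemma tract1 x : tract x 1 = x.
Proof. by tind0 x. Qed.
Lemma tractM x a b : tract x (a * b) = tract (tract x a) b.
Proof. by tind0 x. Qed.
Lemma tlractA a x b : tract (tlact a x) b = tlact a (tract x b).
Proof. by tind0 x. Qed.
Lemma tksym (c : k) x : tlact c%:A x = tract x c%:A.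
Proof.
elim/tens_ind: x => [m n|x y hx hy|]; first by rewrite tlactE tractE ksym tenM ksym.
  by rewrite tlactDr tractDl hx hy.
by rewrite tlact0 tract0.
Qed.

Definition tensb : bimod A C :=
  Bimod tlactDr tlactDl tlact1 tlactM tractDl tractDr tract1 tractM tlractA tksym.

End Tensor.

Notation "M ⨂ N" := (tensb M N) : ring_scope.

(* Pure tensors, with the bimodule M ⨂ N visible in their type. *)
Definition pten (k : comNzRingType) (A B C : algType k)
  (M : bimod A B) (N : bimod B C) (m : M) (n : N) : M ⨂ N := ten m n.
Notation "x ⊗ y" := (pten x y) : ring_scope.

Section TensorTheory.
Variables (k : comNzRingType) (A B C : algType k).
Variables (M : bimod A B) (N : bimod B C).

Lemma tensDl (m m' : M) (n : N) : (m + m') ⊗ n = m ⊗ n + m' ⊗ n.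
Proof. exact: tenDl. Qed.
Lemma tensDr (m : M) (n n' : N) : m ⊗ (n + n') = m ⊗ n + m ⊗ n'.
Proof. exact: tenDr. Qed.
Lemma tens0l (n : N) : (0 : M) ⊗ n = 0. Proof. exact: ten0l. Qed.
Lemma tens0r (m : M) : m ⊗ (0 : N) = 0. Proof. exact: ten0r. Qed.
Lemma tensM (m : M) b (n : N) : (m <* b) ⊗ n = m ⊗ (b *> n).
Proof. exact: tenM. Qed.
Lemma lact_ten a (m : M) (n : N) : a *> (m ⊗ n) = (a *> m) ⊗ n.
Proof. exact: tlactE. Qed.
Lemma ract_ten (m : M) (n : N) c : (m ⊗ n) <* c = m ⊗ (n <* c).
Proof. exact: tractE. Qed.
Lemma tensb_ind (P : M ⨂ N -> Prop) :
  (forall m n, P (m ⊗ n)) -> (forall x y, P x -> P y -> P (x + y)) -> P 0 ->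
  forall x, P x.
Proof. exact: tens_ind. Qed.
Lemma tens_liftD (V : zmodType) (phi : M -> N -> V) : balanced phi ->
  {morph (tlift phi : M ⨂ N -> V) : x y / x + y}.
Proof. exact: tliftD. Qed.
Lemma tens_lift0 (V : zmodType) (phi : M -> N -> V) : balanced phi ->
  tlift phi (0 : M ⨂ N) = 0.
Proof. exact: tlift0. Qed.
Lemma tens_liftE (V : zmodType) (phi : M -> N -> V) m n : balanced phi ->
  tlift phi (m ⊗ n) = phi m n.
Proof. exact: tlift_ten. Qed.
End TensorTheory.

Ltac tens_elim t := elim/tensb_ind: t;
  [ | let h := fresh in let h' := fresh in move=> ? ? h h';
      by rewrite ?(rfunD, tensDl, tensDr, lactDr, ractDl) ?h ?h' ?addr0
    | by rewrite ?(rfun0, tens0l, tens0r, lact0, ract0) ?addr0 ].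

(* A balanced map that respects the outer actions is a morphism out of M ⨂ N. *)
Section TensorMorphisms.
Variables (k : comNzRingType) (A A' B C : algType k).
Variables (M : bimod A B) (N : bimod B C) (P : bimod A' C) (phi : M -> N -> P).
Hypotheses (bal : balanced phi) (phir : forall m n c, phi m (n <* c) = phi m n <* c).

Lemma tens_liftr c : {morph (tlift phi : M ⨂ N -> P) : x / x <* c}.
Proof.
elim/tensb_ind => [m n|x y hx hy|].
- by rewrite ract_ten !tens_liftE.
- by rewrite ractDl !tens_liftD// hx hy ractDl.
- by rewrite ract0 !tens_lift0// ract0.
Qed.
Definition tens_rhom : rhom (M ⨂ N) P := RHom (tens_liftD bal) tens_liftr.
Lemma tens_rhomE m n : tens_rhom (m ⊗ n) = phi m n. Proof. exact: tens_liftE. Qed.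
End TensorMorphisms.

Section TensorBimorphisms.
Variables (k : comNzRingType) (A B C : algType k).
Variables (M : bimod A B) (N : bimod B C) (P : bimod A C) (f : rhom (M ⨂ N) P).
Hypothesis fl : forall a m n, f ((a *> m) ⊗ n) = a *> f (m ⊗ n).
Lemma tens_bhom_subproof a : {morph f : x / a *> x}.
Proof. by move=> x; tens_elim x => m n; rewrite lact_ten fl. Qed.
Definition tens_bhom : bhom (M ⨂ N) P := BHom tens_bhom_subproof.
End TensorBimorphisms.

Section TMap.
Variables (k : comNzRingType) (A A' B C : algType k).
Variables (M : bimod A B) (M' : bimod A' B) (N N' : bimod B C).

Lemma tmap_bal (f : rhom M M') (g : bhom N N') :
  balanced (fun m n => f m ⊗ g n).
Proof.
split=> [n m m'|m n n'|m b n]; rewrite ?rfunD ?tensDl ?tensDr//.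
by rewrite rfunr rfunl; exact: tensM.
Qed.
Lemma tmap_r (f : rhom M M') (g : bhom N N') m n c :
  f m ⊗ g (n <* c) = (f m ⊗ g n) <* c.
Proof. by rewrite rfunr ract_ten. Qed.
Definition tmap (f : rhom M M') (g : bhom N N') : rhom (M ⨂ N) (M' ⨂ N') :=
  tens_rhom (tmap_bal f g) (tmap_r f g).
Lemma tmapE f g (m : M) (n : N) : tmap f g (m ⊗ n) = f m ⊗ g n.
Proof. exact: tens_rhomE. Qed.
End TMap.

Section BMap.
Variables (k : comNzRingType) (A B C : algType k).
Variables (M M' : bimod A B) (N N' : bimod B C).
Lemma bmap_subproof (f : bhom M M') (g : bhom N N') a m n :
  tmap f g ((a *> m) ⊗ n) = a *> tmap f g (m ⊗ n).
Proof. by rewrite !tmapE rfunl lact_ten. Qed.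
Definition bmap (f : bhom M M') (g : bhom N N') : bhom (M ⨂ N) (M' ⨂ N') :=
  tens_bhom (bmap_subproof f g).
End BMap.

Section Assoc.
Variables (k : comNzRingType) (A B C D : algType k).
Variables (M : bimod A B) (N : bimod B C) (P : bimod C D).

Lemma tassoc_bal0 (p : P) : balanced (fun (m : M) (n : N) => m ⊗ (n ⊗ p)).
Proof.
split=> [n m m'|m n n'|m b n]; rewrite ?tensDl ?tensDr//.
by rewrite tensM lact_ten.
Qed.
Lemma tassoc_bal :
  balanced (fun (x : M ⨂ N) (p : P) =>
    tlift (fun (m : M) (n : N) => m ⊗ (n ⊗ p)) x).
Proof.
split=> [p x y|x p p'|x c p]; first exact: tens_liftD (tassoc_bal0 p) x y.
- elim/tensb_ind: x => [m n|x y hx hy|].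
  + by rewrite !tens_liftE//; first rewrite !tensDr//; exact: tassoc_bal0.
  + by rewrite !(tens_liftD (tassoc_bal0 _)) hx hy addrACA.
  + by rewrite !(tens_lift0 (tassoc_bal0 _)) addr0.
- elim/tensb_ind: x => [m n|x y hx hy|].
  + rewrite ract_ten !tens_liftE ?tensM//; exact: tassoc_bal0.
  + by rewrite ractDl !(tens_liftD (tassoc_bal0 _)) hx hy.
  + by rewrite ract0 !(tens_lift0 (tassoc_bal0 _)).
Qed.
Lemma tassoc_r (x : M ⨂ N) (p : P) d :
  tlift (fun (m : M) (n : N) => m ⊗ (n ⊗ (p <* d))) x =
  (tlift (fun (m : M) (n : N) => m ⊗ (n ⊗ p)) x) <* d.
Proof.
elim/tensb_ind: x => [m n|x y hx hy|].
- by rewrite !tens_liftE ?ract_ten//; exact: tassoc_bal0.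
- by rewrite !(tens_liftD (tassoc_bal0 _)) hx hy ractDl.
- by rewrite !(tens_lift0 (tassoc_bal0 _)) ract0.
Qed.
Definition tassocr : rhom ((M ⨂ N) ⨂ P) (M ⨂ (N ⨂ P)) :=
  tens_rhom tassoc_bal tassoc_r.
Lemma tassocrE m n p : tassocr ((m ⊗ n) ⊗ p) = m ⊗ (n ⊗ p : N ⨂ P).
Proof. by rewrite /= !tens_liftE//; [exact: tassoc_bal0|exact: tassoc_bal]. Qed.
Lemma tassoc_l a (x : M ⨂ N) p : tassocr ((a *> x) ⊗ p) = a *> tassocr (x ⊗ p).
Proof. by tens_elim x => m n; rewrite lact_ten !tassocrE lact_ten. Qed.
Definition tassoc : bhom ((M ⨂ N) ⨂ P) (M ⨂ (N ⨂ P)) := tens_bhom tassoc_l.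
Lemma tassocE m n p : tassoc ((m ⊗ n) ⊗ p) = m ⊗ (n ⊗ p : N ⨂ P).
Proof. exact: tassocrE. Qed.

Lemma tassocV_bal0 (m : M) : balanced (fun (n : N) (p : P) => (m ⊗ n) ⊗ p).
Proof.
split=> [p n n'|n p p'|n b p]; rewrite ?(tensDl, tensDr)//.
by rewrite -ract_ten tensM.
Qed.
Lemma tassocV_bal :
  balanced (fun (m : M) (x : N ⨂ P) =>
    tlift (fun (n : N) (p : P) => (m ⊗ n) ⊗ p) x).
Proof.
split=> [x m m'|m x y|m b x]; last 1 first.
- elim/tensb_ind: x => [n p|x y hx hy|].
  + rewrite lact_ten !tens_liftE ?tensM//; exact: tassocV_bal0.
  + by rewrite lactDr !(tens_liftD (tassocV_bal0 _)) hx hy.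
  + by rewrite lact0 !(tens_lift0 (tassocV_bal0 _)).
- elim/tensb_ind: x => [n p|x y hx hy|].
  + by rewrite !tens_liftE//; first rewrite !tensDl//; exact: tassocV_bal0.
  + by rewrite !(tens_liftD (tassocV_bal0 _)) hx hy addrACA.
  + by rewrite !(tens_lift0 (tassocV_bal0 _)) addr0.
- exact: tens_liftD (tassocV_bal0 m) x y.
Qed.
Lemma tassocV_r (m : M) (x : N ⨂ P) d :
  tlift (fun (n : N) (p : P) => (m ⊗ n) ⊗ p) (x <* d) =
  (tlift (fun (n : N) (p : P) => (m ⊗ n) ⊗ p) x) <* d.
Proof. by apply: tens_liftr => [|n p c]; [exact: tassocV_bal0|rewrite ract_ten]. Qed.
Definition tassocVr : rhom (M ⨂ (N ⨂ P)) ((M ⨂ N) ⨂ P) :=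
  tens_rhom tassocV_bal tassocV_r.
Lemma tassocVrE m n p : tassocVr (m ⊗ (n ⊗ p)) = (m ⊗ n) ⊗ p.
Proof. by rewrite /= !tens_liftE//; [exact: tassocV_bal0|exact: tassocV_bal]. Qed.
Lemma tassocV_l a m (x : N ⨂ P) : tassocVr ((a *> m) ⊗ x) = a *> tassocVr (m ⊗ x).
Proof. by tens_elim x => n p; rewrite !tassocVrE !lact_ten. Qed.
Definition tassocV : bhom (M ⨂ (N ⨂ P)) ((M ⨂ N) ⨂ P) := tens_bhom tassocV_l.
Lemma tassocVE m n p : tassocV (m ⊗ (n ⊗ p)) = (m ⊗ n) ⊗ p.
Proof. exact: tassocVrE. Qed.

Lemma tassocVK : cancel tassocV tassoc.
Proof. by move=> x; tens_elim x => m y; tens_elim y => n p; rewrite tassocVE tassocE. Qed.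
Lemma tassocK : cancel tassoc tassocV.
Proof. by move=> x; tens_elim x => y p; tens_elim y => m n; rewrite tassocE tassocVE. Qed.
End Assoc.
Arguments tassoc {k A B C D} M N P.
Arguments tassocV {k A B C D} M N P.

Section Units.
Variables (k : comNzRingType) (A B : algType k) (M : bimod A B).

Definition reg (R : algType k) : bimod R R.
refine (@Bimod k R R R *%R *%R _ _ _ _ _ _ _ _ _ _).
- abstract (by move=> a x y; exact: mulrDr).
- abstract (by move=> x a b; exact: mulrDl).
- abstract (exact: mul1r).
- abstract (by move=> a b x; rewrite mulrA).
- abstract (by move=> b x y; exact: mulrDl).
- abstract (by move=> x a b; exact: mulrDr).
- abstract (exact: mulr1).
- abstract (by move=> x a b; rewrite mulrA).
- abstract (by move=> a x b; rewrite mulrA).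
- abstract (by move=> c x; rewrite mulr_algl mulr_algr).
Defined.

Lemma runit_bal : balanced (fun (m : M) (b : reg B) => m <* (b : B)).
Proof.
split=> [n m m'|m n n'|m b n] /=; rewrite ?ractDl ?ractM//.
exact: ractDr.
Qed.
Lemma runit_r (m : M) (b : reg B) c : m <* ((b <* c : reg B) : B) = m <* (b : B) <* c.
Proof. exact: ractM. Qed.
Definition runitr : rhom (M ⨂ reg B) M := tens_rhom runit_bal runit_r.
Lemma runitrE (m : M) (b : reg B) : runitr (m ⊗ b) = m <* (b : B).
Proof. exact: tens_rhomE. Qed.
Lemma runit_l a (m : M) (b : reg B) : runitr ((a *> m) ⊗ b) = a *> runitr (m ⊗ b).
Proof. by rewrite !runitrE lractA. Qed.
Definition runit : bhom (M ⨂ reg B) M := tens_bhom runit_l.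
Lemma runitE (m : M) (b : reg B) : runit (m ⊗ b) = m <* (b : B).
Proof. exact: tens_rhomE. Qed.

Lemma lunit_bal : balanced (fun (a : reg A) (m : M) => (a : A) *> m).
Proof.
split=> [m a a'|a m m'|a b m] /=; rewrite ?lactDr ?lactM//.
exact: lactDl.
Qed.
Lemma lunit_r (a : reg A) (m : M) b : (a : A) *> (m <* b) = (a : A) *> m <* b.
Proof. by rewrite lractA. Qed.
Definition lunitr : rhom (reg A ⨂ M) M := tens_rhom lunit_bal lunit_r.
Lemma lunitrE (a : reg A) (m : M) : lunitr (a ⊗ m) = (a : A) *> m.
Proof. exact: tens_rhomE. Qed.
Lemma lunit_l a (b : reg A) (m : M) : lunitr ((a *> b) ⊗ m) = a *> lunitr (b ⊗ m).
Proof. by rewrite !lunitrE -lactM. Qed.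
Definition lunit : bhom (reg A ⨂ M) M := tens_bhom lunit_l.
Lemma lunitE (a : reg A) (m : M) : lunit (a ⊗ m) = (a : A) *> m.
Proof. exact: tens_rhomE. Qed.
End Units.
Arguments runit {k A B} M.
Arguments lunit {k A B} M.
Arguments reg {k} R.

#[global] Opaque tmap tassoc tassocV runit lunit.

Section TMapTheory.
Variables (k : comNzRingType) (E E' E'' B C : algType k).
Variables (M : bimod E B) (M' : bimod E' B) (M'' : bimod E'' B).
Variables (N N' N'' : bimod B C).
Lemma tmap_id x : tmap (rid M) (bid N) x = x.
Proof. by tens_elim x => m n; rewrite tmapE. Qed.
Lemma tmap_comp (f : rhom M M') (f' : rhom M' M'') (g : bhom N N') (g' : bhom N' N'')
    (h : rhom M M'') (h' : bhom N N'') :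
    (forall m, h m = f' (f m)) -> (forall n, h' n = g' (g n)) ->
  forall x, tmap h h' x = tmap f' g' (tmap f g x).
Proof. by move=> H H' x; tens_elim x => m n; rewrite !tmapE H H'. Qed.
End TMapTheory.

Record coring (k : comNzRingType) (A : algType k) := Coring {
  cobim :> bimod A A;
  comul : bhom cobim (cobim ⨂ cobim);
  coeps : bhom cobim (reg A);
  comulA : forall x,
    tassoc _ _ _ (tmap comul (bid cobim) (comul x)) = tmap (bid cobim) comul (comul x);
  coepsl : forall x, lunit _ (tmap coeps (bid cobim) (comul x)) = x;
  coepsr : forall x, runit _ (tmap (bid cobim) coeps (comul x)) = x }.

(* Bimodules over (E, B) with an E-linear right coaction of the B-coring D. For
   E = k^o these are the right D-comodules. *)
Record rcomod (k : comNzRingType) (E B : algType k) (D : coring B) := RComod {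
  rcbim :> bimod E B;
  rho : bhom rcbim (rcbim ⨂ D);
  rhoA : forall x,
    tassoc _ _ _ (tmap rho (bid D) (rho x)) = tmap (bid rcbim) (comul D) (rho x);
  rho1 : forall x, runit _ (tmap (bid rcbim) (coeps D) (rho x)) = x }.
Arguments rho {k E B D} r.

Record bicomod (k : comNzRingType) (A B : algType k) (C : coring A) (D : coring B) :=
BiComod {
  bicr :> rcomod A D;
  lam : bhom bicr (C ⨂ bicr);
  lamA : forall x,
    tassoc _ _ _ (tmap (comul C) (bid bicr) (lam x)) = tmap (bid C) lam (lam x);
  lam1 : forall x, lunit _ (tmap (coeps C) (bid bicr) (lam x)) = x;
  lam_rho : forall x,
    tassoc _ _ _ (tmap lam (bid D) (rho bicr x)) = tmap (bid C) (rho bicr) (lam x) }.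
Arguments lam {k A B C D} b.

Record chom (k : comNzRingType) (E E' B : algType k) (D : coring B)
    (Y : rcomod E D) (Z : rcomod E' D) := CHom {
  chr :> rhom Y Z;
  chomP : forall y, rho Z (chr y) = tmap chr (bid D) (rho Y y) }.

Record echom (k : comNzRingType) (E B : algType k) (D : coring B)
    (Y Z : rcomod E D) := EHom {
  ech :> bhom Y Z;
  echomP : forall y, rho Z (ech y) = tmap ech (bid D) (rho Y y) }.
Coercion chom_of_echom (k : comNzRingType) (E B : algType k) (D : coring B)
  (Y Z : rcomod E D) (f : echom Y Z) : chom Y Z := CHom (@echomP _ _ _ _ _ _ f).

Record bicomod_hom (k : comNzRingType) (A B : algType k) (C : coring A) (D : coring B)
    (M N : bicomod C D) := BiComodHom {
  bch :> echom M N;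
  bch_l : forall x, lam N (bch x) = tmap (bid C) bch (lam M x) }.

Definition bicomod_iso (k : comNzRingType) (A B : algType k) (C : coring A)
    (D : coring B) (M N : bicomod C D) : Prop :=
  exists (f : bicomod_hom M N) (g : bicomod_hom N M), cancel f g /\ cancel g f.

(* The functor - ⨂ C from right A-modules to abelian groups is exact. *)
Definition flat (k : comNzRingType) (A B : algType k) (C : bimod A B) : Prop :=
  forall (K M N : bimod k^o A) (i : rhom K M) (f : rhom M N),
    (forall m, f m = 0 <-> exists x, i x = m) ->
  forall t, tmap f (bid C) t = 0 <-> exists s, tmap i (bid C) s = t.

Section HomModules.
Variables (k : comNzRingType) (E E' B : algType k).

Lemma algC (b : B) (c : k) : b * c%:A = c%:A * b.
Proof. by rewrite mulr_algl mulr_algr. Qed.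

Section RHomModule.
Variables (M : bimod E B) (N : bimod E' B).
HB.instance Definition _ := gen_eqMixin (rhom M N).
HB.instance Definition _ := gen_choiceMixin (rhom M N).

Definition rhom_add (f g : rhom M N) : rhom M N.
refine (@RHom _ _ _ _ _ _ (fun x => f x + g x) _ _).
- abstract (by move=> x y; rewrite !rfunD addrACA).
- abstract (by move=> b x; rewrite !rfunr ractDl).
Defined.
Definition rhom_opp (f : rhom M N) : rhom M N.
refine (@RHom _ _ _ _ _ _ (fun x => - f x) _ _).
- abstract (by move=> x y; rewrite !rfunD opprD).
- abstract (by move=> b x; rewrite !rfunr ractN).
Defined.
Definition rhom_zero : rhom M N.
refine (@RHom _ _ _ _ _ _ (fun x => 0) _ _).
- abstract (by move=> x y; rewrite addr0).
- abstract (by move=> b x; rewrite ract0).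
Defined.
Definition rhom_scale (c : k) (f : rhom M N) : rhom M N.
refine (@RHom _ _ _ _ _ _ (fun x => f x <* c%:A) _ _).
- abstract (by move=> x y; rewrite !rfunD ractDl).
- abstract (by move=> b x; rewrite !rfunr -!ractM algC).
Defined.
Lemma rhom_addA : associative rhom_add.
Proof. by move=> f g h; apply: rhom_ext => x /=; rewrite addrA. Qed.
Lemma rhom_addC : commutative rhom_add.
Proof. by move=> f g; apply: rhom_ext => x /=; rewrite addrC. Qed.
Lemma rhom_add0 : left_id rhom_zero rhom_add.
Proof. by move=> f; apply: rhom_ext => x /=; rewrite add0r. Qed.
Lemma rhom_addN : left_inverse rhom_zero rhom_opp rhom_add.
Proof. by move=> f; apply: rhom_ext => x /=; rewrite addNr. Qed.
HB.instance Definition _ :=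
  GRing.isZmodule.Build (rhom M N) rhom_addA rhom_addC rhom_add0 rhom_addN.
Lemma rhom_scaleA c d f : rhom_scale c (rhom_scale d f) = rhom_scale (c * d) f.
Proof.
apply: rhom_ext => x /=.
by rewrite -ractM mulr_algl scalerA mulrC.
Qed.
Lemma rhom_scale1 : left_id 1 rhom_scale.
Proof. by move=> f; apply: rhom_ext => x /=; rewrite scale1r ract1. Qed.
Lemma rhom_scaleDr : right_distributive rhom_scale +%R.
Proof. by move=> c f g; apply: rhom_ext => x /=; rewrite ractDl. Qed.
Lemma rhom_scaleDl f : {morph rhom_scale^~ f : c d / c + d}.
Proof. by move=> c d; apply: rhom_ext => x /=; rewrite scalerDl ractDr. Qed.
HB.instance Definition _ := GRing.Zmodule_isLmodule.Build k (rhom M N)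
  rhom_scaleA rhom_scale1 rhom_scaleDr rhom_scaleDl.

Lemma rhom_addE (f g : rhom M N) x : (f + g) x = f x + g x. Proof. by []. Qed.
Lemma rhom_oppE (f : rhom M N) x : (- f) x = - f x. Proof. by []. Qed.
Lemma rhom_scaleE c (f : rhom M N) x : (c *: f) x = f x <* c%:A. Proof. by []. Qed.

Variable D : bimod B B.
Lemma tmap_add (f g : rhom M N) (x : M ⨂ D) :
  tmap (f + g) (bid D) x = tmap f (bid D) x + tmap g (bid D) x.
Proof.
elim/tensb_ind: x => [m n|x y hx hy|]; first by rewrite !tmapE tensDl.
  by rewrite !rfunD hx hy addrACA.
by rewrite !rfun0 addr0.
Qed.
Lemma tmap_scale c (f : rhom M N) (x : M ⨂ D) :
  tmap (c *: f) (bid D) x = tmap f (bid D) x <* c%:A.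
Proof.
tens_elim x => m n; rewrite !tmapE rhom_scaleE ract_ten.
by rewrite tensM -ksym.
Qed.
Lemma tmap_zero (x : M ⨂ D) : tmap (0 : rhom M N) (bid D) x = 0.
Proof. by tens_elim x => m n; rewrite tmapE tens0l. Qed.
Lemma tmap_opp (f : rhom M N) (x : M ⨂ D) : tmap (- f) (bid D) x = - tmap f (bid D) x.
Proof.
by apply/eqP; rewrite -addr_eq0 -tmap_add addNr tmap_zero.
Qed.

End RHomModule.

Section CHomModule.
Variables (D : coring B) (Y : rcomod E D) (Z : rcomod E' D).

Lemma chom_ext (f g : chom Y Z) : f =1 g -> f = g.
Proof.
case: f g => [f fP] [g gP] /= /rhom_ext efg.
by case: _ / efg in gP *; congr CHom; exact: Prop_irrelevance.
Qed.

HB.instance Definition _ := gen_eqMixin (chom Y Z).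
HB.instance Definition _ := gen_choiceMixin (chom Y Z).

Definition chom_add (f g : chom Y Z) : chom Y Z.
refine (@CHom _ _ _ _ _ _ _ (chr f + chr g) _).
abstract (by move=> y; rewrite tmap_add (rhom_addE f g) rfunD !chomP).
Defined.
Definition chom_opp (f : chom Y Z) : chom Y Z.
refine (@CHom _ _ _ _ _ _ _ (- chr f) _).
abstract (by move=> y; rewrite tmap_opp (rhom_oppE f) rfunN !chomP).
Defined.
Definition chom_zero : chom Y Z.
refine (@CHom _ _ _ _ _ _ _ 0 _).
abstract (by move=> y; rewrite tmap_zero; exact: rfun0).
Defined.
Definition chom_scale (c : k) (f : chom Y Z) : chom Y Z.
refine (@CHom _ _ _ _ _ _ _ (c *: chr f) _).
abstract (by move=> y; rewrite tmap_scale (rhom_scaleE c f) rfunr !chomP).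
Defined.
Lemma chr_inj : injective (@chr _ _ _ _ _ Y Z).
Proof. by move=> f g efg; apply: chom_ext => x; rewrite efg. Qed.
Lemma chom_addA : associative chom_add.
Proof. by move=> f g h; apply: chr_inj; exact: addrA. Qed.
Lemma chom_addC : commutative chom_add.
Proof. by move=> f g; apply: chr_inj; exact: addrC. Qed.
Lemma chom_add0 : left_id chom_zero chom_add.
Proof. by move=> f; apply: chr_inj; exact: add0r. Qed.
Lemma chom_addN : left_inverse chom_zero chom_opp chom_add.
Proof. by move=> f; apply: chr_inj; exact: addNr. Qed.
HB.instance Definition _ :=
  GRing.isZmodule.Build (chom Y Z) chom_addA chom_addC chom_add0 chom_addN.
Lemma chom_scaleA c d f : chom_scale c (chom_scale d f) = chom_scale (c * d) f.
Proof. by apply: chr_inj; exact: scalerA. Qed.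
Lemma chom_scale1 : left_id 1 chom_scale.
Proof. by move=> f; apply: chr_inj; exact: scale1r. Qed.
Lemma chom_scaleDr : right_distributive chom_scale +%R.
Proof. by move=> c f g; apply: chr_inj; exact: scalerDr. Qed.
Lemma chom_scaleDl f : {morph chom_scale^~ f : c d / c + d}.
Proof. by move=> c d; apply: chr_inj; exact: scalerDl. Qed.
HB.instance Definition _ := GRing.Zmodule_isLmodule.Build k (chom Y Z)
  chom_scaleA chom_scale1 chom_scaleDr chom_scaleDl.

Lemma chom_addE (f g : chom Y Z) x : (f + g) x = f x + g x. Proof. by []. Qed.
Lemma chom_scaleE c (f : chom Y Z) x : (c *: f) x = f x <* c%:A. Proof. by []. Qed.
End CHomModule.
End HomModules.

Record kcat (k : comNzRingType) := KCat {
  kob :> Type;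
  khom : kob -> kob -> lmodType k;
  kid : forall X, khom X X;
  kcomp : forall X Y Z, khom Y Z -> khom X Y -> khom X Z;
  kcompA : forall X Y Z T (h : khom Z T) (g : khom Y Z) (f : khom X Y),
    kcomp h (kcomp g f) = kcomp (kcomp h g) f;
  kcomp1l : forall X Y (f : khom X Y), kcomp (kid Y) f = f;
  kcomp1r : forall X Y (f : khom X Y), kcomp f (kid X) = f;
  kcomp_linr : forall X Y Z (g : khom Y Z) c (f f' : khom X Y),
    kcomp g (c *: f + f') = c *: kcomp g f + kcomp g f';
  kcomp_linl : forall X Y Z (f : khom X Y) c (g g' : khom Y Z),
    kcomp (c *: g + g') f = c *: kcomp g f + kcomp g' f }.
Arguments kid {k _} X.

Notation "g ⊚ f" := (kcomp g f) (at level 40, left associativity) : ring_scope.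

Record functor (k : comNzRingType) (K L : kcat k) := Functor {
  fob :> K -> L;
  fmap : forall X Y : K, khom X Y -> khom (fob X) (fob Y);
  fmap1 : forall X, fmap (kid X) = kid (fob X);
  fmapM : forall X Y Z (g : khom Y Z) (f : khom X Y), fmap (g ⊚ f) = fmap g ⊚ fmap f }.
Arguments fmap {k K L} _ {X Y}.

Definition linear_functor (k : comNzRingType) (K L : kcat k) (F : functor K L) : Prop :=
  forall X Y : K, linear (@fmap k K L F X Y).

Definition nat_iso (k : comNzRingType) (K L : kcat k) (F G : functor K L) : Prop :=
  exists (s : forall X, khom (F X) (G X)) (t : forall X, khom (G X) (F X)),
    [/\ forall X, t X ⊚ s X = kid (F X), forall X, s X ⊚ t X = kid (G X)
      & forall X Y (f : khom X Y), fmap G f ⊚ s X = s Y ⊚ fmap F f].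

(* F is left adjoint to G. *)
Record adjunction (k : comNzRingType) (K L : kcat k)
    (F : functor K L) (G : functor L K) := Adjunction {
  aunit : forall X, khom X (G (F X));
  acounit : forall Y, khom (F (G Y)) Y;
  aunit_nat : forall X X' (f : khom X X'), fmap G (fmap F f) ⊚ aunit X = aunit X' ⊚ f;
  acounit_nat : forall Y Y' (g : khom Y Y'),
    acounit Y' ⊚ fmap F (fmap G g) = g ⊚ acounit Y;
  atri1 : forall X, acounit (F X) ⊚ fmap F (aunit X) = kid (F X);
  atri2 : forall Y, fmap G (acounit Y) ⊚ aunit (G Y) = kid (G Y) }.

Definition left_adjoint (k : comNzRingType) (K L : kcat k)
    (F : functor K L) (G : functor L K) : Prop := inhabited (adjunction F G).

Definition frobenius_pair (k : comNzRingType) (K L : kcat k)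
    (F : functor K L) (G : functor L K) : Prop :=
  left_adjoint F G /\ left_adjoint G F.

Definition frobenius_functor (k : comNzRingType) (K L : kcat k)
    (F : functor K L) : Prop := exists G : functor L K, frobenius_pair F G.

Definition monic (k : comNzRingType) (K : kcat k) (X Y : K) (i : khom X Y) : Prop :=
  forall (Z : K) (f g : khom Z X), i ⊚ f = i ⊚ g -> f = g.

Definition injective_object (k : comNzRingType) (K : kcat k) (I : K) : Prop :=
  forall (X Y : K) (i : khom X Y) (f : khom X I),
    monic i -> exists g : khom Y I, g ⊚ i = f.

Definition preserves_injectives (k : comNzRingType) (K L : kcat k)
    (F : functor K L) : Prop :=
  forall I : K, injective_object I -> injective_object (F I).

Section AdjointTheory.
Variables (k : comNzRingType) (K L : kcat k) (F : functor K L) (G : functor L K).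
Variable adj : adjunction F G.

Lemma adj_inj_l X Y (u v : khom (F X) Y) :
  fmap G u ⊚ aunit adj X = fmap G v ⊚ aunit adj X -> u = v.
Proof.
have E w : w = acounit adj Y ⊚ fmap F (fmap G w ⊚ aunit adj X).
  by rewrite fmapM kcompA acounit_nat -kcompA atri1 kcomp1r.
by move=> H; rewrite (E u) H -E.
Qed.

Lemma adj_inj_r X Y (u v : khom X (G Y)) :
  acounit adj Y ⊚ fmap F u = acounit adj Y ⊚ fmap F v -> u = v.
Proof.
have E w : w = fmap G (acounit adj Y ⊚ fmap F w) ⊚ aunit adj X.
  by rewrite fmapM -kcompA aunit_nat kcompA atri2 kcomp1l.
by move=> H; rewrite (E u) H -E.
Qed.

Lemma left_adjoint_linear : linear_functor G -> linear_functor F.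
Proof.
move=> linG X Y c f g; apply: adj_inj_l.
rewrite aunit_nat linG [RHS]kcomp_linl !aunit_nat.
by rewrite kcomp_linr.
Qed.

Lemma right_adjoint_linear : linear_functor F -> linear_functor G.
Proof.
move=> linF X Y c f g; apply: adj_inj_r.
by rewrite acounit_nat linF [RHS]kcomp_linr !acounit_nat kcomp_linl.
Qed.
End AdjointTheory.

Definition bcomp (k : comNzRingType) (A B : algType k) (M N P : bimod A B)
  (g : bhom N P) (f : bhom M N) : bhom M P.
refine (@BHom _ _ _ _ _ (rcomp g f) _).
abstract (by move=> a x /=; rewrite !rfunl).
Defined.

Section RightModules.
Variables (k : comNzRingType) (B : algType k).

(* Right linear maps between k-symmetric bimodules are automatically k-linear. *)
Lemma rhom_k (M N : bimod k^o B) (f : rhom M N) (c : k^o) : {morph f : x / c *> x}.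
Proof.
have E (P : bimod k^o B) (x : P) : c *> x = x <* (c : k)%:A.
  by rewrite -ksym; congr (_ *> _); rewrite /GRing.scale /= mulr1.
by move=> x; rewrite !E rfunr.
Qed.
Definition kbhom (M N : bimod k^o B) (f : rhom M N) : bhom M N := BHom (rhom_k f).

Definition mod_cat : kcat k.
refine (@KCat k (bimod k^o B) (fun M N => rhom M N : lmodType k) (fun M => rid M)
  (fun M N P g f => rcomp g f) _ _ _ _ _).
- abstract (by move=> *; apply: rhom_ext).
- abstract (by move=> *; apply: rhom_ext).
- abstract (by move=> *; apply: rhom_ext).
- abstract (by move=> X Y Z g c f f'; apply: rhom_ext => x /=; rewrite rfunD rfunr).
- abstract (by move=> X Y Z f c g g'; apply: rhom_ext).
Defined.

End RightModules.
Arguments mod_cat {k} B.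

Section RightComodules.
Variables (k : comNzRingType) (B : algType k) (D : coring B).

Definition idc (E : algType k) (Y : rcomod E D) : chom Y Y.
refine (@CHom _ _ _ _ _ _ _ (rid Y) _).
abstract (by move=> y; rewrite tmap_id).
Defined.

Definition ccomp (E E' E'' : algType k) (Y : rcomod E D) (Z : rcomod E' D)
  (T : rcomod E'' D) (g : chom Z T) (f : chom Y Z) : chom Y T.
refine (@CHom _ _ _ _ _ _ _ (rcomp g f) _).
abstract (by move=> y; rewrite /= !chomP; symmetry; apply: tmap_comp).
Defined.

Definition comod_cat : kcat k.
refine (@KCat k (rcomod k^o D) (fun M N => chom M N : lmodType k) (fun M => idc M)
  (fun M N P g f => ccomp g f) _ _ _ _ _).
- abstract (by move=> *; apply: chom_ext).
- abstract (by move=> *; apply: chom_ext).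
- abstract (by move=> *; apply: chom_ext).
- abstract (by move=> X Y Z g c f f'; apply: chom_ext => x /=; rewrite rfunD rfunr).
- abstract (by move=> X Y Z f c g g'; apply: chom_ext).
Defined.

Definition forget : functor comod_cat (mod_cat B).
refine (@Functor k comod_cat (mod_cat B) (fun Y => rcbim Y) (fun Y Z f => chr f) _ _).
- abstract (by []).
- abstract (by []).
Defined.

Definition coring_rcomod : rcomod B D := RComod (@comulA _ _ D) (@coepsr _ _ D).

Variables (E A : algType k).

Definition tens_rho (W : bimod E A) (Y : rcomod A D) : bhom (W ⨂ Y) ((W ⨂ Y) ⨂ D) :=
  bcomp (tassocV W Y D) (bmap (bid W) (rho Y)).
Lemma tens_rhoE (W : bimod E A) (Y : rcomod A D) (w : W) (y : Y) :
  tens_rho W Y (w ⊗ y) = tassocV _ _ _ (w ⊗ rho Y y).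
Proof. by rewrite -[LHS]/(tassocV _ _ _ (tmap (bid W) (rho Y) (w ⊗ y))) tmapE. Qed.

Lemma tens_rhoA (W : bimod E A) (Y : rcomod A D) x :
  tassoc _ _ _ (tmap (tens_rho W Y) (bid D) (tens_rho W Y x)) =
  tmap (bid (W ⨂ Y)) (comul D) (tens_rho W Y x).
Proof.
tens_elim x => w y; rewrite !tens_rhoE.
have H1 (v : Y ⨂ D) d : tassoc _ _ _ (tassocV _ _ _ (w ⊗ v) ⊗ d) =
    tassocV _ _ _ (w ⊗ tassoc _ _ _ (v ⊗ d)).
  by tens_elim v => y' d'; rewrite tassocVE !tassocE tassocVE.
have H2 (u : Y ⨂ D) :
    tassoc _ _ _ (tmap (tens_rho W Y) (bid D) (tassocV _ _ _ (w ⊗ u))) =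
    tassocV _ _ _ (w ⊗ tassoc _ _ _ (tmap (rho Y) (bid D) u)).
  by tens_elim u => y' d; rewrite tassocVE !tmapE tens_rhoE H1.
have H3 (u : Y ⨂ D) :
    tmap (bid (W ⨂ Y)) (comul D) (tassocV _ _ _ (w ⊗ u)) =
    tassocV _ _ _ (w ⊗ tmap (bid Y) (comul D) u).
  by tens_elim u => y' d; rewrite tassocVE !tmapE tassocVE.
by rewrite H2 H3 rhoA.
Qed.
Lemma tens_rho1 (W : bimod E A) (Y : rcomod A D) x :
  runit _ (tmap (bid (W ⨂ Y)) (coeps D) (tens_rho W Y x)) = x.
Proof.
tens_elim x => w y; rewrite tens_rhoE.
have H (u : Y ⨂ D) :
    runit _ (tmap (bid (W ⨂ Y)) (coeps D) (tassocV _ _ _ (w ⊗ u))) =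
    w ⊗ runit _ (tmap (bid Y) (coeps D) u).
  by tens_elim u => y' d; rewrite tassocVE !tmapE !runitE ract_ten.
by rewrite H rho1.
Qed.
Definition tens_comod (W : bimod E A) (Y : rcomod A D) : rcomod E D :=
  RComod (@tens_rhoA W Y) (@tens_rho1 W Y).
Lemma tens_comodE (W : bimod E A) (Y : rcomod A D) (w : W) (y : Y) :
  rho (tens_comod W Y) (w ⊗ y) = tassocV _ _ _ (w ⊗ rho Y y).
Proof. exact: tens_rhoE. Qed.

End RightComodules.
Arguments idc {k B D E} Y.
Arguments comod_cat {k B} D.
Arguments forget {k B} D.
Arguments coring_rcomod {k B} D.

Section TensComod.
Variables (k : comNzRingType) (B : algType k) (D : coring B).

Section Map.
Variables (E E' A : algType k).
Lemma tens_map_subproof (W : bimod E A) (W' : bimod E' A) (Y Y' : rcomod A D)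
  (f : rhom W W') (g : echom Y Y') (x : tens_comod W Y) :
  rho (tens_comod W' Y') (tmap f g x) = tmap (tmap f g) (bid D) (rho (tens_comod W Y) x).
Proof.
tens_elim x => w y; rewrite tmapE !tens_comodE echomP.
have H (u : Y ⨂ D) : tassocV _ _ _ (f w ⊗ tmap g (bid D) u) =
    tmap (tmap f g) (bid D) (tassocV _ _ _ (w ⊗ u)).
  by tens_elim u => y' d; rewrite tmapE !tassocVE !tmapE.
exact: H.
Qed.
Definition tens_map (W : bimod E A) (W' : bimod E' A) (Y Y' : rcomod A D)
  (f : rhom W W') (g : echom Y Y') : chom (tens_comod W Y) (tens_comod W' Y') :=
  @CHom _ _ _ _ _ (tens_comod W Y) (tens_comod W' Y') (tmap f g) (tens_map_subproof f g).
End Map.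

Variables (E A A' : algType k) (M : bimod E A) (P : bimod A A') (N : rcomod A' D).
Lemma tens_assocV_subproof (x : tens_comod M (tens_comod P N)) :
  rho (tens_comod (M ⨂ P) N) (tassocV M P N x) =
  tmap (tassocV M P N) (bid D) (rho (tens_comod M (tens_comod P N)) x).
Proof.
tens_elim x => m y; rewrite tens_comodE; tens_elim y => p n.
rewrite tassocVE !tens_comodE.
have H (u : N ⨂ D) : tassocV _ _ _ ((m ⊗ p) ⊗ u) =
    tmap (tassocV M P N) (bid D) (tassocV _ _ _ (m ⊗ tassocV _ _ _ (p ⊗ u))).
  by tens_elim u => n' d; rewrite !tassocVE tmapE tassocVE.
exact: H.
Qed.
Definition tens_assocV :
  echom (tens_comod M (tens_comod P N)) (tens_comod (M ⨂ P) N) :=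
  @EHom _ _ _ _ (tens_comod M (tens_comod P N)) (tens_comod (M ⨂ P) N)
    (tassocV M P N) tens_assocV_subproof.
Lemma tens_assoc_subproof (x : tens_comod (M ⨂ P) N) :
  rho (tens_comod M (tens_comod P N)) (tassoc M P N x) =
  tmap (tassoc M P N) (bid D) (rho (tens_comod (M ⨂ P) N) x).
Proof.
rewrite -[in RHS](tassocK x) (echomP tens_assocV).
by rewrite -(@tmap_comp _ _ _ _ _ _ _ _ _ _ _ _ _ _ _ _ (bid _) (bid D)) ?tmap_id//
  => y; rewrite /= tassocVK.
Qed.
Definition tens_assoc :
  echom (tens_comod (M ⨂ P) N) (tens_comod M (tens_comod P N)) :=
  @EHom _ _ _ _ (tens_comod (M ⨂ P) N) (tens_comod M (tens_comod P N))
    (tassoc M P N) tens_assoc_subproof.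
End TensComod.

Definition idec (k : comNzRingType) (E B : algType k) (D : coring B) (N : rcomod E D) :
  echom N N := @EHom _ _ _ _ N N (bid N) (fun y => esym (tmap_id _)).

Definition lam_echom (k : comNzRingType) (A B : algType k) (C : coring A) (D : coring B)
  (N : bicomod C D) : echom N (tens_comod C N).
refine (@EHom _ _ _ _ N (tens_comod C N) (lam N) _).
abstract (by move=> y; rewrite -[RHS](tassocK (M := C) (N := N)) lam_rho).
Defined.
Arguments lam_echom {k A B C D} N.

(* The functor - ⨂ N from right A-modules to right D-comodules. *)
Definition tens_functor (k : comNzRingType) (A B : algType k) (D : coring B)
  (N : rcomod A D) : functor (mod_cat A) (comod_cat D).
refine (@Functor k (mod_cat A) (comod_cat D) (fun W => tens_comod W N)
  (fun V W f => tens_map f (idec N)) _ _).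
- abstract (by move=> W; apply: chom_ext => x; exact: tmap_id).
- abstract (by move=> W V U g f; apply: chom_ext => x; exact: tmap_comp).
Defined.

Section Kernel.
Variables (k : comNzRingType) (B : algType k) (T S : bimod k^o B) (h : rhom T S).

Definition ker_car := {t : T | h t == 0}.
HB.instance Definition _ := SubChoice.on ker_car.
Definition ker_in (t : T) (ht : h t == 0) : ker_car := exist _ t ht.

Lemma ker_memD (x y : ker_car) : h (val x + val y) == 0.
Proof. by rewrite rfunD (eqP (valP x)) (eqP (valP y)) addr0. Qed.
Lemma ker_memN (x : ker_car) : h (- val x) == 0.
Proof. by rewrite rfunN (eqP (valP x)) oppr0. Qed.
Lemma ker_mem0 : h 0 == 0. Proof. by rewrite rfun0. Qed.
Lemma ker_meml c (x : ker_car) : h (c *> val x) == 0.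
Proof. by rewrite rhom_k (eqP (valP x)) lact0. Qed.
Lemma ker_memr (x : ker_car) b : h (val x <* b) == 0.
Proof. by rewrite rfunr (eqP (valP x)) ract0. Qed.

Definition ker_add (x y : ker_car) : ker_car := ker_in (ker_memD x y).
Definition ker_opp (x : ker_car) : ker_car := ker_in (ker_memN x).
Definition ker_zero : ker_car := ker_in ker_mem0.
Lemma ker_addA : associative ker_add.
Proof. by move=> x y z; apply: val_inj => /=; rewrite addrA. Qed.
Lemma ker_addC : commutative ker_add.
Proof. by move=> x y; apply: val_inj => /=; rewrite addrC. Qed.
Lemma ker_add0 : left_id ker_zero ker_add.
Proof. by move=> x; apply: val_inj => /=; rewrite add0r. Qed.
Lemma ker_addN : left_inverse ker_zero ker_opp ker_add.
Proof. by move=> x; apply: val_inj => /=; rewrite addNr. Qed.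
HB.instance Definition _ :=
  GRing.isZmodule.Build ker_car ker_addA ker_addC ker_add0 ker_addN.

Definition kernel : bimod k^o B.
refine (@Bimod k k^o B ker_car (fun c x => ker_in (ker_meml c x))
  (fun x b => ker_in (ker_memr x b)) _ _ _ _ _ _ _ _ _ _).
- abstract (by move=> c x y; apply: val_inj => /=; rewrite lactDr).
- abstract (by move=> x c d; apply: val_inj => /=; rewrite lactDl).
- abstract (by move=> x; apply: val_inj => /=; rewrite lact1).
- abstract (by move=> c d x; apply: val_inj => /=; rewrite lactM).
- abstract (by move=> b x y; apply: val_inj => /=; rewrite ractDl).
- abstract (by move=> x b b'; apply: val_inj => /=; rewrite ractDr).
- abstract (by move=> x; apply: val_inj => /=; rewrite ract1).
- abstract (by move=> x b b'; apply: val_inj => /=; rewrite ractM).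
- abstract (by move=> c x b; apply: val_inj => /=; rewrite lractA).
- abstract (by move=> c x; apply: val_inj => /=; rewrite ksym).
Defined.

Definition kincl : rhom kernel T :=
  @RHom _ _ _ _ kernel T (fun x : ker_car => val x) (fun _ _ => erefl) (fun _ _ => erefl).
Lemma kincl_inj : injective kincl. Proof. exact: val_inj. Qed.
Lemma kincl0 x : h (kincl x) = 0. Proof. exact/eqP/(valP (x : ker_car)). Qed.
Lemma kernelP t : h t = 0 <-> exists x, kincl x = t.
Proof.
split=> [ht|[x <-]]; last exact: kincl0.
by exists (ker_in (introT eqP ht)).
Qed.
End Kernel.

Section Flat.
Variables (k : comNzRingType) (A B : algType k) (C : bimod A B).
Hypothesis flC : flat C.
Variables (M N : bimod k^o A).

Lemma flat_inj (i : rhom M N) : injective i -> injective (tmap i (bid C)).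
Proof.
move=> inj_i x y /eqP; rewrite -subr_eq0 -rfunN -rfunD => /eqP E.
have ex : forall m, i m = 0 <-> exists x, (0 : rhom M M) x = m.
  move=> m; split=> [im|[x0 <-]]; last exact: rfun0.
  by exists 0; apply: inj_i; rewrite im !rfun0.
have [s /esym] := (flC ex (x - y)).1 E.
suff -> : tmap (0 : rhom M M) (bid C) s = 0 by move/eqP; rewrite subr_eq0 => /eqP.
by tens_elim s => m n; rewrite tmapE tens0l.
Qed.
End Flat.

Section KernelComodule.
Variables (k : comNzRingType) (B : algType k) (D : coring B) (flD : flat D).
Variables (T S : rcomod k^o D) (h : chom T S).
Let K := kernel h.
Let i : rhom K T := kincl h.

Lemma ker_rho_ex (x : K) : exists s, tmap i (bid D) s = rho T (i x).
Proof.
apply/(flD (kernelP h)); rewrite -chomP.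
by rewrite (kincl0 (h := h)) rfun0.
Qed.
Definition ker_rho_fun (x : K) : K ⨂ D := projT1 (cid (ker_rho_ex x)).
Lemma ker_rho_funE x : tmap i (bid D) (ker_rho_fun x) = rho T (i x).
Proof. exact: (projT2 (cid (ker_rho_ex x))). Qed.
Let injD : injective (tmap i (bid D)) := flat_inj flD (@kincl_inj _ _ _ _ h).

Definition ker_rho : bhom K (K ⨂ D).
apply: kbhom; refine (@RHom _ _ _ _ _ _ ker_rho_fun _ _).
- abstract (by move=> x y; apply: injD; rewrite rfunD !ker_rho_funE !rfunD).
- abstract (by move=> b x; apply: injD; rewrite rfunr !ker_rho_funE !rfunr).
Defined.
Lemma ker_rhoE x : tmap i (bid D) (ker_rho x) = rho T (i x).
Proof. exact: ker_rho_funE. Qed.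

Lemma ker_rhoA x :
  tassoc _ _ _ (tmap ker_rho (bid D) (ker_rho x)) = tmap (bid K) (comul D) (ker_rho x).
Proof.
apply: (can_inj (tassocVK (M := K) (N := D) (P := D))).
apply: (flat_inj flD injD); rewrite tassocK.
rewrite -(@tmap_comp _ _ _ _ _ _ _ _ _ _ _ _ _ _ _ _ (rcomp (rho T) i) (bid D))//;
  last by move=> y; rewrite /= ker_rhoE.
rewrite (@tmap_comp _ _ _ _ _ _ _ _ _ _ _ _ i (rho T) (bid D) (bid D))//.
rewrite ker_rhoE -[LHS](tassocK (M := T) (N := D) (P := D)) rhoA -ker_rhoE.
by elim/tensb_ind: (ker_rho x) => [m d|y z hy hz|]; rewrite ?rfun0// ?rfunD ?hy ?hz//
  !tmapE; tens_elim (comul D d) => d1 d2; rewrite !tassocVE !tmapE.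
Qed.
Lemma ker_rho1 x : runit _ (tmap (bid K) (coeps D) (ker_rho x)) = x.
Proof.
apply: kincl_inj; rewrite -[RHS](rho1 (r := T)) -ker_rhoE.
by tens_elim (ker_rho x) => m d; rewrite !tmapE !runitE rfunr.
Qed.
Definition ker_comod : rcomod k^o D := RComod ker_rhoA ker_rho1.

Definition ker_incl : chom ker_comod T :=
  @CHom _ _ _ _ _ ker_comod T i (fun x => esym (ker_rhoE x)).
End KernelComodule.

Section KernelMap.
Variables (k : comNzRingType) (B : algType k) (D : coring B) (flD : flat D).
Variables (T S T' S' : rcomod k^o D) (h : chom T S) (h' : chom T' S').
Variables (u : chom T T') (v : chom S S') (uv : forall t, h' (u t) = v (h t)).

Lemma ker_map_mem (x : ker_car h) : h' (u (val x)) == 0.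
Proof. by rewrite uv (eqP (valP x)) rfun0. Qed.
Definition ker_map_fun (x : kernel h) : kernel h' := ker_in (ker_map_mem x).
Lemma ker_mapD : {morph ker_map_fun : x y / x + y}.
Proof. by move=> x y; apply: val_inj; rewrite /= rfunD. Qed.
Lemma ker_mapr b : {morph ker_map_fun : x / x <* b}.
Proof. by move=> x; apply: val_inj; rewrite /= rfunr. Qed.
Lemma ker_map_rho x : rho (ker_comod flD h') (ker_map_fun x) =
  tmap (RHom ker_mapD ker_mapr) (bid D) (rho (ker_comod flD h) x).
Proof.
apply: (flat_inj flD (@kincl_inj _ _ _ _ h')).
rewrite ker_rhoE -(@tmap_comp _ _ _ _ _ _ _ _ _ _ _ _ _ _ _ _ (rcomp u (kincl h)) (bid D))//.
by rewrite (@tmap_comp _ _ _ _ _ _ _ _ _ _ _ _ (kincl h) u (bid D) (bid D))// ker_rhoE -chomP.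
Qed.
Definition ker_map : chom (ker_comod flD h) (ker_comod flD h') :=
  @CHom _ _ _ _ _ (ker_comod flD h) (ker_comod flD h') (RHom ker_mapD ker_mapr) ker_map_rho.
Lemma ker_mapE x : val (ker_map x : ker_car h') = u (val (x : ker_car h)).
Proof. by []. Qed.
End KernelMap.

Section Cotensor.
Variables (k : comNzRingType) (A B : algType k) (C : coring A) (D : coring B).
Variables (flD : flat D) (N : bicomod C D).

Definition cotens_map (M : rcomod k^o C) :
    chom (tens_comod M N) (tens_comod M (tens_comod C N)) :=
  ccomp (tens_assoc M C N) (tens_map (rho M) (idec N)) - tens_map (rid M) (lam_echom N).

Definition cotens (M : rcomod k^o C) : rcomod k^o D := ker_comod flD (cotens_map M).

Lemma cotens_mapE M t : cotens_map M t =
  tassoc _ _ _ (tmap (rho M) (bid N) t) - tmap (bid M) (lam N) t.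
Proof. by []. Qed.

Lemma cotens_nat (M M' : rcomod k^o C) (f : chom M M') t :
  cotens_map M' (tens_map f (idec N) t) =
  tens_map f (idec (tens_comod C N)) (cotens_map M t).
Proof.
rewrite !cotens_mapE [RHS]rfunD rfunN; congr (_ - _); tens_elim t => m n.
- rewrite [tens_map _ _ _]tmapE !tmapE chomP.
  have H (u : M ⨂ C) : tassoc _ _ _ (tmap f (bid C) u ⊗ n) =
      tmap f (bid (C ⨂ N)) (tassoc _ _ _ (u ⊗ n)).
    by tens_elim u => m' c; rewrite tmapE !tassocE tmapE.
  exact: H.
- by rewrite [tens_map _ _ _]tmapE !tmapE.
Qed.

(* The functor - □_C N; the coaction on a cotensor product is the unique one for
   which the inclusion into the tensor product is colinear. *)
Definition cotens_functor : functor (comod_cat C) (comod_cat D).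
refine (@Functor k (comod_cat C) (comod_cat D) cotens
  (fun M M' f => ker_map flD (@cotens_nat M M' f)) _ _).
- abstract (by move=> M; apply: chom_ext => x; apply: val_inj; exact: tmap_id).
- abstract (by move=> M M' M'' g f; apply: chom_ext => x; apply: val_inj; exact: tmap_comp).
Defined.
End Cotensor.

(* A right comodule structure is carried along an isomorphism of right modules
   to a bimodule on which the left algebra acts by comodule endomorphisms. *)
Section Transport.
Variables (k : comNzRingType) (E E' B : algType k) (D : coring B).
Variables (Y : rcomod E D) (M : bimod E' B) (i : rhom Y M) (j : rhom M Y).
Hypotheses (ijK : cancel i j) (jiK : cancel j i).
Hypothesis (act : forall a : E', exists l : chom Y Y, forall y, a *> i y = i (l y)).

Definition transp_rhor : rhom M (M ⨂ D) := rcomp (tmap i (bid D)) (rcomp (rho Y) j).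
Lemma transp_rhol a : {morph transp_rhor : x / a *> x}.
Proof.
have [l al] := act a => x; rewrite -{1}(jiK x) al.
rewrite -[LHS]/(tmap i (bid D) (rho Y (j (i _)))) ijK chomP.
rewrite -[transp_rhor x]/(tmap i (bid D) (rho Y (j x))).
by tens_elim (rho Y (j x)) => m d; rewrite !tmapE lact_ten al.
Qed.
Definition transp_rho : bhom M (M ⨂ D) := BHom transp_rhol.
Lemma transp_rhoE y : transp_rho (i y) = tmap i (bid D) (rho Y y).
Proof. by rewrite /= ijK. Qed.
Lemma transp_rhoA x :
  tassoc _ _ _ (tmap transp_rho (bid D) (transp_rho x)) =
  tmap (bid M) (comul D) (transp_rho x).
Proof.
rewrite -(jiK x) transp_rhoE; move: (j x) => y {x}.
have -> t : tassoc _ _ _ (tmap transp_rho (bid D) (tmap i (bid D) t)) =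
    tmap i (bid (D ⨂ D)) (tassoc _ _ _ (tmap (rho Y) (bid D) t)).
  tens_elim t => m d; rewrite !tmapE transp_rhoE.
  by tens_elim (rho Y m) => m' d'; rewrite tmapE !tassocE tmapE.
rewrite rhoA -!(@tmap_comp _ _ _ _ _ _ _ _ _ _ _ _ _ _ _ _ i (comul D))//.
Qed.
Lemma transp_rho1 x : runit _ (tmap (bid M) (coeps D) (transp_rho x)) = x.
Proof.
rewrite -(jiK x) transp_rhoE; move: (j x) => y {x}.
rewrite -[in RHS](rho1 y).
by tens_elim (rho Y y) => m d; rewrite !tmapE !runitE rfunr.
Qed.
Definition transp : rcomod E' D := RComod transp_rhoA transp_rho1.
End Transport.

Section LeftAction.
Variables (k : comNzRingType) (E B : algType k) (D : coring B) (Y : rcomod E D).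

Definition lactr (a : E) : rhom Y Y.
refine (@RHom _ _ _ _ _ _ (lact a) _ _).
- abstract (exact: lactDr).
- abstract (by move=> b x; rewrite lractA).
Defined.
Definition lactc (a : E) : chom Y Y.
refine (@CHom _ _ _ _ _ _ _ (lactr a) _).
abstract (by move=> y; rewrite rfunl; tens_elim (rho Y y) => m d; rewrite lact_ten tmapE).
Defined.
End LeftAction.

(* Forgetting the left action, except for that of k. *)
Section Restriction.
Variables (k : comNzRingType) (E B : algType k) (D : coring B).

Definition restr (M : bimod E B) : bimod k^o B.
refine (@Bimod k k^o B M (fun c x => (c : k)%:A *> x) (@ract _ _ _ M)
  _ _ _ _ _ _ _ _ _ _).
- abstract (by move=> c x y; rewrite lactDr).
- abstract (by move=> x c d; rewrite scalerDl lactDl).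
- abstract (by move=> x; rewrite scale1r lact1).
- abstract (by move=> c d x; rewrite -lactM mulr_algl scalerA).
- abstract (exact: ractDl).
- abstract (exact: ractDr).
- abstract (exact: ract1).
- abstract (exact: ractM).
- abstract (by move=> c x b; rewrite lractA).
- abstract (by move=> c x; rewrite -ksym; congr (_%:A *> _); rewrite /GRing.scale /= mulr1).
Defined.

Definition restr_in (M : bimod E B) : rhom M (restr M) :=
  @RHom _ _ _ _ M (restr M) (fun x => x) (fun _ _ => erefl) (fun _ _ => erefl).
Definition restr_out (M : bimod E B) : rhom (restr M) M :=
  @RHom _ _ _ _ (restr M) M (fun x => x) (fun _ _ => erefl) (fun _ _ => erefl).

Lemma rrestr_act (Y : rcomod E D) (c : k^o) :
  exists l : chom Y Y, forall y, c *> restr_in Y y = restr_in Y (l y).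
Proof. by exists (lactc Y (c : k)%:A). Qed.
Definition rrestr (Y : rcomod E D) : rcomod k^o D :=
  @transp _ _ _ _ _ Y (restr Y) (restr_in Y) (restr_out Y)
    (fun _ => erefl) (fun _ => erefl) (@rrestr_act Y).

Definition rrestr_in (Y : rcomod E D) : chom Y (rrestr Y) :=
  @CHom _ _ _ _ _ Y (rrestr Y) (restr_in Y) (fun _ => erefl).
Definition rrestr_out (Y : rcomod E D) : chom (rrestr Y) Y.
refine (@CHom _ _ _ _ _ (rrestr Y) Y (restr_out Y) _).
abstract (by move=> y; rewrite -(@tmap_comp _ _ _ _ _ _ _ _ _ _ _ _ _ _ _ _
  (rid Y) (bid D))// tmap_id).
Defined.
End Restriction.

Definition rrestr_map (k : comNzRingType) (E E' B : algType k) (D : coring B)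
  (Y : rcomod E D) (Z : rcomod E' D) (f : chom Y Z) : chom (rrestr Y) (rrestr Z) :=
  ccomp (rrestr_in Z) (ccomp f (rrestr_out Y)).

Definition wtenr (k : comNzRingType) (E E' B : algType k) (W : bimod E E') (Y : bimod E' B)
  (w : W) : rhom Y (W ⨂ Y).
refine (@RHom _ _ _ _ Y (W ⨂ Y) (fun y => w ⊗ y) _ _).
- abstract (exact: tensDr).
- abstract (by move=> b y; rewrite ract_ten).
Defined.

Section Image.
Variables (k : comNzRingType) (A B : algType k) (C : coring A) (D : coring B).
Variables (F : functor (comod_cat D) (comod_cat C)) (linF : linear_functor F).

Section FMap.
Variables (E E' : algType k) (Y : rcomod E D) (Z : rcomod E' D).

Definition img_map0 (f : chom Y Z) : chom (F (rrestr Y)) (F (rrestr Z)) :=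
  @fmap _ _ _ F (rrestr Y) (rrestr Z) (rrestr_map f).

Lemma img_map0_lin (c : k) (f g : chom Y Z) :
  img_map0 (c *: f + g) = c *: img_map0 f + img_map0 g.
Proof.
rewrite -[RHS](linF (X := rrestr Y) (Y := rrestr Z)).
by congr (fmap F _); exact: chom_ext.
Qed.

Lemma img_map0D (f g : chom Y Z) : img_map0 (f + g) = img_map0 f + img_map0 g.
Proof. by have := img_map0_lin 1 f g; rewrite !scale1r. Qed.

Lemma img_map0Z c (f : chom Y Z) : img_map0 (c *: f) = c *: img_map0 f.
Proof.
by have := img_map0_lin c f 0; rewrite addr0 (morphD0 img_map0D) addr0.
Qed.
End FMap.

Lemma img_map01 (E : algType k) (Y : rcomod E D) (f : chom Y Y) :
  (forall y, f y = y) -> img_map0 f = idc (F (rrestr Y)).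
Proof.
move=> Hf; rewrite -[RHS](fmap1 F (rrestr Y)).
by congr (fmap F _); exact: chom_ext.
Qed.

Lemma img_map0M (E E' E'' : algType k) (Y : rcomod E D) (Z : rcomod E' D)
  (T : rcomod E'' D) (g : chom Z T) (f : chom Y Z) (h : chom Y T) z :
  (forall y, h y = g (f y)) -> img_map0 h z = img_map0 g (img_map0 f z).
Proof.
move=> H.
have -> : img_map0 h = fmap F (rrestr_map g : @khom _ (comod_cat D) _ _) ⊚
    fmap F (rrestr_map f : @khom _ (comod_cat D) _ _).
  by rewrite -fmapM; congr (fmap F _); exact: chom_ext.
by [].
Qed.

(* For a comodule Y with a compatible left E-action, F(Y) with the left
   E-action induced by functoriality. *)
Section Object.
Variables (E : algType k) (Y : rcomod E D).

Definition img_bimod : bimod E A.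
refine (@Bimod k E A (F (rrestr Y))
  (fun a z => img_map0 (lactc Y a) z)
  (@ract _ _ _ (F (rrestr Y))) _ _ _ _ _ _ _ _ _ _).
- abstract (by move=> a x y; rewrite rfunD).
- abstract (by move=> x a b; rewrite -chom_addE -img_map0D;
    congr (rfun (chr (img_map0 _)) x); apply: chom_ext => y /=; rewrite lactDl).
- abstract (by move=> x; rewrite img_map01// => y /=; rewrite lact1).
- abstract (by move=> a b x; apply: img_map0M => y /=; rewrite lactM).
- abstract (exact: ractDl).
- abstract (exact: ractDr).
- abstract (exact: ract1).
- abstract (exact: ractM).
- abstract (by move=> c x b; rewrite rfunr).
- abstract (by move=> c x; rewrite -[RHS]/(rfun (chr (c *: idc (F (rrestr Y)))) x)
    -(img_map01 (f := idc Y))// -img_map0Z; congr (rfun (chr (img_map0 _)) x);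
    apply: chom_ext => y /=; rewrite ksym).
Defined.

Definition img_in : rhom (F (rrestr Y)) img_bimod :=
  @RHom _ _ _ _ (F (rrestr Y)) img_bimod (fun x => x) (fun _ _ => erefl) (fun _ _ => erefl).
Definition img_out : rhom img_bimod (F (rrestr Y)) :=
  @RHom _ _ _ _ img_bimod (F (rrestr Y)) (fun x => x) (fun _ _ => erefl) (fun _ _ => erefl).

Lemma img_act (a : E) :
  exists l : chom (F (rrestr Y)) (F (rrestr Y)), forall y, a *> img_in y = img_in (l y).
Proof. by exists (img_map0 (lactc Y a)). Qed.

Definition img : rcomod E C :=
  @transp _ _ _ _ _ (F (rrestr Y)) img_bimod img_in img_out
    (fun _ => erefl) (fun _ => erefl) img_act.

Definition img_inc : chom (F (rrestr Y)) img :=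
  @CHom _ _ _ _ _ (F (rrestr Y)) img img_in (fun _ => erefl).
Definition img_outc : chom img (F (rrestr Y)).
refine (@CHom _ _ _ _ _ img (F (rrestr Y)) img_out _).
abstract (by move=> y; rewrite -(@tmap_comp _ _ _ _ _ _ _ _ _ _ _ _ _ _ _ _
  (rid (F (rrestr Y))) (bid C))// tmap_id).
Defined.
End Object.

Definition img_map (E E' : algType k) (Y : rcomod E D) (Z : rcomod E' D) (f : chom Y Z) :
  chom (img Y) (img Z) := ccomp (img_inc Z) (ccomp (img_map0 f) (img_outc Y)).

Section Map.
Variables (E E' E'' : algType k).
Variables (Y : rcomod E D) (Z : rcomod E' D) (T : rcomod E'' D).
Lemma img_map_comp (g : chom Z T) (f : chom Y Z) (h : chom Y T) z :
  (forall y, h y = g (f y)) -> img_map h z = img_map g (img_map f z).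
Proof.
exact: img_map0M.
Qed.
Lemma img_map_compE (g : chom Z T) (f : chom Y Z) z :
  img_map g (img_map f z) = img_map (ccomp g f) z.
Proof. by symmetry; exact: img_map_comp. Qed.
Lemma img_map_ext (f g : chom Y Z) z : (forall y, f y = g y) -> img_map f z = img_map g z.
Proof. by move=> H; congr (rfun (chr (img_map _)) z); exact: chom_ext. Qed.
Lemma img_mapD (f g h : chom Y Z) z :
  (forall y, h y = f y + g y) -> img_map h z = img_map f z + img_map g z.
Proof.
move=> H; have -> : h = f + g by exact: chom_ext.
by rewrite /= img_map0D.
Qed.
Lemma img_map1 (f : chom Y Y) z : (forall y, f y = y) -> img_map f z = z.
Proof. by move=> H; rewrite /= img_map01. Qed.
Lemma img_lact a (z : img Y) : a *> z = img_map (lactc Y a) z.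
Proof. by []. Qed.
End Map.

Lemma img_map_l (E : algType k) (Y Z : rcomod E D) (f : echom Y Z) a :
  {morph img_map f : x / a *> x}.
Proof.
move=> x; rewrite !img_lact -[RHS](@img_map_comp _ _ _ _ _ _ _ _ (ccomp (lactc Z a) f))//.
by symmetry; apply: img_map_comp => y /=; rewrite rfunl.
Qed.
Definition img_emap (E : algType k) (Y Z : rcomod E D) (f : echom Y Z) :
    echom (img Y) (img Z) :=
  @EHom _ _ _ _ (img Y) (img Z) (@BHom _ _ _ (img Y) (img Z) (img_map f) (img_map_l f))
    (chomP (img_map f)).

(* The canonical map W ⨂ F(Y) -> F(W ⨂ Y). *)
Section Canonical.
Variables (E E' : algType k) (W : bimod E E') (Y : rcomod E' D).

Definition wten (w : W) : chom Y (tens_comod W Y).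
refine (@CHom _ _ _ _ _ Y (tens_comod W Y) (wtenr Y w) _).
abstract (by move=> y; rewrite tens_comodE; tens_elim (rho Y y) => m d; rewrite tmapE tassocVE).
Defined.

Definition canon_fun (w : W) (z : img Y) : img (tens_comod W Y) := img_map (wten w) z.
Lemma canon_bal : balanced canon_fun.
Proof.
split=> [z w w'|w z z'|w b z].
- by apply: img_mapD => y /=; rewrite tensDl.
- exact: rfunD.
- rewrite /canon_fun img_lact -(@img_map_comp _ _ _ _ _ _ _ _ (wten (w <* b)))// => y /=.
  by rewrite tensM.
Qed.
Lemma canon_r w z a : canon_fun w (z <* a) = canon_fun w z <* a.
Proof. exact: rfunr. Qed.
Definition canonr : rhom (W ⨂ img Y) (img (tens_comod W Y)) := tens_rhom canon_bal canon_r.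
Lemma canonrE w z : canonr (w ⊗ z) = img_map (wten w) z.
Proof. exact: tens_rhomE. Qed.
Lemma canon_l a w z : canonr ((a *> w) ⊗ z) = a *> canonr (w ⊗ z).
Proof.
rewrite !canonrE img_lact; apply: img_map_comp => y.
by rewrite -[RHS]/(a *> (w ⊗ y)) lact_ten.
Qed.
Definition canon : bhom (W ⨂ img Y) (img (tens_comod W Y)) := tens_bhom canon_l.
Lemma canonE w z : canon (w ⊗ z) = img_map (wten w) z.
Proof. exact: canonrE. Qed.
Lemma canon_rho x : rho (img (tens_comod W Y)) (canon x) =
  tmap canon (bid C) (rho (tens_comod W (img Y)) x).
Proof.
tens_elim x => w z; rewrite canonE chomP tens_comodE.
by tens_elim (rho (img Y) z) => m c; rewrite tassocVE !tmapE canonE.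
Qed.
End Canonical.

Definition canon_iso : Prop :=
  forall (E E' : algType k) (W : bimod E E') (Y : rcomod E' D), bijective (canon W Y).
End Image.

Section CanonicalTheory.
Variables (k : comNzRingType) (A B : algType k) (C : coring A) (D : coring B).
Variables (F : functor (comod_cat D) (comod_cat C)) (linF : linear_functor F).
Local Notation img := (img linF).
Local Notation canon := (canon linF).

Lemma canon_natl (E E' E'' : algType k) (W : bimod E E') (W' : bimod E'' E')
    (Y : rcomod E' D) (f : rhom W W') x :
  canon W' Y (tmap f (bid (img Y)) x) = img_map linF (tens_map f (idec Y)) (canon W Y x).
Proof.
tens_elim x => w z; rewrite tmapE !canonE -[RHS](@img_map_comp _ _ _ _ _ _ linF _ _ _ _ _ _
  (tens_map f (idec Y)) (wten Y w) (ccomp (tens_map f (idec Y)) (wten Y w)))//.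
by apply: img_map_ext => y; rewrite -[RHS]/(tmap f (bid Y) (w ⊗ y)) tmapE.
Qed.

Lemma canon_natr (E E' : algType k) (W : bimod E E') (Y Y' : rcomod E' D)
    (g : echom Y Y') x :
  canon W Y' (tmap (bid W) (img_emap linF g) x) =
  img_map linF (tens_map (bid W) g) (canon W Y x).
Proof.
tens_elim x => w z; rewrite tmapE !canonE.
rewrite -[LHS](@img_map_comp _ _ _ _ _ _ linF _ _ _ _ _ _ (wten Y' w) g (ccomp (wten Y' w) g))//.
apply: img_map_comp => y; by rewrite -[RHS]/(tmap (bid W) g (w ⊗ y)) tmapE.
Qed.

Lemma canon_assoc (E E' E'' : algType k) (W : bimod E E') (Z : bimod E' E'')
    (Y : rcomod E'' D) (x : (W ⨂ Z) ⨂ img Y) :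
  canon W (tens_comod Z Y) (tmap (bid W) (canon Z Y) (tassoc _ _ _ x)) =
  img_map linF (tens_assoc W Z Y) (canon (W ⨂ Z) Y x).
Proof.
tens_elim x => wz y; tens_elim wz => w z; rewrite tassocE tmapE !canonE.
rewrite -[LHS](@img_map_comp _ _ _ _ _ _ linF _ _ _ _ _ _
  (wten (tens_comod Z Y) w) (wten Y z) (ccomp (wten (tens_comod Z Y) w) (wten Y z)))//.
apply: img_map_comp => y'.
by rewrite -[RHS]/(tassoc _ _ _ ((w ⊗ z) ⊗ y')) tassocE.
Qed.

Definition lunitc (E : algType k) (Y : rcomod E D) : chom (tens_comod (reg E) Y) Y.
refine (@CHom _ _ _ _ _ (tens_comod (reg E) Y) Y (lunit Y) _).
abstract (by move=> x; tens_elim x => a y; rewrite lunitE tens_comodE rfunl;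
  tens_elim (rho Y y) => m d; rewrite tassocVE tmapE lunitE lact_ten).
Defined.

Lemma canon_unit (E : algType k) (Y : rcomod E D) (x : reg E ⨂ img Y) :
  lunit _ x = img_map linF (lunitc Y) (canon (reg E) Y x).
Proof.
tens_elim x => a z; rewrite lunitE canonE img_lact; apply: img_map_comp => y.
by rewrite -[RHS]/(lunit Y (a ⊗ y)) lunitE.
Qed.

Section Inverse.
Hypothesis ci : canon_iso linF.
Variables (E E' : algType k) (W : bimod E E') (Y : rcomod E' D).

Lemma canonV_ex : exists g, cancel (canon W Y) g /\ cancel g (canon W Y).
Proof. by have [g ? ?] := ci W Y; exists g. Qed.
Definition canonV_fun : img (tens_comod W Y) -> W ⨂ img Y := projT1 (boolp.cid canonV_ex).
Lemma canonV_funK : cancel canonV_fun (canon W Y).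
Proof. exact: (projT2 (boolp.cid canonV_ex)).2. Qed.
Lemma canon_inj : injective (canon W Y).
Proof. exact: can_inj (projT2 (boolp.cid canonV_ex)).1. Qed.
Definition canonVr : rhom (img (tens_comod W Y)) (W ⨂ img Y).
refine (@RHom _ _ _ _ (img (tens_comod W Y)) (W ⨂ img Y) canonV_fun _ _).
- abstract (by move=> x y; apply: canon_inj; rewrite rfunD !canonV_funK).
- abstract (by move=> b x; apply: canon_inj; rewrite rfunr !canonV_funK).
Defined.
Definition canonV : bhom (img (tens_comod W Y)) (W ⨂ img Y).
refine (@BHom _ _ _ (img (tens_comod W Y)) (W ⨂ img Y) canonVr _).
abstract (by move=> a x; apply: canon_inj; rewrite rfunl !canonV_funK).
Defined.
Lemma canonVK : cancel canonV (canon W Y). Proof. exact: canonV_funK. Qed.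
Lemma canonK : cancel (canon W Y) canonV.
Proof. by move=> x; apply: canon_inj; rewrite canonVK. Qed.
Lemma canonV_rho x : rho (tens_comod W (img Y)) (canonV x) =
  tmap canonV (bid C) (rho (img (tens_comod W Y)) x).
Proof.
rewrite -[in RHS](canonVK x) canon_rho.
rewrite -(@tmap_comp _ _ _ _ _ _ _ _ _ _ _ _ _ _ _ _ (rid _) (bid C)) ?tmap_id// => y.
by rewrite canonK.
Qed.
End Inverse.

Definition comul_echom : echom (coring_rcomod D) (tens_comod D (coring_rcomod D)).
refine (@EHom _ _ _ _ (coring_rcomod D) (tens_comod D (coring_rcomod D)) (comul D) _).
abstract (by move=> x; apply: (can_inj (tassocK (M := D) (N := D) (P := D)));
  rewrite [RHS]comulA [LHS]tassocVK).
Defined.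

Section Bicomodule.
Hypothesis ci : canon_iso linF.
Local Notation FD := (img (coring_rcomod D)).

(* The left coaction is F(Δ) followed by the inverse of the canonical map
   D ⨂ F(D) -> F(D ⨂ D). *)
Definition img_lam : bhom FD (D ⨂ FD) :=
  bcomp (canonV ci D (coring_rcomod D)) (img_emap linF comul_echom).

Lemma img_lamE x : canon D (coring_rcomod D) (img_lam x) = img_map linF comul_echom x.
Proof. exact: canonVK. Qed.

Lemma img_lamA x : tassoc _ _ _ (tmap (comul D) (bid FD) (img_lam x)) =
  tmap (bid D) img_lam (img_lam x).
Proof.
have inj_tmap : injective (tmap (bid D) (canon D (coring_rcomod D))).
  apply: (can_inj (g := tmap (bid D) (canonV ci D (coring_rcomod D)))) => y.
  rewrite -(@tmap_comp _ _ _ _ _ _ _ _ _ _ _ _ _ _ _ _ (bid D) (bid (D ⨂ FD))) ?tmap_id//.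
  by move=> z; rewrite canonK.
apply: inj_tmap; apply: (canon_inj ci).
rewrite canon_assoc canon_natl img_lamE.
rewrite -[in RHS](@tmap_comp _ _ _ _ _ _ _ _ _ _ _ _ _ _ _ _ (bid D)
  (img_emap linF comul_echom))//; last by move=> z; rewrite img_lamE.
rewrite canon_natr img_lamE.
rewrite !img_map_compE.
apply: img_map_ext => y; exact: comulA.
Qed.

Lemma img_lam1 x : lunit _ (tmap (coeps D) (bid FD) (img_lam x)) = x.
Proof.
rewrite canon_unit canon_natl img_lamE.
rewrite !img_map_compE.
apply: img_map1 => y; exact: coepsl.
Qed.

Lemma img_lam_rho x : tassoc _ _ _ (tmap img_lam (bid C) (rho FD x)) =
  tmap (bid D) (rho FD) (img_lam x).
Proof.
apply: (can_inj (tassocVK (M := D) (N := FD) (P := C))); rewrite tassocK.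
rewrite -[RHS]/(rho (tens_comod D FD) (img_lam x)) canonV_rho.
rewrite (echomP (img_emap linF comul_echom)).
exact: tmap_comp.
Qed.

Definition img_bicomod : bicomod D C := BiComod img_lamA img_lam1 img_lam_rho.
End Bicomodule.
End CanonicalTheory.

Section Composition.
Variable (k : comNzRingType).

Definition fcomp (K L M : kcat k) (G : functor L M) (F : functor K L) : functor K M.
refine (@Functor k K M (fun X => G (F X)) (fun X Y f => fmap G (fmap F f)) _ _).
- abstract (by move=> X; rewrite !fmap1).
- abstract (by move=> X Y Z g f; rewrite !fmapM).
Defined.

Definition adj_comp (K L M : kcat k) (F : functor K L) (G : functor L K)
  (F' : functor L M) (G' : functor M L) (a : adjunction F G) (a' : adjunction F' G') :
  adjunction (fcomp F' F) (fcomp G G').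
refine (@Adjunction k K M (fcomp F' F) (fcomp G G')
  (fun X => fmap G (aunit a' (F X)) ⊚ aunit a X)
  (fun Y => acounit a' Y ⊚ fmap F' (acounit a (G' Y))) _ _ _ _).
- abstract (by move=> X X' f /=; rewrite kcompA -fmapM aunit_nat fmapM -!kcompA aunit_nat).
- abstract (by move=> Y Y' g /=; rewrite -kcompA -fmapM acounit_nat fmapM !kcompA acounit_nat).
- abstract (by move=> X /=; rewrite -kcompA -fmapM [fmap F (_ ⊚ _)]fmapM kcompA acounit_nat
    -kcompA atri1 kcomp1r atri1).
- abstract (by move=> Y /=; rewrite kcompA -fmapM [fmap G' (_ ⊚ _)]fmapM -kcompA aunit_nat
    kcompA atri2 kcomp1l atri2).
Defined.
End Composition.

Lemma tens_functor_linear (k : comNzRingType) (A B : algType k) (D : coring B)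
  (N : rcomod A D) : linear_functor (tens_functor N).
Proof.
move=> X Y c f g; apply: chom_ext => t.
rewrite -[LHS]/(tmap (c *: f + g) (bid N) t).
rewrite -[RHS]/(tmap f (bid N) t <* c%:A + tmap g (bid N) t).
elim/tensb_ind: t => [m n|x y hx hy|].
- by rewrite !tmapE rhom_addE rhom_scaleE tensDl ract_ten tensM ksym.
- by rewrite !rfunD hx hy ractDl addrACA.
- by rewrite !rfun0 ract0 addr0.
Qed.

(* The forgetful functor is left adjoint to - ⨂ C. *)
Section ForgetAdjunction.
Variables (k : comNzRingType) (A : algType k) (C : coring A).

Definition forget_unit (X : rcomod k^o C) : chom X (tens_comod X (coring_rcomod C)).
refine (@CHom _ _ _ _ _ X (tens_comod X (coring_rcomod C)) (rho X) _).
abstract (by move=> x; apply: (can_inj (tassocK (M := X) (N := C) (P := C)));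
  rewrite [RHS]rhoA [LHS]tassocVK).
Defined.
Definition forget_counit (M : bimod k^o A) : rhom (M ⨂ C) M :=
  rcomp (runit M) (tmap (bid M) (coeps C)).

Lemma forget_counitE (M : bimod k^o A) (m : M) (c : C) : forget_counit M (m ⊗ c) = m <* (coeps C c : A).
Proof. by rewrite /= tmapE runitE. Qed.

Definition forget_adj : adjunction (forget C) (tens_functor (coring_rcomod C)).
refine (@Adjunction k (comod_cat C) (mod_cat A) (forget C) (tens_functor (coring_rcomod C))
  forget_unit forget_counit _ _ _ _).
- abstract (by move=> X X' f; apply: chom_ext => x; rewrite [RHS]chomP).
- abstract (by move=> M M' f; apply: rhom_ext => x;
    rewrite -[LHS]/(forget_counit M' (tmap f (bid C) x))
      -[RHS]/(f (forget_counit M x)); tens_elim x => m c;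
    rewrite tmapE !forget_counitE rfunr).
- abstract (by move=> X; apply: rhom_ext => x; exact: rho1).
- abstract (move=> M; apply: chom_ext => x;
    rewrite -[LHS]/(tmap (forget_counit M) (bid C)
      (rho (tens_comod M (coring_rcomod C)) x)) -[RHS]/x;
    tens_elim x => m c; rewrite tens_comodE -[in RHS](coepsl c);
    by tens_elim (comul C c) => c1 c2;
      rewrite tassocVE !tmapE forget_counitE lunitE tensM).
Defined.
End ForgetAdjunction.

Lemma adj_transpose (k : comNzRingType) (K L : kcat k) (F : functor K L) (G : functor L K)
  (adj : adjunction F G) X Y (w : khom X (G Y)) :
  fmap G (acounit adj Y ⊚ fmap F w) ⊚ aunit adj X = w.
Proof. by rewrite fmapM -kcompA aunit_nat kcompA atri2 kcomp1l. Qed.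

Lemma adj_transposeV (k : comNzRingType) (K L : kcat k) (F : functor K L) (G : functor L K)
  (adj : adjunction F G) X Y (u : khom (F X) Y) :
  acounit adj Y ⊚ fmap F (fmap G u ⊚ aunit adj X) = u.
Proof. by rewrite fmapM kcompA acounit_nat -kcompA atri1 kcomp1r. Qed.

Lemma mod_congr (k : comNzRingType) (A : algType k) (M N : bimod k^o A)
  (u v : @khom k (mod_cat A) M N) :
  u = v -> forall x : M, (u : rhom M N) x = (v : rhom M N) x.
Proof. by move=> ->. Qed.
Lemma comod_congr (k : comNzRingType) (A : algType k) (C : coring A) (M N : rcomod k^o C)
  (u v : @khom k (comod_cat C) M N) :
  u = v -> forall x : M, (u : chom M N) x = (v : chom M N) x.
Proof. by move=> ->. Qed.

Section CanonicalIso.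
Variables (k : comNzRingType) (A B : algType k) (C : coring A) (D : coring B).
Variables (F : functor (comod_cat D) (comod_cat C)) (linF : linear_functor F).
Variables (H : functor (mod_cat A) (comod_cat D)).
Variable (adj : adjunction (fcomp (forget C) F) H).
Variables (E E' : algType k) (W : bimod E E') (Y : rcomod E' D).

Let L := fcomp (forget C) F.
Let T : mod_cat A := restr (W ⨂ img linF Y).

Let linH : linear_functor H.
Proof. by apply: (right_adjoint_linear adj) => X Z c f g /=; rewrite linF. Qed.

Definition ci_j (w : W) : rhom (F (rrestr Y)) (restr (W ⨂ img linF Y)) :=
  rcomp (restr_in _) (rcomp (wtenr (img linF Y) w) (img_in linF Y)).
Let j (w : W) : @khom k (mod_cat A) (L (rrestr Y)) T := ci_j w.
Let eta (w : W) : chom (rrestr Y) (H T) := fmap H (j w) ⊚ aunit adj (rrestr Y).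
Definition ci_phi (w : W) : chom Y (H T) := ccomp (eta w) (rrestr_in Y).

Lemma ci_phi_bal : balanced (fun w y => ci_phi w y).
Proof.
split=> [y w w'|w y y'|w b y].
- rewrite -chom_addE; congr (rfun (chr _) y).
  have -> : ci_phi (w + w') = ccomp (fmap H (j (w + w')) ⊚ aunit adj (rrestr Y)) (rrestr_in Y).
    by [].
  have -> : j (w + w') = 1 *: j w + j w'.
    by rewrite scale1r; apply: rhom_ext => z; rewrite -[LHS]/(_ ⊗ _) tensDl.
  by rewrite linH kcomp_linl scale1r; apply: chom_ext.
- exact: rfunD.
- have E1 : j (w <* b) = j w ⊚ fmap L (rrestr_map (lactc Y b) : @khom _ (comod_cat D) _ _).
    apply: rhom_ext => z; rewrite -[LHS]/((w <* b) ⊗ (z : img linF Y)) tensM.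
    by rewrite img_lact.
  rewrite -[LHS]/(rfun (chr (fmap H (j (w <* b)) ⊚ aunit adj (rrestr Y))) y).
  by rewrite E1 fmapM -kcompA aunit_nat kcompA.
Qed.
Lemma ci_phi_r w y b : ci_phi w (y <* b) = ci_phi w y <* b. Proof. exact: rfunr. Qed.
Let psir : rhom (W ⨂ Y) (H T) := tens_rhom ci_phi_bal ci_phi_r.
Let psirE w y : psir (w ⊗ y) = ci_phi w y. Proof. exact: tens_rhomE. Qed.
Lemma ci_psi_rho x : rho (H T) (psir x) = tmap psir (bid D) (rho (tens_comod W Y) x).
Proof.
tens_elim x => w y; rewrite psirE chomP tens_comodE.
by tens_elim (rho Y y) => m d; rewrite tassocVE !tmapE psirE.
Qed.
Let psi : chom (tens_comod W Y) (H T) := @CHom _ _ _ _ _ (tens_comod W Y) (H T) psir ci_psi_rho.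
Let psi0 : @khom _ (comod_cat D) (rrestr (tens_comod W Y)) (H T) :=
  ccomp psi (rrestr_out (tens_comod W Y)).
Let Psi : @khom _ (mod_cat A) (L (rrestr (tens_comod W Y))) T := acounit adj T ⊚ fmap L psi0.
Let rwten w : @khom _ (comod_cat D) (rrestr Y) (rrestr (tens_comod W Y)) :=
  rrestr_map (wten Y w).

Let Psi_wten w : Psi ⊚ fmap L (rwten w) = j w.
Proof.
rewrite -[RHS](adj_transposeV adj) -kcompA -fmapM; congr (_ ⊚ fmap L _).
by apply: chom_ext => y; rewrite -[LHS]/(psir (w ⊗ (y : Y))) psirE.
Qed.

Let cc : @khom _ (mod_cat A) T (L (rrestr (tens_comod W Y))) :=
  rcomp (img_out linF (tens_comod W Y)) (rcomp (canon linF W Y) (restr_out _)).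

Let ccj w : cc ⊚ j w = fmap L (rwten w).
Proof.
by apply: rhom_ext => z; rewrite -[LHS]/(canon linF W Y (w ⊗ (z : img linF Y))) canonE.
Qed.

Lemma canon_bij : bijective (canon linF W Y).
Proof.
exists (fun x : img linF (tens_comod W Y) => (Psi : rhom _ _) x : W ⨂ img linF Y) => x.
- have PsiD : {morph (fun x : img linF (tens_comod W Y) =>
      (Psi : rhom _ _) x : W ⨂ img linF Y) : x y / x + y} := rfunD (Psi : rhom _ _).
  elim/tensb_ind: x => [w z|x y hx hy|].
  + rewrite canonE.
    exact: (mod_congr (Psi_wten w) z).
  + by rewrite rfunD PsiD hx hy.
  + by rewrite rfun0 (morphD0 PsiD).
- have H1 : cc ⊚ Psi = kid (L (rrestr (tens_comod W Y))).
    apply: (adj_inj_l (adj := adj)); rewrite fmapM fmap1 kcomp1l -kcompA adj_transpose.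
    apply: chom_ext => t; rewrite -[LHS]/((fmap H cc : chom _ _) (psir (t : W ⨂ Y))).
    pose al : chom _ _ := aunit adj (rrestr (tens_comod W Y)).
    have alD : {morph (fun t : W ⨂ Y => al t) : x y / x + y} := rfunD al.
    rewrite -[RHS]/(al t).
    elim/tensb_ind: (t : W ⨂ Y) => [w y|u v hu hv|].
    + rewrite psirE.
      have := comod_congr (aunit_nat adj (rwten w)) (y : rrestr Y).
      by rewrite -ccj fmapM -kcompA.
    + by rewrite alD (rfunD psir) rfunD hu hv.
    + by rewrite (morphD0 alD) (rfun0 psir) rfun0.
  exact: (mod_congr H1 x).
Qed.
End CanonicalIso.

Section LeftAdjointImage.
Variables (k : comNzRingType) (A B : algType k) (C : coring A) (D : coring B).
Variables (F : functor (comod_cat D) (comod_cat C)) (linF : linear_functor F).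
Variables (G : functor (comod_cat C) (comod_cat D)) (adj : left_adjoint F G).

Lemma left_adjoint_canon_iso : canon_iso linF.
Proof.
by case: adj => a E E' W Y; exact: (canon_bij linF (adj_comp a (forget_adj C))).
Qed.

Definition image_bicomod : bicomod D C := img_bicomod left_adjoint_canon_iso.
End LeftAdjointImage.

Record cohom (k : comNzRingType) (A B : algType k) (D : coring B) (N : rcomod A D) :=
Cohom {
  cohom_fun :> functor (comod_cat D) (mod_cat A);
  cohom_adj : adjunction cohom_fun (tens_functor N) }.

Definition quasi_finite (k : comNzRingType) (A B : algType k) (D : coring B)
    (N : rcomod A D) : Prop :=
  exists h : functor (comod_cat D) (mod_cat A), left_adjoint h (tens_functor N).

Definition injector (k : comNzRingType) (A B : algType k) (D : coring B)
  (N : rcomod A D) : Prop := preserves_injectives (tens_functor N).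

Section CohomComodule.
Variables (k : comNzRingType) (A B : algType k) (C : coring A) (D : coring B).
Variables (N : bicomod C D) (h : cohom N).

Section Coaction.
Variable Y : rcomod k^o D.
Local Notation hY := (h Y : bimod k^o A).

Definition cohom_unit : chom Y (tens_comod hY N) := aunit (cohom_adj h) Y.

Lemma cohom_inj (M : bimod k^o A) (u v : rhom hY M) :
  (forall y, tmap u (bid N) (cohom_unit y) = tmap v (bid N) (cohom_unit y)) -> u =1 v.
Proof.
move=> H; suff: u = v :> @khom _ (mod_cat A) (h Y) M by move=> ->.
by apply: (adj_inj_l (adj := cohom_adj h)); apply: chom_ext => y; exact: H.
Qed.

(* The unique right linear map ρ with (ρ ⨂ N) θ = (h(Y) ⨂ λ_N) θ. *)
Definition cohom_rhor : rhom hY (hY ⨂ C) :=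
  @kcomp k (mod_cat A) _ _ _ (acounit (cohom_adj h) (hY ⨂ C))
    (@fmap k _ _ h Y (tens_comod (hY ⨂ C) N)
      (ccomp (tens_assocV hY C N) (ccomp (tens_map (bid hY) (lam_echom N)) cohom_unit))).
Definition cohom_rho : bhom hY (hY ⨂ C) := kbhom cohom_rhor.

Lemma cohom_rhoE y : tmap cohom_rho (bid N) (cohom_unit y) =
  tassocV _ _ _ (tmap (bid hY) (lam N) (cohom_unit y)).
Proof.
exact: (comod_congr (adj_transpose (cohom_adj h) (Y := hY ⨂ C)
  (ccomp (tens_assocV hY C N) (ccomp (tens_map (bid hY) (lam_echom N)) cohom_unit))) y).
Qed.

Lemma cohom_rhoA x :
  tassoc _ _ _ (tmap cohom_rho (bid C) (cohom_rho x)) =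
  tmap (bid hY) (comul C) (cohom_rho x).
Proof.
apply: (cohom_inj (u := rcomp (tassoc _ _ _) (rcomp (tmap cohom_rho (bid C)) cohom_rho))
  (v := rcomp (tmap (bid hY) (comul C)) cohom_rho)) => y.
rewrite [RHS](tmap_comp (f := cohom_rho) (f' := tmap (bid hY) (comul C)) (g := bid N)
  (g' := bid N))//.
rewrite [LHS](tmap_comp (f := cohom_rho) (f' := rcomp (tassoc hY C C) (tmap cohom_rho (bid C)))
  (g := bid N) (g' := bid N))// cohom_rhoE.
have H1 (t : hY ⨂ (C ⨂ N)) :
    tmap (rcomp (tassoc hY C C) (tmap cohom_rho (bid C))) (bid N) (tassocV _ _ _ t) =
    tmap (tassoc hY C C) (bid N) (tassocV _ _ _ (tmap cohom_rho (bid (C ⨂ N)) t)).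
  by tens_elim t => z u; tens_elim u => c n; rewrite tassocVE !tmapE tassocVE tmapE /= tmapE.
have H2 (t : hY ⨂ N) :
    tmap cohom_rho (bid (C ⨂ N)) (tmap (bid hY) (lam N) t) =
    tmap (bid (hY ⨂ C)) (lam N) (tmap cohom_rho (bid N) t).
  by tens_elim t => z n; rewrite !tmapE.
rewrite H1 H2 cohom_rhoE.
tens_elim (cohom_unit y) => z n; rewrite !tmapE.
have H3 (u : C ⨂ N) :
    tmap (tassoc hY C C) (bid N) (tassocV _ _ _ (tmap (bid (hY ⨂ C)) (lam N)
      (tassocV _ _ _ (z ⊗ u)))) =
    tassocV _ _ _ (z ⊗ tassocV _ _ _ (tmap (bid C) (lam N) u)).
  tens_elim u => c m; rewrite tassocVE !tmapE.
  by tens_elim (lam N m) => c' n'; rewrite !tassocVE tmapE tassocE.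
have H4 (u : C ⨂ N) :
    tmap (tmap (bid hY) (comul C)) (bid N) (tassocV _ _ _ (z ⊗ u)) =
    tassocV _ _ _ (z ⊗ tmap (comul C) (bid N) u).
  by tens_elim u => c m; rewrite tassocVE !tmapE tassocVE.
by rewrite H3 H4 -lamA tassocK.
Qed.

Lemma cohom_rho1 x : runit _ (tmap (bid hY) (coeps C) (cohom_rho x)) = x.
Proof.
apply: (cohom_inj (u := rcomp (runit _) (rcomp (tmap (bid hY) (coeps C)) cohom_rho))
  (v := rid hY)) => y.
rewrite tmap_id.
rewrite [LHS](tmap_comp (f := cohom_rho) (f' := rcomp (runit hY) (tmap (bid hY) (coeps C)))
  (g := bid N) (g' := bid N))// cohom_rhoE.
tens_elim (cohom_unit y) => z n; rewrite tmapE -[in RHS](lam1 n).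
by tens_elim (lam N n) => c m; rewrite tassocVE !tmapE /= tmapE runitE lunitE tensM.
Qed.

Definition cohom_comod : rcomod k^o C := RComod cohom_rhoA cohom_rho1.
End Coaction.

Lemma cohom_map_rho (Y Y' : rcomod k^o D) (f : chom Y Y') x :
  cohom_rho Y' (fmap h (f : @khom _ (comod_cat D) Y Y') x) =
  tmap (fmap h (f : @khom _ (comod_cat D) Y Y') : rhom _ _) (bid C) (cohom_rho Y x).
Proof.
set hf : rhom (h Y) (h Y') := fmap h _.
have nat y : tmap hf (bid N) (cohom_unit Y y) = cohom_unit Y' (f y).
  exact: (comod_congr (aunit_nat (cohom_adj h) f) y).
apply: (cohom_inj (u := rcomp (cohom_rho Y') hf)
  (v := rcomp (tmap hf (bid C)) (cohom_rho Y))) => y.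
rewrite [LHS](tmap_comp (f := hf) (f' := cohom_rho Y') (g := bid N) (g' := bid N))//.
rewrite [RHS](tmap_comp (f := cohom_rho Y) (f' := tmap hf (bid C)) (g := bid N) (g' := bid N))//.
rewrite nat !cohom_rhoE -nat.
tens_elim (cohom_unit Y y) => z n; rewrite !tmapE.
by tens_elim (lam N n) => c m; rewrite !tassocVE !tmapE.
Qed.

(* The cohom functor with values in right C-comodules. *)
Definition cohom_functor : functor (comod_cat D) (comod_cat C).
refine (@Functor k (comod_cat D) (comod_cat C) cohom_comod
  (fun Y Y' f => @CHom _ _ _ _ _ (cohom_comod Y) (cohom_comod Y') (fmap h f)
    (cohom_map_rho f)) _ _).
- abstract (by move=> Y; apply: chr_inj; exact: (@fmap1 _ _ _ h Y)).
- abstract (by move=> X Y Z g f; apply: chr_inj; exact: (@fmapM _ _ _ h X Y Z g f)).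
Defined.

Lemma cohom_linear : linear_functor cohom_functor.
Proof.
move=> X Y c f g; apply: chr_inj.
exact: (left_adjoint_linear (cohom_adj h) (@tens_functor_linear _ _ _ _ N)).
Qed.

Definition cohom_adj' : adjunction (fcomp (forget C) cohom_functor) (tens_functor N) :=
  @Adjunction k _ _ (fcomp (forget C) cohom_functor) (tens_functor N)
    (aunit (cohom_adj h)) (acounit (cohom_adj h)) (aunit_nat (cohom_adj h))
    (acounit_nat (cohom_adj h)) (atri1 (cohom_adj h)) (atri2 (cohom_adj h)).

Lemma cohom_canon_iso : canon_iso cohom_linear.
Proof. by move=> E E' W Y; exact: (canon_bij cohom_linear cohom_adj'). Qed.

(* The bicomodule h_D(N, D). *)
Definition cohom_bicomod : bicomod D C := img_bicomod cohom_canon_iso.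
End CohomComodule.

(* Main.v *)
(* Three facts carry the proof.
   - The cohom functor h_D(X, -), with values in M^C, is left adjoint to - □_C X;
     conversely, as (- ⨂ C) □_C X ≅ - ⨂ X and - ⨂ C is right adjoint to the forgetful
     functor, any left adjoint of - □_C X becomes a cohom functor of X once the
     coaction is forgotten.
   - M is the kernel of M ⨂ C -> M ⨂ C ⨂ C, so a functor F with
     F(W ⨂ C) ≅ W ⨂ F(C) that preserves this kernel is - □_C F(C). Right adjoints
     preserve it.
   - If L is an injector, h_C(L, -) preserves it too: a functional from h_C(L, Y) to
     the injective cogenerator Hom_Z(B, Q/Z) of M_B corresponds to a map from Y to the
     injective comodule Hom_Z(B, Q/Z) ⨂ L, which extends along monomorphisms.
   The implications then follow from uniqueness of adjoints. *)

From HB Require Import structures.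
From mathcomp Require Import all_boot all_algebra.
From mathcomp Require Import boolp classical_sets.
Require Import Defs.

Set Implicit Arguments.
Unset Strict Implicit.
Unset Printing Implicit Defensive.

Import GRing.Theory Num.Theory.
Local Open Scope ring_scope.

(** * Adjunctions and natural isomorphisms *)

Section NaturalIsomorphisms.
Variables (k : comNzRingType) (K L : kcat k).
Implicit Types (F : functor K L).

Lemma nat_iso_sym F F' : nat_iso F F' -> nat_iso F' F.
Proof.
move=> [s [t [ts st nat]]]; exists t, s; split=> // X Y f.
rewrite -[LHS]kcomp1l -ts -!kcompA; congr (t Y ⊚ _).
by rewrite kcompA -nat -kcompA st kcomp1r.
Qed.

Lemma nat_iso_trans F F' F'' : nat_iso F F' -> nat_iso F' F'' -> nat_iso F F''.
Proof.
move=> [s [t [ts st nat]]] [s' [t' [ts' st' nat']]].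
exists (fun X => s' X ⊚ s X), (fun X => t X ⊚ t' X); split=> [X|X|X Y f].
- by rewrite -kcompA (kcompA (t' X)) ts' kcomp1l.
- by rewrite -kcompA (kcompA (s X)) st kcomp1l.
- by rewrite kcompA nat' -!kcompA nat.
Qed.

End NaturalIsomorphisms.

Section Adjoints.
Variables (k : comNzRingType) (K L : kcat k).
Implicit Types (F : functor K L) (G : functor L K).

Lemma left_adjoint_unique F F' G : left_adjoint F G -> left_adjoint F' G -> nat_iso F F'.
Proof.
move=> [a] [a'].
have inv (H H' : functor K L) (b : adjunction H G) (b' : adjunction H' G) X :
    (acounit b' (H X) ⊚ fmap H' (aunit b X)) ⊚ (acounit b (H' X) ⊚ fmap H (aunit b' X)) =
    kid (H X).
  apply: (adj_inj_l (adj := b)).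
  rewrite fmap1 kcomp1l !fmapM -!kcompA aunit_nat (kcompA (fmap G (acounit b _))) atri2 kcomp1l.
  by rewrite aunit_nat kcompA atri2 kcomp1l.
exists (fun X => acounit a (F' X) ⊚ fmap F (aunit a' X)),
  (fun X => acounit a' (F X) ⊚ fmap F' (aunit a X)); split; [exact: inv..|].
move=> X Y f.
by rewrite kcompA -acounit_nat -!kcompA -!fmapM aunit_nat.
Qed.

Lemma left_adjoint_nat_isol F F' G : nat_iso F F' -> left_adjoint F G -> left_adjoint F' G.
Proof.
move=> isoF [a]; have [t [s [st ts nat']]] := nat_iso_sym isoF.
have nat X Y (f : khom X Y) : fmap F' f ⊚ s X = s Y ⊚ fmap F f.
  rewrite -[LHS]kcomp1l -st -!kcompA; congr (s Y ⊚ _).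
  by rewrite kcompA -nat' -kcompA ts kcomp1r.
split; exists (fun X => fmap G (s X) ⊚ aunit a X) (fun Y => acounit a Y ⊚ t (G Y)).
- by move=> X Y f; rewrite kcompA -fmapM nat fmapM -!kcompA aunit_nat.
- by move=> X Y g; rewrite -kcompA -nat' !kcompA acounit_nat.
- move=> X; rewrite -kcompA -nat' fmapM !kcompA acounit_nat -(kcompA (s X)).
  by rewrite atri1 kcomp1r st.
- by move=> Y; rewrite kcompA -fmapM -kcompA ts kcomp1r atri2.
Qed.

Lemma left_adjoint_nat_isor F G G' : nat_iso G G' -> left_adjoint F G -> left_adjoint F G'.
Proof.
move=> isoG [a]; have [t [s [st ts nat']]] := nat_iso_sym isoG.
have nat X Y (f : khom X Y) : fmap G' f ⊚ s X = s Y ⊚ fmap G f.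
  rewrite -[LHS]kcomp1l -st -!kcompA; congr (s Y ⊚ _).
  by rewrite kcompA -nat' -kcompA ts kcomp1r.
split; exists (fun X => s (F X) ⊚ aunit a X) (fun Y => acounit a Y ⊚ fmap F (t Y)).
- by move=> X Y f; rewrite kcompA nat -!kcompA aunit_nat.
- by move=> X Y g; rewrite -kcompA -fmapM -nat' fmapM !kcompA acounit_nat.
- by move=> X; rewrite -kcompA -fmapM kcompA ts kcomp1l atri1.
- by move=> Y; rewrite kcompA nat fmapM -!kcompA aunit_nat (kcompA (fmap G _)) atri2 kcomp1l.
Qed.

(** By transposition, a map into [G I] extends along [i] as soon as its transpose into [I] extends
    along [fmap F i]. *)
Lemma right_adjoint_injectives F G :
  (forall X Y (i : khom X Y), monic i -> monic (fmap F i)) -> left_adjoint F G ->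
  preserves_injectives G.
Proof.
move=> monoF [a] I injI X Y i f mi.
have [g gE] := injI _ _ _ (acounit a I ⊚ fmap F f) (monoF _ _ _ mi).
exists (fmap G g ⊚ aunit a Y).
by rewrite -kcompA -aunit_nat kcompA -fmapM gE adj_transpose.
Qed.

Lemma nat_iso_injectives G G' : nat_iso G G' -> preserves_injectives G -> preserves_injectives G'.
Proof.
move=> [s [t [ts st nat]]] PG I /PG injI X Y i f mi.
have [g gE] := injI _ _ _ (t I ⊚ f) mi.
by exists (s I ⊚ g); rewrite -kcompA gE kcompA st kcomp1l.
Qed.
End Adjoints.

Lemma right_adjoint_monic (k : comNzRingType) (K L : kcat k) (F : functor K L)
    (G : functor L K) : left_adjoint F G -> forall X Y (i : khom X Y), monic i -> monic (fmap G i).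
Proof.
move=> [a] X Y i mi Z f g E; apply: (adj_inj_r (adj := a)); apply: mi.
by rewrite !kcompA -acounit_nat -!kcompA -!fmapM E.
Qed.

(** * Comodule maps *)

Section ComoduleMaps.
Variables (k : comNzRingType) (B : algType k).

(** [i] does not distinguish the inclusion of its kernel from zero, so that inclusion vanishes when
    [i] is monic. *)
Lemma mod_monic_inj (M N : bimod k^o B) (i : rhom M N) :
  monic (i : @khom k (mod_cat B) M N) -> injective i.
Proof.
move=> mi x y ixy.
have h : i (x - y) = 0 by rewrite rfunD rfunN ixy subrr.
have [z zE] := (kernelP i _).1 h.
have E : kincl i = 0.
  by apply: (mi (kernel i)); apply: rhom_ext => w; rewrite /= rfun0; exact: (kincl0 (h := i)).
by apply/eqP; rewrite -subr_eq0 -zE E.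
Qed.

Variables (D : coring B) (flD : flat D).

Lemma inj_comod_monic (Y Z : rcomod k^o D) (i : chom Y Z) :
  injective i -> monic (i : @khom k (comod_cat D) Y Z).
Proof.
by move=> inj_i W f g E; apply: chom_ext => w; apply: inj_i; exact: (comod_congr E w).
Qed.

(** The test object is again the kernel; it is a comodule because [D] is flat. *)
Lemma comod_monic_inj (Y Z : rcomod k^o D) (i : chom Y Z) :
  monic (i : @khom k (comod_cat D) Y Z) -> injective i.
Proof.
move=> mi x y ixy.
have h : i (x - y) = 0 by rewrite rfunD rfunN ixy subrr.
have [z zE] := (kernelP i _).1 h.
have E : ker_incl flD i = 0.
  by apply: (mi (ker_comod flD i)); apply: chom_ext => w; rewrite /= rfun0;
    exact: (kincl0 (h := i)).
by apply/eqP; rewrite -subr_eq0 -zE -[kincl _ _]/(ker_incl flD i z) E.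
Qed.

Lemma forget_monic (Y Z : rcomod k^o D) (i : chom Y Z) :
  monic (i : @khom k (comod_cat D) Y Z) ->
  monic (fmap (forget D) (i : @khom k (comod_cat D) Y Z)).
Proof.
move=> /comod_monic_inj inj_i W f g E; apply: rhom_ext => w; apply: inj_i.
exact: (mod_congr E w).
Qed.

(** Produces the comodule maps into cotensor products, which are kernels. Linearity of the lift is
    checked after [j], colinearity after [tmap j (bid D)], injective by flatness. *)
Lemma chom_lift (E : algType k) (K Y : rcomod k^o D) (W : rcomod E D)
    (j : chom K Y) (u : chom W Y) :
  injective j -> (forall w, exists x, j x = u w) ->
  exists v : chom W K, forall w, j (v w) = u w.
Proof.
move=> inj_j /choice[v vE].
have vD : {morph v : x y / x + y} by move=> x y; apply: inj_j; rewrite rfunD !vE rfunD.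
have vr b : {morph v : x / x <* b} by move=> x; apply: inj_j; rewrite rfunr !vE rfunr.
pose v' := RHom vD vr.
suff vP w : rho K (v' w) = tmap v' (bid D) (rho W w) by exists (CHom vP).
apply: (flat_inj flD inj_j); rewrite -chomP vE chomP.
by tens_elim (rho W w) => m d; rewrite !tmapE /= vE.
Qed.

(** Dual to [chom_lift]: preimages under [p] are chosen, and the condition on kernels makes the
    value of [g] independent of the choice. *)
Lemma chom_fact (E E' E'' : algType k) (Y : rcomod E D) (I : rcomod E' D) (Z : rcomod E'' D)
    (p : chom Y I) (g : chom Y Z) :
  (forall x, exists y, p y = x) -> (forall y, p y = 0 -> g y = 0) ->
  exists h : chom I Z, forall y, h (p y) = g y.
Proof.
move=> /choice[s sK] pg.
have hE y : g (s (p y)) = g y.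
  by apply/eqP; rewrite -subr_eq0 -rfunN -rfunD pg// rfunD rfunN sK subrr.
have hD : {morph g \o s : x y / x + y}.
  by move=> x y /=; rewrite -rfunD -[RHS]hE rfunD !sK.
have hr b : {morph g \o s : x / x <* b} by move=> x /=; rewrite -rfunr -[RHS]hE rfunr !sK.
pose h := RHom hD hr.
suff hP x : rho Z (h x) = tmap h (bid D) (rho I x) by exists (CHom hP).
rewrite -(sK x) -[h _]/(g (s (p (s x)))) hE !chomP.
by tens_elim (rho Y (s x)) => m d; rewrite !tmapE /= hE.
Qed.

(** The inverse at [X] is the lift of the identity along [s X]. *)
Lemma nat_iso_bij (K : kcat k) (F G : functor K (comod_cat D))
    (s : forall X : K, chom (F X) (G X)) :
  (forall X, injective (s X)) -> (forall X y, exists x, s X x = y) ->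
  (forall X Y (f : khom X Y) x, s Y (fmap F f x) = fmap G f (s X x)) -> nat_iso F G.
Proof.
move=> inj_s surj_s nat.
have inv (X : K) : exists t : chom (G X) (F X), forall y, s X (t y) = y.
  exact: (chom_lift (u := idc (G X)) (inj_s X) (surj_s X)).
exists s, (fun X => projT1 (cid (inv X))); split.
- move=> X; apply: chom_ext => x; apply: (inj_s X).
  exact: (projT2 (cid (inv X))).
- by move=> X; apply: chom_ext => x; exact: (projT2 (cid (inv X))).
- by move=> X Y f; apply: chom_ext => x; rewrite /= nat.
Qed.
End ComoduleMaps.

(** * Isomorphisms of bicomodules *)

Section BicomoduleIsomorphisms.
Variables (k : comNzRingType) (A B : algType k) (C : coring A) (D : coring B).

(** The set-theoretic inverse inherits linearity and both coaction identities from [f] by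
    cancellation. *)
Lemma bicomod_iso_bij (M N : bicomod C D) (f : bicomod_hom M N) (g : N -> M) :
  cancel f g -> cancel g f -> bicomod_iso M N.
Proof.
move=> fK gK; have inj_f := can_inj fK.
have gD : {morph g : x y / x + y} by move=> x y; apply: inj_f; rewrite rfunD !gK.
have gr b : {morph g : x / x <* b} by move=> x; apply: inj_f; rewrite rfunr !gK.
have gl a : {morph RHom gD gr : x / a *> x} by move=> x; apply: inj_f; rewrite rfunl !gK.
pose g' := BHom gl.
have gP y : rho M (g' y) = tmap g' (bid D) (rho N y).
  rewrite -{2}(gK y) echomP -[LHS]tmap_id.
  by tens_elim (rho M (g' y)) => m d; rewrite !tmapE /= fK.
pose g'' : echom N M := EHom gP.
have gL y : lam M (g'' y) = tmap (bid C) g'' (lam N y).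
  rewrite -{2}(gK y) bch_l -[LHS]tmap_id.
  by tens_elim (lam M (g'' y)) => c m; rewrite !tmapE /= fK.
by exists f, (BiComodHom gL).
Qed.

Lemma bicomod_iso_sym (M N : bicomod C D) : bicomod_iso M N -> bicomod_iso N M.
Proof. by move=> [f [g [fK gK]]]; exists g, f. Qed.

Lemma bicomod_iso_trans (M N P : bicomod C D) :
  bicomod_iso M N -> bicomod_iso N P -> bicomod_iso M P.
Proof.
move=> [f [f' [fK fK']]] [g [g' [gK gK']]].
have hP x : rho P (bcomp g f x) = tmap (bcomp g f) (bid D) (rho M x).
  by rewrite /= !echomP; tens_elim (rho M x) => m d; rewrite !tmapE.
pose h : echom M P := EHom hP.
have hL x : lam P (h x) = tmap (bid C) h (lam M x).
  by rewrite /= !bch_l; tens_elim (lam M x) => c m; rewrite !tmapE.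
apply: (@bicomod_iso_bij _ _ (BiComodHom hL) (f' \o g')) => x /=.
- by rewrite gK fK.
- by rewrite fK' gK'.
Qed.
End BicomoduleIsomorphisms.

(** * The bicomodule F(C) *)

Section ImageNaturality.
Variables (k : comNzRingType) (A B : algType k) (C : coring A) (D : coring B).
Variables (F G : functor (comod_cat D) (comod_cat C)).
Variables (linF : linear_functor F) (linG : linear_functor G).
Variable s : forall Y : rcomod k^o D, chom (F Y) (G Y).
Hypothesis nat : forall (Y Z : rcomod k^o D) (f : chom Y Z) x,
  s Z (fmap F (f : @khom k (comod_cat D) Y Z) x) =
  fmap G (f : @khom k (comod_cat D) Y Z) (s Y x).

Definition img_nt (E : algType k) (Y : rcomod E D) : chom (img linF Y) (img linG Y) :=
  ccomp (img_inc linG Y) (ccomp (s (rrestr Y)) (img_outc linF Y)).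

Lemma img_nt_map (E E' : algType k) (Y : rcomod E D) (Z : rcomod E' D) (f : chom Y Z) x :
  img_nt Z (img_map linF f x) = img_map linG f (img_nt Y x).
Proof. exact: nat. Qed.

Lemma img_nt_l (E : algType k) (Y : rcomod E D) a : {morph img_nt Y : x / a *> x}.
Proof. by move=> x; rewrite !img_lact img_nt_map. Qed.

(** [canon] is assembled from the images of the comodule maps [wten Y w], to which naturality
    applies. *)
Lemma img_nt_canon (E E' : algType k) (W : bimod E E') (Y : rcomod E' D) x :
  img_nt (tens_comod W Y) (canon linF W Y x) =
  canon linG W Y (tmap (bid W) (BHom (@img_nt_l _ Y)) x).
Proof. by tens_elim x => w z; rewrite tmapE !canonE img_nt_map. Qed.

Variables (ciF : canon_iso linF) (ciG : canon_iso linG).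

Definition img_nt_echom (E : algType k) (Y : rcomod E D) : echom (img linF Y) (img linG Y) :=
  @EHom _ _ _ _ (img linF Y) (img linG Y) (BHom (@img_nt_l _ Y)) (chomP (img_nt Y)).

Lemma img_nt_lam x : lam (img_bicomod ciG) (img_nt_echom (coring_rcomod D) x) =
  tmap (bid D) (img_nt_echom (coring_rcomod D)) (lam (img_bicomod ciF) x).
Proof.
apply: (canon_inj ciG); rewrite [LHS]img_lamE -img_nt_canon.
by rewrite [X in img_nt _ X]img_lamE img_nt_map.
Qed.
Definition img_nt_bicomod : bicomod_hom (img_bicomod ciF) (img_bicomod ciG) :=
  @BiComodHom _ _ _ _ _ (img_bicomod ciF) (img_bicomod ciG) _ img_nt_lam.
End ImageNaturality.

Lemma nat_iso_img_bicomod (k : comNzRingType) (A B : algType k) (C : coring A) (D : coring B)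
    (F G : functor (comod_cat D) (comod_cat C)) (linF : linear_functor F)
    (linG : linear_functor G) (ciF : canon_iso linF) (ciG : canon_iso linG) :
  nat_iso F G -> bicomod_iso (img_bicomod ciF) (img_bicomod ciG).
Proof.
move=> [s [t [ts st nat]]].
have natE (Y Z : rcomod k^o D) (f : chom Y Z) x :
    (s Z : chom _ _) (fmap F (f : @khom k (comod_cat D) Y Z) x) =
    fmap G (f : @khom k (comod_cat D) Y Z) ((s Y : chom _ _) x).
  exact: (comod_congr (esym (nat _ _ f)) x).
apply: (bicomod_iso_bij (f := img_nt_bicomod natE ciF ciG)
  (g := fun x => (t (rrestr (coring_rcomod D)) : chom _ _) x)) => x.
- exact: (comod_congr (ts _) x).
- exact: (comod_congr (st _) x).
Qed.

(** * The cotensor functor and its value at the coring *)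

Section CotensorLinear.
Variables (k : comNzRingType) (A B : algType k) (C : coring A) (D : coring B).
Variables (flD : flat D) (X : bicomod C D).

Lemma cotens_linear : linear_functor (cotens_functor flD X).
Proof.
move=> M N c f g; apply: chom_ext => x; apply: val_inj.
exact: (comod_congr (@tens_functor_linear _ _ _ _ X M N c f g) (val x)).
Qed.

Lemma cotens_mem (M : rcomod k^o C) (x : cotens flD X M) :
  tassoc _ _ _ (tmap (rho M) (bid X) (val x)) = tmap (bid M) (lam X) (val x).
Proof. by apply/eqP; rewrite -subr_eq0; exact: (valP x). Qed.

Lemma cotens_ker (M : rcomod k^o C) t :
  tassoc _ _ _ (tmap (rho M) (bid X) t) = tmap (bid M) (lam X) t <->
  exists x : cotens flD X M, kincl (cotens_map X M) x = t.
Proof.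
rewrite -[X in _ <-> X]kernelP cotens_mapE; split=> [->|/eqP]; first by rewrite subrr.
by rewrite subr_eq0 => /eqP.
Qed.

Local Notation CX := (img cotens_linear (coring_rcomod C)).

Let res : rhom C (restr C) := restr_in C.

(** [res] is the identity on elements but forgets the left [A]-action. It commutes with both sides
    of the cotensor equation and is invertible, so the equation may be checked in either copy. *)
Lemma cotens_coring_mem (v : C ⨂ X) :
  tassoc _ _ _ (tmap (comul C) (bid X) v) = tmap (bid C) (lam X) v <->
  tassoc _ _ _ (tmap (rho (rrestr (coring_rcomod C))) (bid X) (tmap res (bid X) v)) =
  tmap (bid (restr C)) (lam X) (tmap res (bid X) v).
Proof.
have -> : tassoc _ _ _ (tmap (rho (rrestr (coring_rcomod C))) (bid X) (tmap res (bid X) v)) =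
    tmap res (bid _) (tassoc _ _ _ (tmap (comul C) (bid X) v)).
  tens_elim v => c x; rewrite !tmapE.
  rewrite -[X in tassoc _ _ _ (X ⊗ x)]/(tmap res (bid C) (comul C c)).
  by tens_elim (comul C c) => c1 c2; rewrite tmapE !tassocE tmapE.
have -> : tmap (bid (restr C)) (lam X) (tmap res (bid X) v) =
    tmap res (bid _) (tmap (bid C) (lam X) v).
  by tens_elim v => c x; rewrite !tmapE.
split=> [->//|E].
have K (u : C ⨂ (C ⨂ X)) : tmap (restr_out C) (bid _) (tmap res (bid _) u) = u.
  by tens_elim u => c x; rewrite !tmapE.
by rewrite -[LHS]K E K.
Qed.

(** The left coaction lands in the cotensor product by its coassociativity; this is the candidate
    isomorphism from [X] to its cotensor product with [C]. *)
Lemma cotens_coring_lam : exists g : chom X (cotens flD X (rrestr (coring_rcomod C))),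
  forall x, kincl (cotens_map X (rrestr (coring_rcomod C))) (g x) = tmap res (bid X) (lam X x).
Proof.
pose u : chom X (tens_comod (rrestr (coring_rcomod C)) X) :=
  ccomp (tens_map res (idec X)) (lam_echom X).
apply: (chom_lift flD (j := ker_incl flD (cotens_map X _)) (u := u)) => [|x].
  exact: kincl_inj.
apply/cotens_ker/cotens_coring_mem; exact: lamA.
Qed.

Definition counitl (P : bimod A B) : bhom (C ⨂ P) P :=
  bcomp (lunit P) (bmap (coeps C) (bid P)).
Lemma counitlE (P : bimod A B) (c : C) (p : P) : counitl P (c ⊗ p) = (coeps C c : A) *> p.
Proof. by rewrite -[LHS]/(lunit P (tmap (coeps C) (bid P) (c ⊗ p))) tmapE lunitE. Qed.
Lemma counitl_nat (P Q : bimod A B) (f : bhom P Q) v :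
  counitl Q (tmap (bid C) f v) = f (counitl P v).
Proof. by tens_elim v => c p; rewrite tmapE !counitlE rfunl. Qed.
Lemma counitl_comul (P : bimod A B) (v : C ⨂ P) :
  counitl _ (tassoc _ _ _ (tmap (comul C) (bid P) v)) = v.
Proof.
tens_elim v => c p; rewrite tmapE -[in RHS](coepsl c).
by tens_elim (comul C c) => c1 c2; rewrite tassocE counitlE tmapE lunitE lact_ten.
Qed.

(** The coaction of [X] and the restriction of [counitl] are mutually inverse. One composite is the
    counit law; for the other, [counitl] is applied to the cotensor equation. *)
Lemma cotens_img_bicomod (ci : canon_iso cotens_linear) :
  bicomod_iso (img_bicomod ci) X.
Proof.
have [g0 g0E] := cotens_coring_lam.
pose g : chom X CX := ccomp (img_inc cotens_linear (coring_rcomod C)) g0.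
have gE x : kincl (cotens_map X (rrestr (coring_rcomod C))) (g x) =
  tmap res (bid X) (lam X x) by exact: g0E.
have gl a : {morph g : x / a *> x}.
  move=> x; apply: (@kincl_inj _ _ _ _ (cotens_map X (rrestr (coring_rcomod C)))).
  rewrite gE rfunl img_lact.
  rewrite -[RHS]/(tmap (rrestr_map (lactc (coring_rcomod C) a)) (bid X) (kincl _ (g x))) gE.
  by tens_elim (lam X x) => c y; rewrite lact_ten !tmapE.
pose g1 : bhom X CX := BHom gl.
pose ge : echom X CX := @EHom _ _ _ _ X CX g1 (chomP g).
(* After [canon], compatibility with the left coactions becomes coassociativity of [lam X]. *)
have gL x : lam (img_bicomod ci) (ge x) = tmap (bid C) ge (lam X x).
  apply: (canon_inj ci); rewrite [LHS]img_lamE.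
  apply: (@kincl_inj _ _ _ _ (cotens_map X (rrestr (tens_comod C (coring_rcomod C))))).
  rewrite -[LHS]/(tmap (rrestr_map (comul_echom C)) (bid X) (kincl _ (g x))) gE.
  have -> u : kincl (cotens_map X (rrestr (tens_comod C (coring_rcomod C))))
      (canon cotens_linear C (coring_rcomod C) (tmap (bid C) ge u)) =
      tmap (restr_in (C ⨂ C)) (bid X) (tassocV _ _ _ (tmap (bid C) (lam X) u)).
    tens_elim u => c y; rewrite !tmapE canonE.
    rewrite -[LHS]/(tmap (rrestr_map (wten (coring_rcomod C) c)) (bid X) (kincl _ (g y))) gE.
    by tens_elim (lam X y) => c' y'; rewrite tassocVE !tmapE.
  rewrite -lamA tassocK.
  by tens_elim (lam X x) => c y; rewrite !tmapE.
pose gb : bicomod_hom X (img_bicomod ci) := @BiComodHom _ _ _ _ _ X (img_bicomod ci) ge gL.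
apply/bicomod_iso_sym/(bicomod_iso_bij (f := gb) (g := fun z : CX => counitl X
   (tmap (restr_out C) (bid X) (kincl (cotens_map X (rrestr (coring_rcomod C))) z)))) => [x|z].
- rewrite -[gb x]/(g x) gE.
  have -> (v : C ⨂ X) : tmap (restr_out C) (bid X) (tmap res (bid X) v) = v.
    by tens_elim v => c y; rewrite !tmapE.
  exact: lam1.
- apply: (@kincl_inj _ _ _ _ (cotens_map X (rrestr (coring_rcomod C)))).
  rewrite [LHS]gE -counitl_nat.
  set v := tmap _ _ (kincl _ z).
  have vE : kincl _ z = tmap res (bid X) v.
    have K (t : restr C ⨂ X) : tmap res (bid X) (tmap (restr_out C) (bid X) t) = t.
      by tens_elim t => c y; rewrite !tmapE.
    by rewrite K.
  have /cotens_coring_mem <- : tassoc _ _ _ (tmap (rho (rrestr (coring_rcomod C))) (bid X)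
      (tmap res (bid X) v)) = tmap (bid (restr C)) (lam X) (tmap res (bid X) v).
    by rewrite -vE; apply/cotens_ker; exists z.
  by rewrite counitl_comul vE.
Qed.
End CotensorLinear.

(** * Cohom and cotensor functors *)

Section CohomAdjunction.
Variables (k : comNzRingType) (A B : algType k) (C : coring A) (D : coring B).
Variables (flD : flat D) (N : bicomod C D) (h : cohom N).

(** The equation that characterises the coaction of [cohom_comod h Y] says that the unit takes
    values in the cotensor product. *)
Lemma cohom_unit_lift (Y : rcomod k^o D) : exists u : chom Y (cotens flD N (cohom_comod h Y)),
  forall y, kincl (cotens_map N (cohom_comod h Y)) (u y) = cohom_unit h Y y.
Proof.
apply: (chom_lift flD (j := ker_incl flD (cotens_map N (cohom_comod h Y)))
  (u := cohom_unit h Y)) => [|y].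
  exact: kincl_inj.
apply/(cotens_ker flD).
by have := congr1 (tassoc _ _ _) (cohom_rhoE h y); rewrite tassocVK.
Qed.
Definition cotens_unit Y := projT1 (cid (cohom_unit_lift Y)).
Lemma cotens_unitE Y y :
  kincl (cotens_map N (cohom_comod h Y)) (cotens_unit Y y) = cohom_unit h Y y.
Proof. exact: (projT2 (cid (cohom_unit_lift Y))). Qed.

Definition cotens_counitr (M : rcomod k^o C) : rhom (h (cotens flD N M)) M :=
  @kcomp k (mod_cat A) _ _ _ (acounit (cohom_adj h) (rcbim M))
    (fmap h (ker_incl flD (cotens_map N M) :
      @khom k (comod_cat D) (cotens flD N M) (tens_comod M N))).

Lemma cotens_counitrE M x : tmap (cotens_counitr M) (bid N) (cohom_unit h (cotens flD N M) x) =
  kincl (cotens_map N M) x.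
Proof.
exact: (comod_congr (adj_transpose (cohom_adj h) (Y := rcbim M)
  (ker_incl flD (cotens_map N M) : @khom k (comod_cat D) (cotens flD N M) (tens_comod M N))) x).
Qed.

(** Tested on the unit by [cohom_inj], the identity becomes the cotensor equation. *)
Lemma cotens_counit_rho M x : rho M (cotens_counitr M x) =
  tmap (cotens_counitr M) (bid C) (rho (cohom_comod h (cotens flD N M)) x).
Proof.
set Y := cotens flD N M; set q := cotens_counitr M.
apply: (cohom_inj (h := h) (u := rcomp (rho M) q)
  (v := rcomp (tmap q (bid C)) (cohom_rho h Y))) => y.
rewrite (@tmap_comp _ _ _ _ _ _ _ _ _ _ _ _ q (rho M) (bid N) (bid N))// cotens_counitrE.
rewrite (@tmap_comp _ _ _ _ _ _ _ _ _ _ _ _ (cohom_rho h Y) (tmap q (bid C)) (bid N) (bid N))//.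
rewrite cohom_rhoE -[LHS]tassocK cotens_mem.
rewrite -[val y]/(kincl (cotens_map N M) y) -cotens_counitrE.
move: (cohom_unit h Y y) => t; rewrite -/q; tens_elim t => z n; rewrite !tmapE.
by tens_elim (lam N n) => c n'; rewrite !tassocVE !tmapE.
Qed.
Definition cotens_counit (M : rcomod k^o C) : chom (cohom_comod h (cotens flD N M)) M :=
  @CHom _ _ _ _ _ (cohom_comod h (cotens flD N M)) M (cotens_counitr M) (@cotens_counit_rho M).

(** The unit is that of the cohom adjunction, corestricted; the counit is the transpose of the
    inclusion into [M ⨂ N]. Every identity is tested through this inclusion or by [cohom_inj]. *)
Lemma cohom_cotens_adj : left_adjoint (cohom_functor h) (cotens_functor flD N).
Proof.
have unitN (Y Y' : rcomod k^o D) (f : chom Y Y') y :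
    tmap (fmap h (f : @khom k (comod_cat D) Y Y')) (bid N) (cohom_unit h Y y) =
    cohom_unit h Y' (f y).
  exact: (comod_congr (aunit_nat (cohom_adj h) (f : @khom k (comod_cat D) Y Y')) y).
split; refine (@Adjunction k (comod_cat D) (comod_cat C) (cohom_functor h)
  (cotens_functor flD N) cotens_unit cotens_counit _ _ _ _).
- move=> Y Y' f; apply: chom_ext => y; apply: (@kincl_inj _ _ _ _ (cotens_map N _)).
  rewrite [RHS]cotens_unitE -unitN -cotens_unitE.
  by [].
- move=> M M' g; apply: chom_ext => x.
  apply: (cohom_inj (h := h)
    (u := rcomp (cotens_counitr M') (fmap h (fmap (cotens_functor flD N) g)))
    (v := rcomp g (cotens_counitr M))) => y.
  rewrite [LHS](@tmap_comp _ _ _ _ _ _ _ _ _ _ _ _ (fmap h (fmap (cotens_functor flD N) g))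
    (cotens_counitr M') (bid N) (bid N))//.
  rewrite [RHS](@tmap_comp _ _ _ _ _ _ _ _ _ _ _ _ (cotens_counitr M) g (bid N) (bid N))//.
  by rewrite unitN !cotens_counitrE.
- move=> Y; apply: chom_ext => x.
  apply: (cohom_inj (h := h) (u := rcomp (cotens_counitr (cohom_comod h Y))
    (fmap h (cotens_unit Y : @khom k (comod_cat D) _ _))) (v := rid _)) => y.
  rewrite tmap_id.
  rewrite [LHS](@tmap_comp _ _ _ _ _ _ _ _ _ _ _ _
    (fmap h (cotens_unit Y : @khom k (comod_cat D) _ _))
    (cotens_counitr _) (bid N) (bid N))//.
  by rewrite unitN cotens_counitrE cotens_unitE.
- move=> M; apply: chom_ext => x; apply: (@kincl_inj _ _ _ _ (cotens_map N _)).
  rewrite -[LHS]/(tmap (cotens_counitr M) (bid N) (kincl _ (cotens_unit (cotens flD N M) x))).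
  by rewrite cotens_unitE cotens_counitrE.
Qed.
End CohomAdjunction.

Section CotensorCofree.
Variables (k : comNzRingType) (A B : algType k) (C : coring A) (D : coring B).
Variables (flD : flat D) (N : bicomod C D).

Local Notation cofree W := (tens_comod W (coring_rcomod C)).

(** Applying the counit to the first of the two factors [C] in the cotensor equation gives the
    formula for [t]; conversely, elements of this form satisfy the equation by [lamA]. *)
Lemma cotens_cofree_mem (W : bimod k^o A) (t : (W ⨂ C) ⨂ N) :
  tassoc _ _ _ (tmap (rho (cofree W)) (bid N) t) = tmap (bid (W ⨂ C)) (lam N) t <->
  t = tassocV _ _ _ (tmap (bid W) (lam N) (tmap (bid W) (counitl C N) (tassoc _ _ _ t))).
Proof.
pose phi (v : W ⨂ (C ⨂ N)) : W ⨂ (C ⨂ (C ⨂ N)) :=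
  tmap (bid W) (tassoc C C N) (tmap (bid W) (bmap (comul C) (bid N)) v).
have E1 : tassoc _ _ _ (tassoc _ _ _ (tmap (rho (cofree W)) (bid N) t)) = phi (tassoc _ _ _ t).
  rewrite /phi; tens_elim t => u n; tens_elim u => w c; rewrite tassocE !tmapE tens_comodE.
  rewrite -[rho (coring_rcomod C) c]/(comul C c).
  by tens_elim (comul C c) => c1 c2; rewrite tassocVE !tassocE.
have E2 : tassoc _ _ _ (tmap (bid (W ⨂ C)) (lam N) t) =
    tmap (bid W) (bmap (bid C) (lam N)) (tassoc _ _ _ t).
  clear E1; tens_elim t => u n; tens_elim u => w c.
  by rewrite !tmapE !tassocE ?tmapE.
split=> [/(congr1 (tassoc _ _ _))|E].
- rewrite E1 E2 => E; apply: (can_inj (tassocK (M := W) (N := C) (P := N))).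
  rewrite tassocVK; move: (tassoc W C N t) E => v /(congr1 (tmap (bid W) (counitl C _))).
  have -> : tmap (bid W) (counitl C _) (phi v) = v.
    by rewrite /phi; tens_elim v => w u; rewrite !tmapE [counitl _ _ _]counitl_comul.
  have -> : tmap (bid W) (counitl C _) (tmap (bid W) (bmap (bid C) (lam N)) v) =
      tmap (bid W) (lam N) (tmap (bid W) (counitl C N) v).
    by tens_elim v => w u; rewrite !tmapE [counitl _ _ _]counitl_nat.
  by [].
- apply: (can_inj (tassocK (M := W) (N := C) (P := C ⨂ N))).
  rewrite E1 E2 E tassocVK; move: (tmap (bid W) (counitl C N) _) => v.
  rewrite /phi; tens_elim v => w n; rewrite !tmapE; congr (w ⊗ _); exact: lamA.
Qed.

Definition cofree_counit (W : bimod k^o A) : rhom ((W ⨂ C) ⨂ N) (W ⨂ N) :=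
  rcomp (tmap (bid W) (counitl C N)) (tassoc W C N).
Lemma cofree_counitE (W : bimod k^o A) (w : W) c n :
  cofree_counit W ((w ⊗ c) ⊗ n) = w ⊗ ((coeps C c : A) *> n).
Proof. by rewrite /= tassocE tmapE counitlE. Qed.
Lemma cofree_counit_rho (W : bimod k^o A) (t : tens_comod (cofree W) N) :
  rho (tens_comod W N) (cofree_counit W t) =
  tmap (cofree_counit W) (bid D) (rho (tens_comod (cofree W) N) t).
Proof.
tens_elim t => u n; tens_elim u => w c; rewrite cofree_counitE !tens_comodE rfunl.
by tens_elim (rho N n) => n' d; rewrite lact_ten !tassocVE tmapE cofree_counitE.
Qed.

(** Contracting [C] by its counit is bijective on the cotensor product: by [cotens_cofree_mem] the
    inverse is [tmap (bid W) (lam N)], up to associativity. *)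
Lemma cotens_cofree_nat_iso :
  nat_iso (fcomp (cotens_functor flD N) (tens_functor (coring_rcomod C))) (tens_functor N).
Proof.
pose s0 (W : bimod k^o A) : chom (tens_comod (cofree W) N) (tens_comod W N) :=
  @CHom _ _ _ _ _ (tens_comod (cofree W) N) (tens_comod W N) _ (@cofree_counit_rho W).
pose s (W : bimod k^o A) := ccomp (s0 W) (ker_incl flD (cotens_map N (cofree W))).
have memE (W : bimod k^o A) (x : cotens flD N (cofree W)) :
    kincl _ x = tassocV _ _ _ (tmap (bid W) (lam N) (s W x)).
  by apply/cotens_cofree_mem; exact: cotens_mem.
apply: (nat_iso_bij flD (K := mod_cat A) (G := tens_functor N)
  (F := fcomp (cotens_functor flD N) (tens_functor (coring_rcomod C))) (s := s)).
- by move=> W x y E; apply: kincl_inj; rewrite !memE E.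
- move=> W y; pose t := tassocV W C N (tmap (bid W) (lam N) y).
  have tE : cofree_counit W t = y.
    rewrite /= /t tassocVK; clear t; tens_elim y => w n; rewrite !tmapE; congr (w ⊗ _).
    exact: lam1.
  have /(cotens_ker flD)[x xE] : tassoc _ _ _ (tmap (rho (cofree W)) (bid N) t) =
      tmap (bid (W ⨂ C)) (lam N) t.
    apply/cotens_cofree_mem; by rewrite -[X in tmap (bid W) (lam N) X]/(cofree_counit W t) tE.
  by exists x; rewrite -[LHS]/(cofree_counit W (kincl _ x)) xE.
- move=> W V f x.
  have nat (t : (W ⨂ C) ⨂ N) : cofree_counit V (tmap (tmap f (bid C)) (bid N) t) =
      tmap f (bid N) (cofree_counit W t).
    by tens_elim t => u n; tens_elim u => w c; rewrite !tmapE !cofree_counitE tmapE.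
  exact: nat.
Qed.

(** Once the coaction is forgotten, [G] is a cohom functor. Its comodule-valued version agrees with
    [G], coactions included, since both are left adjoint to the cotensor functor. *)
Lemma cotens_cohom (G : functor (comod_cat D) (comod_cat C)) :
  left_adjoint G (cotens_functor flD N) ->
  exists h : cohom N, nat_iso G (cohom_functor h).
Proof.
move=> adjG; have [a] := adjG.
have [a'] : left_adjoint (fcomp (forget C) G) (tens_functor N).
  apply: left_adjoint_nat_isor cotens_cofree_nat_iso _.
  by split; exact: adj_comp a (forget_adj C).
exists (Cohom a'); apply: left_adjoint_unique adjG _; exact: cohom_cotens_adj.
Qed.
End CotensorCofree.

Lemma cotens_nat_iso (k : comNzRingType) (A B : algType k) (C : coring A) (D : coring B)
    (flD : flat D) (N N' : bicomod C D) :
  bicomod_iso N N' -> nat_iso (cotens_functor flD N) (cotens_functor flD N').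
Proof.
move=> [f [g [fK gK]]].
have mem (P Q : bicomod C D) (u : bicomod_hom P Q) (M : rcomod k^o C) (t : M ⨂ P) :
    tassoc _ _ _ (tmap (rho M) (bid P) t) = tmap (bid M) (lam P) t ->
    tassoc _ _ _ (tmap (rho M) (bid Q) (tmap (bid M) u t)) =
    tmap (bid M) (lam Q) (tmap (bid M) u t).
  have -> : tassoc _ _ _ (tmap (rho M) (bid Q) (tmap (bid M) u t)) =
      tmap (bid M) (bmap (bid C) u) (tassoc _ _ _ (tmap (rho M) (bid P) t)).
    tens_elim t => m p; rewrite !tmapE; tens_elim (rho M m) => m' c.
    by rewrite !tassocE !tmapE.
  have -> : tmap (bid M) (lam Q) (tmap (bid M) u t) =
      tmap (bid M) (bmap (bid C) u) (tmap (bid M) (lam P) t).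
    by tens_elim t => m p; rewrite !tmapE; congr (_ ⊗ _); exact: bch_l.
  by move=> ->.
have sP (M : rcomod k^o C) : exists v : chom (cotens flD N M) (cotens flD N' M),
    forall x, kincl (cotens_map N' M) (v x) = tmap (bid M) f (kincl (cotens_map N M) x).
  apply: (chom_lift flD (j := ker_incl flD (cotens_map N' M))
    (u := ccomp (tens_map (bid M) f) (ker_incl flD (cotens_map N M)))) => [|x].
    exact: kincl_inj.
  by apply/(cotens_ker flD); apply: mem; exact: cotens_mem.
pose s M := projT1 (cid (sP M)).
have sE M x : kincl (cotens_map N' M) (s M x) = tmap (bid M) f (kincl (cotens_map N M) x).
  exact: (projT2 (cid (sP M))).
have K (P Q : bicomod C D) (u : bicomod_hom P Q) (v : bicomod_hom Q P) (uK : cancel u v)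
    (M : rcomod k^o C) (t : M ⨂ P) : tmap (bid M) v (tmap (bid M) u t) = t.
  by tens_elim t => m p; rewrite !tmapE uK.
apply: (nat_iso_bij flD (K := comod_cat C) (F := cotens_functor flD N)
  (G := cotens_functor flD N') (s := s)).
- move=> M x y E; apply: kincl_inj.
  by rewrite -[LHS](K _ _ _ _ fK) -[RHS](K _ _ _ _ fK) -!sE E.
- move=> M y.
  have /(cotens_ker flD)[x xE] := mem _ _ g M _ (cotens_mem y).
  exists x; apply: kincl_inj; rewrite sE xE; exact: (K _ _ _ _ gK).
- move=> M M' u x; apply: kincl_inj; rewrite sE.
  rewrite -[RHS]/(tmap u (bid N') (kincl _ (s M x))) sE.
  rewrite -[X in tmap _ _ X = _]/(tmap u (bid N) (kincl _ x)).
  by tens_elim (kincl _ x : M ⨂ N) => m n; rewrite !tmapE.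
Qed.

(** * Functors compatible with the cobar complex *)

Lemma linear_functor0 (k : comNzRingType) (K L : kcat k) (F : functor K L) :
  linear_functor F -> forall X Y, fmap F (0 : khom X Y) = 0.
Proof.
move=> linF X Y; apply: (@morphD0 _ _ (@fmap _ _ _ F X Y)) => f g.
by have := linF X Y 1 f g; rewrite !scale1r.
Qed.

Section Cobar.
Variables (k : comNzRingType) (A : algType k) (C : coring A) (M : rcomod k^o C).

(** The first cobar differential; its kernel is [M], embedded by the coaction. *)
Definition cobar_map :
    chom (tens_comod M (coring_rcomod C)) (tens_comod M (tens_comod C (coring_rcomod C))) :=
  ccomp (tens_assoc M C (coring_rcomod C)) (tens_map (rho M) (idec (coring_rcomod C))) -
  tens_map (rid M) (comul_echom C).

Lemma cobar_mapE y :
  cobar_map y = tassoc _ _ _ (tmap (rho M) (bid C) y) - tmap (bid M) (comul C) y.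
Proof. by []. Qed.

Lemma cobar_map_rho x : cobar_map (forget_unit M x) = 0.
Proof. by rewrite cobar_mapE rhoA subrr. Qed.

Definition counitr : bhom (C ⨂ C) C := bcomp (runit C) (bmap (bid C) (coeps C)).
Lemma counitrE (c c' : C) : counitr (c ⊗ c') = c <* (coeps C c' : A).
Proof. by rewrite -[LHS]/(runit C (tmap (bid C) (coeps C) (c ⊗ c'))) tmapE runitE. Qed.

(** The counit on the last factor is a contracting homotopy of the underlying modules. *)
Lemma cobar_contract y :
  tmap (bid M) counitr (cobar_map y) = forget_unit M (forget_counit C M y) - y.
Proof.
rewrite cobar_mapE rfunD rfunN; congr (_ - _).
  tens_elim y => m c; rewrite tmapE forget_counitE rfunr.
  by tens_elim (rho M m) => m' c'; rewrite tassocE tmapE counitrE ract_ten.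
by tens_elim y => m c; rewrite !tmapE; congr (m ⊗ _); exact: coepsr.
Qed.

Lemma cobar_ker y : cobar_map y = 0 -> forget_unit M (forget_counit C M y) = y.
Proof. by move=> y0; apply: subr0_eq; rewrite -cobar_contract y0 rfun0. Qed.

Lemma forget_unit_inj : injective (forget_unit M).
Proof. by move=> x y E; rewrite -[x]rho1 -[y]rho1; congr (runit _ (tmap _ _ _)). Qed.
End Cobar.

Section CobarExact.
Variables (k : comNzRingType) (A B : algType k) (C : coring A) (D : coring B).
Variable F : functor (comod_cat C) (comod_cat D).

Definition cobar_exact : Prop := forall M : rcomod k^o C,
  injective (fmap F (forget_unit M : @khom k (comod_cat C) _ _) : chom _ _) /\
  forall z, (fmap F (cobar_map M : @khom k (comod_cat C) _ _) : chom _ _) z = 0 ->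
    exists x, (fmap F (forget_unit M : @khom k (comod_cat C) _ _) : chom _ _) x = z.

(** A right adjoint preserves kernels: the transpose of the kernel [i] of [fmap F d] is killed by
    [d], hence factors through the coaction of [M], and transposing back factors [i] through
    [fmap F r]. *)
Lemma right_adjoint_cobar_exact (flC : flat C) (flD : flat D)
    (G : functor (comod_cat D) (comod_cat C)) :
  linear_functor F -> left_adjoint G F -> cobar_exact.
Proof.
move=> linF adj M; split.
  apply: (comod_monic_inj flD); apply: (right_adjoint_monic adj).
  exact/inj_comod_monic/forget_unit_inj.
move=> z zE; have [a] := adj; have linG := left_adjoint_linear a linF.
set d : @khom k (comod_cat C) _ _ := cobar_map M.
set r : @khom k (comod_cat C) _ _ := forget_unit M.
set i : @khom k (comod_cat D) _ _ := ker_incl flD (fmap F d : chom _ _).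
set w := acounit a _ ⊚ fmap G i.
have dw : d ⊚ w = 0.
  rewrite /w kcompA -acounit_nat -kcompA -fmapM.
  have -> : fmap F d ⊚ i = 0 by apply: chom_ext => x; exact: (kincl0 x).
  by rewrite (linear_functor0 linG); apply: chom_ext => x; exact: rfun0.
have [v vE] : exists v : chom (G (ker_comod flD (fmap F d : chom _ _))) M,
    forall x, forget_unit M (v x) = (w : chom _ _) x.
  apply: (chom_lift flC (j := forget_unit M) (u := w : chom _ _)) => [|x].
    exact: forget_unit_inj.
  exists (forget_counit C M ((w : chom _ _) x)); apply: cobar_ker.
  exact: (comod_congr dw x).
have iE : i = fmap F r ⊚ (fmap F (v : @khom k (comod_cat C) _ _) ⊚ aunit a _).
  rewrite kcompA -fmapM -[LHS](adj_transpose a); congr (fmap F _ ⊚ _).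
  by apply: chom_ext => x; rewrite -[LHS]vE.
have [x xE] := (kernelP _ _).1 zE.
exists ((fmap F (v : @khom k (comod_cat C) _ _) ⊚ aunit a _ : chom _ _) x).
by rewrite -[RHS]xE; symmetry; exact: (comod_congr iE x).
Qed.

Variables (linF : linear_functor F) (ci : canon_iso linF) (flD : flat D).

Let fC := img linF (coring_rcomod C).

(** [img] is built on [F (rrestr M)], a different term from [F M]; the comparison is [F] of the
    identity map of [M]. *)
Definition img_self (M : rcomod k^o C) : chom (F M) (img linF M) :=
  ccomp (img_inc linF M) (fmap F (rrestr_in M : @khom k (comod_cat C) M (rrestr M))).

Lemma img_self_map (M N : rcomod k^o C) (f : chom M N) x :
  img_self N (fmap F (f : @khom k (comod_cat C) M N) x) = img_map linF f (img_self M x).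
Proof.
rewrite -[LHS]/((fmap F (rrestr_in N : @khom k (comod_cat C) N (rrestr N)) ⊚
  fmap F (f : @khom k (comod_cat C) M N) : chom _ _) x).
rewrite -[RHS]/((fmap F (rrestr_map f : @khom k (comod_cat C) _ _) ⊚
  fmap F (rrestr_in M : @khom k (comod_cat C) M (rrestr M)) : chom _ _) x).
by rewrite -!fmapM; congr (rfun (chr (fmap F _)) x); apply: chom_ext.
Qed.

Lemma img_self_bij (M : rcomod k^o C) : bijective (img_self M).
Proof.
exists (fmap F (rrestr_out M : @khom k (comod_cat C) (rrestr M) M) : chom _ _) => x.
- rewrite -[LHS]/((fmap F (rrestr_out M : @khom k (comod_cat C) (rrestr M) M) ⊚
    fmap F (rrestr_in M : @khom k (comod_cat C) M (rrestr M)) : chom _ _) x).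
  rewrite -fmapM -[RHS]/((kid (F M) : chom _ _) x) -fmap1.
  by congr (rfun (chr (fmap F _)) x); apply: chom_ext.
- rewrite -[LHS]/((fmap F (rrestr_in M : @khom k (comod_cat C) M (rrestr M)) ⊚
    fmap F (rrestr_out M : @khom k (comod_cat C) (rrestr M) M) : chom _ _) x).
  rewrite -fmapM -[RHS]/((kid (F (rrestr M)) : chom _ _) x) -fmap1.
  by congr (rfun (chr (fmap F _)) x); apply: chom_ext.
Qed.

(** The term with the coaction of [M] matches by naturality of [canon], the term with [lam] because
    the left coaction was defined from [comul] through [canon]. *)
Lemma cobar_canon (M : rcomod k^o C) (t : M ⨂ fC) :
  canon linF M (tens_comod C (coring_rcomod C)) (tmap (bid M) (canon linF C (coring_rcomod C))
    (cotens_map (img_bicomod ci) M t)) =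
  img_map linF (cobar_map M) (canon linF M (coring_rcomod C) t).
Proof.
rewrite cotens_mapE !rfunD !rfunN canon_assoc canon_natl.
have -> : tmap (bid M) (canon linF C (coring_rcomod C)) (tmap (bid M) (lam (img_bicomod ci)) t) =
    tmap (bid M) (img_emap linF (comul_echom C)) t.
  tens_elim t => m z; rewrite !tmapE; congr (m ⊗ _); exact: img_lamE.
rewrite canon_natr; apply/eqP; rewrite subr_eq img_map_compE; apply/eqP.
by apply: img_mapD => y; rewrite cobar_mapE addrNK.
Qed.

Definition canonVc (E E' : algType k) (W : bimod E E') (Y : rcomod E' C) :
    chom (img linF (tens_comod W Y)) (tens_comod W (img linF Y)) :=
  @CHom _ _ _ _ _ (img linF (tens_comod W Y)) (tens_comod W (img linF Y)) (canonV ci W Y)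
    (canonV_rho ci (W := W) (Y := Y)).

Lemma cobar_exact_cotens : cobar_exact -> nat_iso F (cotens_functor flD (img_bicomod ci)).
Proof.
move=> exF; set N := img_bicomod ci.
have exI (M : rcomod k^o C) : injective (img_map linF (forget_unit M)) /\ forall z,
    img_map linF (cobar_map M) z = 0 <-> exists x, img_map linF (forget_unit M) x = z.
  have [inj_r ker_d] := exF M.
  have [gM gMK MgK] := img_self_bij M.
  have [gC gCK CgK] := img_self_bij (tens_comod M (coring_rcomod C)).
  split=> [x y|z].
    rewrite -(MgK x) -(MgK y) -!img_self_map => /(can_inj gCK) /inj_r -> //.
  split=> [|[x <-]].
    rewrite -(CgK z) -img_self_map -(rfun0 (img_self _)).
    move=> /(bij_inj (img_self_bij _)) /ker_d [x <-].
    by exists (img_self M x); rewrite img_self_map.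
  rewrite img_map_compE -(MgK x) -img_self_map.
  have -> : ccomp (cobar_map M) (forget_unit M) = 0 by apply: chom_ext => y; exact: cobar_map_rho.
  rewrite [fmap F _](linear_functor0 linF).
  exact: rfun0.
(* [F] of the coaction, followed by the identification of [F(M ⨂ C)] with [M ⨂ F(C)]. Exactness
   makes it an isomorphism onto the cotensor product. *)
pose phi (M : rcomod k^o C) : chom (F M) (tens_comod M fC) :=
  ccomp (canonVc M (coring_rcomod C)) (ccomp (img_map linF (forget_unit M)) (img_self M)).
have phiE (M : rcomod k^o C) x : canon linF M (coring_rcomod C) (phi M x) =
    img_map linF (forget_unit M) (img_self M x) by exact: canonVK.
have inj_phi (M : rcomod k^o C) : injective (phi M).
  move=> x y E; apply: (bij_inj (img_self_bij M)); apply: (exI M).1.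
  by rewrite -!phiE E.
have phi_ker (M : rcomod k^o C) t : cotens_map N M t = 0 <-> exists x, phi M x = t.
  have inj_c : injective (tmap (bid M) (canon linF C (coring_rcomod C))).
    apply: (can_inj (g := tmap (bid M) (canonV ci C (coring_rcomod C)))) => u.
    by tens_elim u => m z; rewrite !tmapE canonK.
  have -> : cotens_map N M t = 0 <->
      img_map linF (cobar_map M) (canon linF M (coring_rcomod C) t) = 0.
    rewrite -cobar_canon; split=> [->|E]; first by rewrite !rfun0.
    by apply: inj_c; apply: (canon_inj ci); rewrite E !rfun0.
  rewrite (exI M).2; split=> [[y yE]|[x <-]].
    have [g gK Kg] := img_self_bij M; exists (g y).
    by apply: (canon_inj ci); rewrite phiE Kg.
  by exists (img_self M x); rewrite -phiE.
have sP (M : rcomod k^o C) : exists v : chom (F M) (cotens flD N M),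
    forall x, kincl (cotens_map N M) (v x) = phi M x.
  apply: (chom_lift flD (j := ker_incl flD (cotens_map N M)) (u := phi M)) => [|x].
    exact: kincl_inj.
  by apply/kernelP/phi_ker; exists x.
pose s M := projT1 (cid (sP M)).
have sE M x : kincl (cotens_map N M) (s M x) = phi M x by exact: (projT2 (cid (sP M))).
apply: (nat_iso_bij flD (K := comod_cat C) (F := F) (G := cotens_functor flD N) (s := s)).
- by move=> M x y E; apply: inj_phi; rewrite -!sE E.
- move=> M y; have [x xE] := (phi_ker M _).1 (kincl0 y).
  by exists x; apply: kincl_inj; rewrite sE.
- move=> M M' f x; apply: kincl_inj; rewrite sE.
  rewrite -[RHS]/(tmap f (bid fC) (kincl _ (s M x))) sE.
  apply: (canon_inj ci); rewrite phiE img_self_map canon_natl phiE !img_map_compE.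
  by apply: img_map_ext => y; exact: chomP.
Qed.
End CobarExact.

(** * An injective cogenerator for modules *)

(** Euclidean division by the least positive element. The trivial subgroup is kept apart because it
    puts no condition on the values chosen in the extensions below. *)
Lemma int_subgroup (I : int -> Prop) :
  I 0 -> (forall m n, I m -> I n -> I (m - n)) ->
  (forall m, I m -> m = 0) \/
  exists2 n : nat, I n.+1 & forall m, I m -> exists a : int, m = n.+1%:Z * a.
Proof.
move=> I0 IB.
have IN m : I m -> I (- m) by move=> Im; rewrite -sub0r; exact: IB.
have IM m (a : int) : I m -> I (m * a).
  move=> Im; have In (n : nat) : I (m * n).
    elim: n => [|n IHn]; first by rewrite mulr0.
    rewrite -addn1 PoszD mulrDr mulr1; have -> : m * n + m = m * n - (- m) by rewrite opprK.
    by apply: IB => //; exact: IN.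
  by case: a => n //; rewrite NegzE mulrN; exact: IN.
have [nI|nI] := pselect (exists n : nat, `[< I n.+1 >]); last first.
  left=> m Im; apply/eqP/negP => /negP m0; apply: nI; exists `|m|%N.-1; apply/asboolP.
  rewrite prednK ?absz_gt0//; case: m Im {m0} => n // /IN.
  by rewrite NegzE opprK.
case: (ex_minnP nI) => {nI}n /asboolP nI n_min; right; exists n => // m Im.
exists (m %/ n.+1)%Z; rewrite {1}(divz_eq m n.+1) mulrC.
suff -> : (m %% n.+1)%Z = 0 by rewrite addr0.
have : I (m %% n.+1)%Z by rewrite /modz mulrC; apply: IB => //; exact: IM.
have : (m %% n.+1)%Z < n.+1 by rewrite ltz_pmod.
have : 0 <= (m %% n.+1)%Z by rewrite modz_ge0.
case: (m %% n.+1)%Z => [[|j]|//] // _ j_lt Ij.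
by have := n_min j (asboolT Ij); move: j_lt; rewrite ltz_nat ltnS leqNgt => /negP.
Qed.

Section DivisibleExtension.
Variables (T Y : zmodType).
Hypothesis T_div : forall n (x : T), exists y, y *+ n.+1 = x.

(* The graph of a homomorphism from a subgroup of Y to T. *)
Definition partial_hom (G : set (Y * T)) : Prop :=
  [/\ G (0, 0), forall x y, G x -> G y -> G (x - y) & forall q, G (0, q) -> q = 0].

Lemma partial_homMz G x (m : int) : partial_hom G -> G x -> G (x *~ m).
Proof.
move=> [G0 GB _] Gx.
have GN y : G y -> G (- y) by move=> Gy; rewrite -sub0r; apply: GB.
have Gn n : G (x *+ n).
  by elim: n => [//|n IHn]; rewrite mulrSr -[x in _ + x]opprK; apply: GB => //; apply: GN.
by case: m => n; rewrite ?NegzE -?pmulrn ?nmulrn //; apply: GN; exact: Gn.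
Qed.

(** The [m] with [y *~ m] in the domain form a subgroup of the integers. If [n.+1] generates it and
    [r0] is the value there, divisibility gives [q] with [q *+ n.+1 = r0], which makes the extended
    graph single-valued. *)
Lemma partial_hom_extend G y : partial_hom G ->
  exists q, partial_hom [set p | exists d (m : int), G d /\ p = d + (y, q) *~ m].
Proof.
move=> GP; have [G0 GB Gf] := GP.
have Mz (a : Y) (b : T) (m : int) : (a, b) *~ m = (a *~ m, b *~ m).
  have Mn n : (a, b) *+ n = (a *+ n, b *+ n) by elim: n => [//|n IHn]; rewrite !mulrS IHn.
  by case: m => n; [exact: Mn | rewrite NegzE -!nmulrn Mn].
suff [q qP] : exists q, forall (m : int) r, G (y *~ m, r) -> r = q *~ m.
  exists q; split.
  - by exists 0, 0; rewrite mulr0z addr0.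
  - move=> _ _ [d [m [Gd ->]]] [d' [m' [Gd' ->]]]; exists (d - d'), (m - m').
    by split; [exact: GB|rewrite mulrzBr opprD addrACA].
  - move=> r [[d s] [m [Gd]]]; rewrite Mz => -[dE ->].
    have : G (y *~ m, - s).
      have -> : (y *~ m, - s) = 0 - (d, s).
        by congr (_, _); rewrite sub0r//; apply/eqP; rewrite -addr_eq0 addrC -dE.
      exact: GB.
    by move=> /qP <-; rewrite subrr.
have [|m n [r Gr] [r' Gr']|I0|[n [r0 Gr0] I_gen]] :=
  @int_subgroup (fun m => exists r, G (y *~ m, r)).
- by exists 0; rewrite mulr0z.
- exists (r - r'); rewrite mulrzBr.
  exact: (GB _ _ Gr Gr').
- exists 0 => m r Gr; rewrite mul0rz; apply: Gf.
  by move: (Gr); rewrite (I0 m) ?mulr0z//; exists r.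
have [q qE] := T_div n r0; exists q => m r Gr.
have [a mE] : exists a : int, m = n.+1%:Z * a by apply: I_gen; exists r.
apply: subr0_eq; apply: Gf.
suff <- : (y *~ m, r) - (y *~ n.+1, r0) *~ a = (0, r - q *~ m).
  by apply: (GB) => //; exact: partial_homMz.
rewrite Mz mE !mulrzA -[q *~ _]pmulrn qE.
by congr (_, _); exact: subrr.
Qed.

Lemma partial_hom_total G0 : partial_hom G0 ->
  exists g : Y -> T, {morph g : x y / x + y} /\ forall y q, G0 (y, q) -> g y = q.
Proof.
move=> G0P.
pose P (G : set (Y * T)) := G = set0 \/ partial_hom G /\ (G0 `<=` G)%classic.
have [|G [GP maxG]] := @Zorn_bigcup _ P.
  move=> F FP Ftot.
  have [[H [FH H0]]|noH] := pselect (exists H, F H /\ H <> set0); last first.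
    left; rewrite -subset0 => x [H FH Hx]; apply: noH; exists H; split=> // H0.
    by rewrite H0 in Hx.
  have FPH K x : F K -> K x -> partial_hom K /\ (G0 `<=` K)%classic.
    by move=> /FP[->|].
  have [//|[HP GH]] := FP _ FH.
  right; split; last by move=> x /GH Hx; exists H.
  split.
  - by exists H => //; case: HP.
  - move=> x y [K FK Kx] [K' FK' K'y].
    have [KP _] := FPH _ _ FK Kx; have [KP' _] := FPH _ _ FK' K'y.
    by have [/(_ _ Kx) K'x|/(_ _ K'y) Ky] := Ftot _ _ FK FK'; [exists K'|exists K] => //;
      [case: KP'|case: KP] => _ + _; apply.
  - by move=> q [K FK Kq]; have [[_ _ +] _] := FPH _ _ FK Kq; apply.
have {GP}[G_0|[GP G0G]] := GP.
  case: (maxG G0); last exact: or_intror (conj G0P (@subset_refl _ _)).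
  by rewrite G_0; split=> // sub0; case: G0P => /sub0.
(* A point outside the domain would give a strictly larger graph. *)
have G_total y : exists q, G (y, q).
  have [q HP] := partial_hom_extend y GP; apply: contrapT => nG.
  apply: (maxG _ _ (or_intror (conj HP _))) => [|x /G0G Gx].
    split=> [x Gx|subG]; first by exists x, 0; rewrite mulr0z addr0.
    apply: nG; exists q; apply: subG.
    by exists 0, 1; rewrite mulr1z add0r; case: GP.
  by exists x, 0; rewrite mulr0z addr0.
have [g gG] := choice G_total; have [G00 GB Gf] : partial_hom G := GP.
have G_fun y q : G (y, q) -> g y = q.
  move=> Gyq; apply: subr0_eq; apply: Gf.
  suff <- : (y, g y) - (y, q) = (0, g y - q) by apply: GB.
  by congr (_, _); rewrite subrr.
exists g; split=> [x y|y q /G0G]; last exact: G_fun.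
apply: G_fun; suff <- : (x, g x) - (0 - (y, g y)) = (x + y, g x + g y).
  by apply: (GB) => //; apply: GB.
by rewrite sub0r opprK.
Qed.
End DivisibleExtension.

(** * Rationals modulo integers, and character modules *)

Definition int_pred : {pred rat} := fun x => x \is a Num.int.
Lemma int_pred_zmod_closed : zmod_closed int_pred.
Proof.
have [i0 iB] : zmod_closed (Num.int : {pred rat}) by split; [exact: rpred0 | exact: rpredB].
by split; [exact: i0 | exact: iB].
Qed.
HB.instance Definition _ := GRing.isZmodClosed.Build rat int_pred int_pred_zmod_closed.

Definition QZ := {ideal_quot (GRing.ZmodClosed.clone rat int_pred _)}.
HB.instance Definition _ := GRing.Zmodule.on QZ.
Definition piQZ : {additive rat -> QZ} := \pi_QZ%qT.

Lemma QZ_eq0 (x : rat) : piQZ x = 0 <-> x \is a Num.int.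
Proof.
rewrite -[X in _ = X](raddf0 (piQZ)).
split=> [/eqP|xi]; last apply/eqP; by rewrite -Quotient.idealrBE subr0.
Qed.

Lemma QZ_div n (x : QZ) : exists y, y *+ n.+1 = x.
Proof.
have [r <-] : exists r, piQZ r = x by exists (repr x); exact: (reprK x).
by exists (piQZ (r / n.+1%:R)); rewrite -raddfMn -[_ / _ *+ _]mulr_natr divfK ?pnatr_eq0.
Qed.

(** The class of the inverse of [n.+2]. The index starts at two because an element killed by one is
    zero. *)
Lemma QZ_torsion n : exists q : QZ, q <> 0 /\ q *+ n.+2 = 0.
Proof.
exists (piQZ (n.+2%:R^-1)); split; last first.
  by rewrite -raddfMn; apply/QZ_eq0; rewrite -[_^-1 *+ _]mulr_natr mulVf ?pnatr_eq0// rpred1.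
move/QZ_eq0 => /intrP[m mE].
have /intr_inj E : ((m * n.+2)%:~R : rat) = 1%:~R.
  by rewrite intrM -mE -pmulrn mulVf ?pnatr_eq0.
have /dvdnP[d /eqP] : (n.+2 %| 1)%Z by apply/dvdzP; exists m; rewrite E.
by rewrite eq_sym muln_eq1 andbF.
Qed.

Section Characters.
Variable Y : zmodType.

(** Prescribe zero on [S] and a nonzero [q] at [z]. This is consistent when [q] is killed by every
    [m] with [z *~ m] in [S], and then extends by divisibility. *)
Lemma separating_character (S : Y -> Prop) (z : Y) :
  S 0 -> (forall x y, S x -> S y -> S (x - y)) -> ~ S z ->
  exists g : Y -> QZ, [/\ {morph g : x y / x + y}, forall x, S x -> g x = 0 & g z <> 0].
Proof.
move=> S0 SB nSz.
pose G0 (q : QZ) : set (Y * QZ) :=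
  [set p | exists (m : int) x, S x /\ p = (x + z *~ m, q *~ m)]%classic.
suff [q [q0 GP]] : exists q, q <> 0 /\ partial_hom (G0 q).
  have [g [gD gE]] := partial_hom_total QZ_div GP; exists g; split=> // [x Sx|].
    by apply: gE; exists 0, x; rewrite !mulr0z addr0.
  suff -> : g z = q by [].
  by apply: gE; exists 1, 0; rewrite !mulr1z add0r.
suff [q [q0 qE]] : exists q : QZ, q <> 0 /\ forall m, S (z *~ m) -> q *~ m = 0.
  exists q; split=> //; split.
  - by exists 0, 0; rewrite !mulr0z addr0.
  - move=> _ _ [m [x [Sx ->]]] [n [y [Sy ->]]]; exists (m - n), (x - y).
    split; first exact: SB.
    by congr (_, _); rewrite mulrzBr// addrACA -opprD.
  - move=> r [m [x [Sx [xE ->]]]]; apply: qE.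
    have -> : z *~ m = 0 - x by rewrite sub0r; apply/eqP; rewrite -addr_eq0 addrC -xE.
    exact: SB.
have [|m n|I0|[n Sn I_gen]] := @int_subgroup (fun m => S (z *~ m)).
- by rewrite mulr0z.
- by rewrite mulrzBr; exact: SB.
- by have [q [q0 _]] := QZ_torsion 0; exists q; split=> // m /I0 ->; rewrite mulr0z.
(* The generator is not one, as [z] lies outside [S]; hence [QZ_torsion] applies. *)
case: n Sn I_gen => [|n] Sn I_gen; first by case: nSz; move: Sn; rewrite mulr1z.
have [q [q0 qn]] := QZ_torsion n; exists q; split=> // m /I_gen[a ->].
by rewrite mulrzA -[q *~ n.+2]pmulrn qn mul0rz.
Qed.
End Characters.

Record character (B : zmodType) := Character {
  char_fun :> B -> QZ;
  charD : {morph char_fun : x y / x + y} }.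

Section CharacterModule.
Variables (k : comNzRingType) (B : algType k).
Local Notation char := (character B).

Lemma char_ext (f g : char) : f =1 g -> f = g.
Proof.
case: f g => [f fD] [g gD] /= /funext efg.
by case: _ / efg in gD *; congr Character; exact: Prop_irrelevance.
Qed.

HB.instance Definition _ := gen_eqMixin char.
HB.instance Definition _ := gen_choiceMixin char.

Definition char_add (f g : char) : char.
refine (@Character _ (fun x => f x + g x) _).
abstract (by move=> x y; rewrite !charD addrACA).
Defined.
Definition char_opp (f : char) : char.
refine (@Character _ (fun x => - f x) _).
abstract (by move=> x y; rewrite !charD opprD).
Defined.
Definition char_zero : char.
refine (@Character _ (fun x => 0) _).
abstract (by move=> x y; rewrite addr0).
Defined.
Lemma char_addA : associative char_add.
Proof. by move=> f g h; apply: char_ext => x /=; rewrite addrA. Qed.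
Lemma char_addC : commutative char_add.
Proof. by move=> f g; apply: char_ext => x /=; rewrite addrC. Qed.
Lemma char_add0 : left_id char_zero char_add.
Proof. by move=> f; apply: char_ext => x /=; rewrite add0r. Qed.
Lemma char_addN : left_inverse char_zero char_opp char_add.
Proof. by move=> f; apply: char_ext => x /=; rewrite addNr. Qed.
HB.instance Definition _ :=
  GRing.isZmodule.Build char char_addA char_addC char_add0 char_addN.

Definition char_act (f : char) (b : B) : char.
refine (@Character _ (fun x => f (b * x)) _).
abstract (by move=> x y; rewrite mulrDr charD).
Defined.

Definition char_bimod : bimod k^o B.
refine (@Bimod k k^o B char (fun c f => char_act f (c : k)%:A) char_act
  _ _ _ _ _ _ _ _ _ _).
- abstract (by move=> c f g; apply: char_ext).
- abstract (by move=> f c d; apply: char_ext => x /=; rewrite scalerDl mulrDl charD).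
- abstract (by move=> f; apply: char_ext => x /=; rewrite scale1r mul1r).
- abstract (by move=> c d f; apply: char_ext => x /=;
    rewrite mulrA; congr (f (_ * x)); rewrite mulr_algl scalerA mulrC).
- abstract (by move=> c f g; apply: char_ext).
- abstract (by move=> f c d; apply: char_ext => x /=; rewrite mulrDl charD).
- abstract (by move=> f; apply: char_ext => x /=; rewrite mul1r).
- abstract (by move=> f c d; apply: char_ext => x /=; rewrite mulrA).
- abstract (by move=> c f b; apply: char_ext => x /=; rewrite !mulrA algC).
- abstract (by move=> c f; apply: char_ext => x /=; rewrite /GRing.scale /= mulr1).
Defined.

Section Transpose.
Variables (Y : bimod k^o B) (g : Y -> QZ).
Hypothesis gD : {morph g : x y / x + y}.

Lemma char_of_subproof (y : Y) : {morph (fun b => g (y <* b)) : a b / a + b}.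
Proof. by move=> a b; rewrite ractDr gD. Qed.
(** Coinduction: additive maps from [Y] to [QZ] correspond to right linear maps to [char_bimod],
    with evaluation at [1] as inverse. *)
Definition char_of (y : Y) : char_bimod := Character (char_of_subproof y).
Lemma char_ofD : {morph char_of : x y / x + y}.
Proof. by move=> x y; apply: char_ext => b /=; rewrite ractDl gD. Qed.
Lemma char_ofr b : {morph char_of : y / y <* b}.
Proof. by move=> x; apply: char_ext => c /=; rewrite ractM. Qed.
Definition char_rhom : rhom Y char_bimod := RHom char_ofD char_ofr.
Lemma char_rhomE y b : (char_rhom y : char) b = g (y <* b). Proof. by []. Qed.
End Transpose.

(** Evaluate at [1], extend the resulting character from the image of [i] by divisibility, and
    transpose back. *)
Lemma char_injective : @injective_object k (mod_cat B) char_bimod.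
Proof.
move=> X Y i f /mod_monic_inj inj_i; rewrite /= in f i inj_i *.
pose ev (x : X) : QZ := (f x : char) 1.
have evD x y : ev (x + y) = ev x + ev y by rewrite /ev rfunD.
have [|g [gD gE]] := @partial_hom_total QZ Y QZ_div (fun p => exists x, p = (i x, ev x)).
  split=> [|_ _ [x ->] [y ->]|q [x [x0 ->]]].
  - by exists 0; rewrite rfun0 (morphD0 evD).
  - by exists (x - y); rewrite rfunD rfunN evD (morphDN evD).
  - suff -> : x = 0 by exact: morphD0 evD.
    by apply: inj_i; rewrite -x0 rfun0.
exists (char_rhom gD); apply: rhom_ext => x; apply: char_ext => b.
rewrite /= -rfunr (gE _ (ev (x <* b))); last by exists (x <* b).
by rewrite /ev rfunr /= mulr1.
Qed.

(** The transpose of a character separating [z] from [S] kills [S] because [S] is stable under the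
    right action. *)
Lemma char_separates (Y : bimod k^o B) (S : Y -> Prop) z :
  S 0 -> (forall x y, S x -> S y -> S (x - y)) -> (forall x b, S x -> S (x <* b)) -> ~ S z ->
  exists g : rhom Y char_bimod, (forall x, S x -> g x = 0) /\ g z <> 0.
Proof.
move=> S0 SB Sr nSz; have [g [gD gS gz]] := separating_character S0 SB nSz.
exists (char_rhom gD); split=> [x Sx|E].
  by apply: char_ext => b; rewrite char_rhomE; apply/gS/Sr.
by apply: gz; have := congr1 (fun f : char => f 1) E; rewrite /= ract1.
Qed.
End CharacterModule.

(** * Exactness of the cohom functor of an injector *)

Section InjectorExact.
Variables (k : comNzRingType) (A B : algType k) (D : coring B) (flD : flat D).
Variables (N : rcomod A D) (h : cohom N).
Hypothesis injN : injector N.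

(* If z were not in the image of h(j), a map h(Y) -> E to the cogenerator E would kill
   that image but not z. Its transpose Y -> E ⨂ N factors through p, and the factor
   extends along i because E ⨂ N is injective, so the map kills ker h(i p). *)
Lemma injector_cohom_exact (X Y I Z : rcomod k^o D) (j : chom X Y) (p : chom Y I)
    (i : chom I Z) :
  (forall y, p y = 0 -> exists x, j x = y) -> (forall y, exists x, p x = y) -> injective i ->
  forall z, (fmap h (ccomp i p : @khom k (comod_cat D) Y Z) : rhom _ _) z = 0 ->
  exists x, (fmap h (j : @khom k (comod_cat D) X Y) : rhom _ _) x = z.
Proof.
move=> pj surj_p inj_i z hz; apply: contrapT => nz.
set hj : rhom _ _ := fmap h _ in nz.
have [|x y [x' <-] [y' <-]|x b [x' <-]|g [gj gz]] :=
    @char_separates _ _ (h Y) (fun z => exists x, hj x = z) z _ _ _ nz.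
- by exists 0; rewrite rfun0.
- by exists (x' - y'); rewrite rfunD rfunN.
- by exists (x' <* b); rewrite rfunr.
pose G : @khom k (mod_cat A) (h Y) (char_bimod A) := g.
pose u : chom Y (tens_comod (char_bimod A) N) := fmap (tens_functor N) G ⊚ aunit (cohom_adj h) Y.
have uj x : u (j x) = 0.
  have /comod_congr/(_ x) E := aunit_nat (cohom_adj h) (j : @khom k (comod_cat D) X Y).
  rewrite -[LHS]/(tmap g (bid N)
    ((aunit (cohom_adj h) Y ⊚ (j : @khom k (comod_cat D) X Y) : chom _ _) x)) -E.
  pose w : h X ⨂ N := (aunit (cohom_adj h) X : chom _ (tens_comod _ _)) x.
  rewrite -[LHS]/(tmap g (bid N) (tmap hj (bid N) w)).
  tens_elim w => m n; rewrite !tmapE gj ?tens0l//.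
  by exists m.
have [v vE] : exists v : chom I (tens_comod (char_bimod A) N), forall y, v (p y) = u y.
  by apply: chom_fact => // y /pj[x <-].
have [w wE] := injN (@char_injective k A) (i := (i : @khom k (comod_cat D) I Z))
  (v : @khom k (comod_cat D) I _) (inj_comod_monic inj_i).
apply: gz; rewrite -[g]/(G : rhom _ _) -(adj_transposeV (cohom_adj h) G).
have -> : fmap (tens_functor N) G ⊚ aunit (cohom_adj h) Y =
    w ⊚ (ccomp i p : @khom k (comod_cat D) Y Z).
  by apply: chom_ext => y; rewrite -[LHS]/(u y) -vE -wE.
rewrite fmapM kcompA.
set q := _ ⊚ fmap h w.
by rewrite -[LHS]/((q : rhom _ _) (fmap h (ccomp i p : @khom k (comod_cat D) Y Z) z)) hz rfun0.
Qed.

(** [injector_cohom_exact] with [j] zero and [p] the identity: the kernel of [fmap h i] is the image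
    of a zero map. *)
Lemma injector_cohom_inj (Y Z : rcomod k^o D) (i : chom Y Z) :
  injective i -> injective (fmap h (i : @khom k (comod_cat D) Y Z) : rhom _ _).
Proof.
move=> inj_i x y E.
have [] := injector_cohom_exact (X := Y) (j := 0) (p := idc Y) (i := i) _ _ inj_i (z := x - y).
- by move=> z z0; exists 0; exact: esym z0.
- by move=> z; exists z.
- have -> : ccomp i (idc Y) = i by apply: chom_ext.
  by rewrite rfunD rfunN E subrr.
- have lin := left_adjoint_linear (cohom_adj h) (@tens_functor_linear _ _ _ _ N).
  by move=> w; rewrite (linear_functor0 lin) => /esym/eqP; rewrite subr_eq0 => /eqP.
Qed.
End InjectorExact.

Section CobarDegreeTwo.
Variables (k : comNzRingType) (A : algType k) (C : coring A) (M : rcomod k^o C).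
Let M' := tens_comod M (coring_rcomod C).

(* The next cobar differential; subtracting the differential of M ⨂ C collects its
   last two terms. *)
Definition cobar_map2 : chom (tens_comod M (tens_comod C (coring_rcomod C)))
    (tens_comod M' (tens_comod C (coring_rcomod C))) :=
  tens_map (rho M) (idec (tens_comod C (coring_rcomod C))) -
  ccomp (cobar_map M') (tens_assocV M C (coring_rcomod C)).

Lemma cobar_map2E t :
  cobar_map2 t = tmap (rho M) (bid (C ⨂ C)) t - cobar_map M' (tassocV _ _ _ t).
Proof. by []. Qed.

(** Up to reassociation, [cobar_map M x] is [tmap (rho M) (bid C) x] minus a coaction, which
    [cobar_map M'] kills. The rest is naturality of the differential along the comodule map
    [rho M]. *)
Lemma cobar_map2_map x : cobar_map2 (cobar_map M x) = 0.
Proof.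
rewrite cobar_map2E; set y := cobar_map M x.
have -> : tassocV _ _ _ y = tmap (rho M) (bid C) x - forget_unit M' x.
  rewrite /y cobar_mapE rfunD rfunN tassocK; congr (_ - _).
have -> : cobar_map M' (tmap (rho M) (bid C) x - forget_unit M' x) =
    cobar_map M' (tmap (rho M) (bid C) x).
  by rewrite rfunD rfunN cobar_map_rho subr0.
suff -> : cobar_map M' (tmap (rho M) (bid C) x) = tmap (rho M) (bid (C ⨂ C)) y by rewrite subrr.
rewrite /y !cobar_mapE rfunD rfunN; congr (_ - _).
  clear y; tens_elim x => m c; rewrite !tmapE [rho M' _](chomP (forget_unit M)).
  rewrite -[(forget_unit M : rhom _ _)]/(rho M : rhom _ _).
  by tens_elim (rho M m) => m1 c1; rewrite tmapE !tassocE tmapE.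
by clear y; tens_elim x => m c; rewrite !tmapE.
Qed.

Lemma cobar_map2_ker t : cobar_map2 t = 0 -> exists x, cobar_map M x = t.
Proof.
rewrite cobar_map2E => /subr0_eq /(congr1 (tmap (bid M') (counitr C))).
rewrite cobar_contract; set u := tassocV _ _ _ t.
pose x := tmap (bid M) (counitr C) t.
have -> : tmap (bid M') (counitr C) (tmap (rho M) (bid (C ⨂ C)) t) = tmap (rho M) (bid C) x.
  by rewrite /x; clear; tens_elim t => m c; rewrite !tmapE.
have -> : forget_counit C M' u = x.
  rewrite /x /u; clear; tens_elim t => m v; tens_elim v => c c'.
  by rewrite tassocVE forget_counitE tmapE counitrE ract_ten.
(* By [E], [tmap (rho M) (bid C) x] equals [forget_unit M' x - u], so [u] is the reassociated
   [- cobar_map M x]; hence the sign. *)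
move=> E; exists (- x); rewrite rfunN cobar_mapE -(tassocVK t) -/u.
have -> : u = forget_unit M' x - tmap (rho M) (bid C) x by rewrite E opprB addrC addrNK.
by rewrite opprB rfunD rfunN; congr (_ - _); symmetry; exact: tassocVK.
Qed.
End CobarDegreeTwo.

(** [injector_cohom_exact] is applied to the factorisation of [cobar_map M] through its image. That
    image is the kernel of [cobar_map2 M], a comodule by flatness. *)
Lemma injector_cobar_exact (k : comNzRingType) (A B : algType k) (C : coring A) (D : coring B)
    (flC : flat C) (L : bicomod D C) (h : cohom L) :
  injector L -> cobar_exact (cohom_functor h).
Proof.
move=> injL M; split.
  exact: (injector_cohom_inj injL (@forget_unit_inj _ _ _ M)).
move=> z hz; set I := ker_comod flC (cobar_map2 M).
have [p pE] : exists p : chom (tens_comod M (coring_rcomod C)) I,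
    forall x, kincl (cobar_map2 M) (p x) = cobar_map M x.
  apply: (chom_lift flC (j := ker_incl flC (cobar_map2 M)) (u := cobar_map M)) => [|x].
    exact: kincl_inj.
  by apply/kernelP; exact: cobar_map2_map.
apply: (injector_cohom_exact injL (p := p) (i := ker_incl flC (cobar_map2 M))) => [y py|y||].
- exists (forget_counit C M y); apply: cobar_ker; rewrite -pE py; exact: rfun0.
- have [x xE] := cobar_map2_ker (kincl0 y); exists x; apply: kincl_inj; by rewrite pE.
- exact: kincl_inj.
- have -> : ccomp (ker_incl flC (cobar_map2 M)) p = cobar_map M by apply: chom_ext.
  exact: hz.
Qed.

(** * Frobenius pairs *)

Section FrobeniusBicomodules.
Variables (k : comNzRingType) (A B : algType k) (C : coring A) (D : coring B).
Variables (flC : flat C) (flD : flat D).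

(** The same functor is evaluated at the coring [D] in two ways: as a cotensor functor it gives [L],
    as a cohom functor of [X] it gives the bicomodule of [h]. *)
Lemma cotens_adj_cohom_bicomod (X : bicomod C D) (L : bicomod D C) :
  left_adjoint (cotens_functor flC L) (cotens_functor flD X) ->
  exists h : cohom X, bicomod_iso L (cohom_bicomod h).
Proof.
move=> adj; have [h iso] := cotens_cohom adj; exists h.
have ci := left_adjoint_canon_iso (cotens_linear flC L) adj.
apply: bicomod_iso_trans (nat_iso_img_bicomod ci (cohom_canon_iso h) iso).
exact/bicomod_iso_sym/cotens_img_bicomod.
Qed.

(** [- ⨂ X] is [- ⨂ C] followed by the cotensor functor. Both are right adjoints of functors that
    preserve monics: [forget], since monics are injective, and [G], since it is a right adjoint
    too. *)
Lemma cotens_right_adjoint_injector (X : bicomod C D) (G : functor (comod_cat D) (comod_cat C)) :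
  frobenius_pair G (cotens_functor flD X) -> injector X.
Proof.
move=> [GF FG]; apply: nat_iso_injectives (cotens_cofree_nat_iso flD X) _.
move=> I /(right_adjoint_injectives (F := forget C) (G := tens_functor (coring_rcomod C))) injI.
apply: (right_adjoint_injectives (F := G)) => [Y Z i mi||]; last 1 first.
- apply: injI; last by split; exact: forget_adj.
  by move=> Y Z i; exact: forget_monic.
- exact: right_adjoint_monic FG _ _ _ mi.
- exact: GF.
Qed.

(** The two adjunctions serve different ends: [FG] gives compatibility with tensor products, [GF]
    preservation of the cobar kernels. *)
Lemma image_cotens (F : functor (comod_cat C) (comod_cat D))
    (G : functor (comod_cat D) (comod_cat C)) (linF : linear_functor F)
    (FG : left_adjoint F G) (X : bicomod C D) :
  left_adjoint G F -> bicomod_iso (image_bicomod linF FG) X -> nat_iso F (cotens_functor flD X).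
Proof.
move=> GF isoX; apply: nat_iso_trans (cotens_nat_iso flD isoX).
exact/cobar_exact_cotens/(right_adjoint_cobar_exact flC flD linF GF).
Qed.

Lemma injector_cohom_cotens (X : bicomod C D) (L : bicomod D C) (h : cohom L) :
  injector L -> bicomod_iso X (cohom_bicomod h) ->
  nat_iso (cotens_functor flD X) (cohom_functor h).
Proof.
move=> injL isoX; apply: nat_iso_trans (cotens_nat_iso flD isoX) _.
exact/nat_iso_sym/cobar_exact_cotens/injector_cobar_exact.
Qed.
End FrobeniusBicomodules.

Theorem theorem2p1p20 (k : comNzRingType) (A B : algType k)
    (C : coring A) (D : coring B) (flC : flat C) (flD : flat D)
    (X : bicomod C D) (L : bicomod D C) :
  [<->
    (* (i) *)
    frobenius_pair (cotens_functor flD X) (cotens_functor flC L);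
    (* (ii) *)
    frobenius_functor (cotens_functor flD X) /\
      exists h : cohom X, bicomod_iso (cohom_bicomod h) L;
    (* (iii) *)
    exists (F : functor (comod_cat C) (comod_cat D))
           (G : functor (comod_cat D) (comod_cat C))
           (linF : linear_functor F) (linG : linear_functor G)
           (FG : frobenius_pair F G),
      bicomod_iso (image_bicomod linF (proj1 FG)) X /\
      bicomod_iso (image_bicomod linG (proj2 FG)) L;
    (* (iv) *)
    [/\ quasi_finite L /\ injector L,
        quasi_finite X /\ injector X,
        exists h : cohom L, bicomod_iso X (cohom_bicomod h)
      & exists h : cohom X, bicomod_iso L (cohom_bicomod h)];
    (* (v) *)
    [/\ quasi_finite L,
        quasi_finite X,
        exists h : cohom L, nat_iso (cotens_functor flD X) (cohom_functor h)
      & exists h : cohom X, nat_iso (cotens_functor flC L) (cohom_functor h)] ].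
Proof.
have qf (A' B' : algType k) (D' : coring B') (N : rcomod A' D') (h : cohom N) : quasi_finite N.
  by exists h; split; exact: cohom_adj.
tfae.
- move=> FG; have [_ GF] := FG; split; first by exists (cotens_functor flC L).
  by have [h /bicomod_iso_sym iso] := cotens_adj_cohom_bicomod GF; exists h.
(* The partner [G] and the cohom functor are both left adjoint to the cotensor functor of [X], so
   [G] sends [D] to the cohom bicomodule. *)
- move=> [[G FG] [h iso]]; have [[_] [a]] := FG.
  have linG := left_adjoint_linear a (cotens_linear flD X).
  exists (cotens_functor flD X), G, (cotens_linear flD X), linG, FG.
  split; first exact: cotens_img_bicomod.
  apply: bicomod_iso_trans iso; apply: nat_iso_img_bicomod.
  exact: left_adjoint_unique (proj2 FG) (cohom_cotens_adj flD h).
(* Once [F] and [G] are identified with cotensor functors, each of these is left adjoint to the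
   other, which gives the cohom bicomodules and the injector property. *)
- move=> [F [G [linF [linG [FG [isoX isoL]]]]]].
  have isoF := image_cotens flC flD (proj2 FG) isoX.
  have isoG := image_cotens flD flC (proj1 FG) isoL.
  have adjFG : left_adjoint (cotens_functor flD X) (cotens_functor flC L).
    exact/(left_adjoint_nat_isol isoF)/(left_adjoint_nat_isor isoG)/(proj1 FG).
  have adjGF : left_adjoint (cotens_functor flC L) (cotens_functor flD X).
    exact/(left_adjoint_nat_isol isoG)/(left_adjoint_nat_isor isoF)/(proj2 FG).
  have [hL isohL] := cotens_adj_cohom_bicomod adjFG.
  have [hX isohX] := cotens_adj_cohom_bicomod adjGF.
  split; [split; first exact: qf hL|split; first exact: qf hX|by exists hL|by exists hX].
  + exact: cotens_right_adjoint_injector (conj adjFG adjGF).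
  + exact: cotens_right_adjoint_injector (conj adjGF adjFG).
- move=> [[qL injL] [qX injX] [hL isoX] [hX isoL]]; split=> //.
  + by exists hL; exact: injector_cohom_cotens.
  + by exists hX; exact: injector_cohom_cotens.
(* Each cohom functor is left adjoint to the cotensor functor of the same bicomodule. *)
- move=> [_ _ [hL isoX] [hX isoL]]; split.
  + exact: left_adjoint_nat_isol (nat_iso_sym isoX) (cohom_cotens_adj flC hL).
  + exact: left_adjoint_nat_isol (nat_iso_sym isoL) (cohom_cotens_adj flD hX).
Qed.
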